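(* For every real $\nu\ge0$ the following bounds hold. (i) For every $k\in\{2,3,\dots\}$, $$\left(\widetilde{\phi}_\nu\right)^{-1}\left(\pi\left(k-\tfrac12\right)\right)<j'_{\nu,k}<\left(\underline{\phi}_\nu\right)^{-1}\left(\pi\left(k-\tfrac12\right)\right).$$ For $k=1$, the upper bound $j'_{\nu,1}<\left(\underline{\phi}_\nu\right)^{-1}\left(\tfrac{\pi}{2}\right)$ is also valid for all $\nu\ge0$, and the lower bound $\left(\widetilde{\phi}_\nu\right)^{-1}\left(\tfrac{\pi}{2}\right)<j'_{\nu,1}$ is valid whenever $z^\star_\nu\le\frac{\pi}{2}$ (that is, roughly, numerically, for $\nu\gtrsim1.19876$). (ii) For every $k\in\mathbb{N}$, $$\left(\widetilde{\phi}_\nu\right)^{-1}(\pi k)<y'_{\nu,k}<\left(\underline{\phi}_\nu\right)^{-1}(\pi k).$$ (iii) More generally, for all $\tau\in[0,1)$ and all integers $k\ge2$, $$\left(\widetilde{\phi}_\nu\right)^{-1}\left(\pi\left(\tau+k-\tfrac12\right)\right)<c'_{\nu,\tau,k}<\left(\underline{\phi}_\nu\right)^{-1}\left(\pi\left(\tau+k-\tfrac12\right)\right).$$ For $k=1$, the upper bound $c'_{\nu,\tau,1}<\left(\underline{\phi}_\nu\right)^{-1}\left(\pi\left(\tau+\tfrac12\right)\right)$ is also valid for all $\tau\in[0,1)$. The lower bound $\left(\widetilde{\phi}_\nu\right)^{-1}\left(\pi\left(\tau+\tfrac12\right)\right)<c'_{\nu,\tau,1}$ is valid for $\nu$ such that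 $z^\star_\nu\le\pi\left(\tau+\tfrac12\right)$; in particular, if $\tau\ge\frac1\pi z^\star_0-\frac12=\frac1\pi\sqrt{\frac32}-\frac14$ ($\approx0.139848$), then it is valid for all $\nu\ge0$.
   Context: $\mathbb{N}=\{1,2,\dots\}$. $J_\nu,Y_\nu$ are the standard Bessel functions of the first and second kind of order $\nu\ge0$. $j'_{\nu,k}$ and $y'_{\nu,k}$ denote the $k$th positive zeros (in increasing order) of $J'_\nu$ and $Y'_\nu$, respectively, except that for $\nu=0$ one sets $j'_{0,1}:=0$ (so that $j'_{0,k}$, $k\ge2$, is the $(k-1)$st positive zero of $J_0'$). Define $N_\nu,\phi_\nu:(0,+\infty)\to\mathbb{R}$ by $N_\nu(x)=\sqrt{J_\nu'(x)^2+Y_\nu'(x)^2}$ and $J'_\nu(x)+\mathrm{i}Y'_\nu(x)=N_\nu(x)\left(\cos\phi_\nu(x)+\mathrm{i}\sin\phi_\nu(x)\right)$, with $\phi_\nu$ the continuous branch such that $\lim_{x\to0^+}\phi_\nu(x)=\frac{\pi}{2}$. The function $\phi_\nu$ (extended by its limit at $0$ if $\nu=0$) restricted to $[j'_{\nu,1},+\infty)$ is strictly increasing onto $\left[\frac{\pi}{2},+\infty\right)$, and $\phi_\nu^{-1}:\left[\frac{\pi}{2},+\infty\right)\to[j'_{\nu,1},+\infty)$ denotes the inverse of this restriction. For $\tau\in[0,1)$ and $k\in\mathbb{N}$, $c'_{\nu,\tau,k}:=\phi_\nu^{-1}\left(\pi\left(\tau+k-\frac12\right)\right)$, which is the $k$th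 zero (in increasing order) in $[j'_{\nu,1},+\infty)$ of $\mathcal{C}'_{\nu,\tau}(x)=J'_\nu(x)\cos(\pi\tau)+Y'_\nu(x)\sin(\pi\tau)$. For $x>\nu\ge0$ define $$\underline{\phi}_\nu(x):=\sqrt{x^2-\nu^2}-\nu\arccos\frac{\nu}{x}+\frac{\pi}{4},\qquad \widetilde{\phi}_\nu(x):=\underline{\phi}_\nu(x)+\frac{9x^2-2\nu^2}{24(x^2-\nu^2)^{3/2}},$$ with $\underline{\phi}_\nu$ extended continuously to $x=\nu$ by $\underline{\phi}_\nu(\nu)=\frac{\pi}{4}$. The function $\underline{\phi}_\nu$ is strictly increasing, with inverse $\left(\underline{\phi}_\nu\right)^{-1}:\left[\frac{\pi}{4},+\infty\right)\to[\nu,+\infty)$. The polynomial $p_\nu(x):=8x^6-3(8\nu^2+1)x^4+4\nu^2(6\nu^2-1)x^2-8\nu^6$ has exactly one root in $(\nu,+\infty)$, denoted $x^\star_\nu$; one has $\widetilde{\phi}'_\nu(x)=\frac{p_\nu(x)}{8x(x^2-\nu^2)^{5/2}}>0$ for $x>x^\star_\nu$. Set $z^\star_\nu:=\widetilde{\phi}_\nu(x^\star_\nu)$. Then $\left(\widetilde{\phi}_\nu\right)^{-1}:[z^\star_\nu,+\infty)\to[x^\star_\nu,+\infty)$ denotes the inverse of $\widetilde{\phi}_\nu$ restricted to $[x^\star_\nu,+\infty)$. *)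

(* Defs.v *)
From Stdlib Require Import Reals Factorial List ClassicalEpsilon.
From Coquelicot Require Import Coquelicot.
Open Scope R_scope.

(* Stdlib reals and Coquelicot.  "The x such that ..." is rendered by
   Hilbert's epsilon [the_real]: it denotes an arbitrary, unspecified real unless
   existence is proved. *)
Definition the_real (P : R -> Prop) : R := epsilon (inhabits 0) P.

Definition inverse_on (D : R -> Prop) (f : R -> R) (y : R) : R :=
  the_real (fun x => D x /\ f x = y).

(* [x] is the [k]th zero of [f] in (0,+oo), in increasing order, k >= 1:
   exactly k - 1 zeros precede it. *)
Definition is_kth_positive_zero (f : R -> R) (k : nat) (x : R) : Prop :=
  0 < x /\ f x = 0 /\
  exists l : list R,
    NoDup l /\ S (length l) = k /\
    forall z, In z l <-> (0 < z < x /\ f z = 0).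

Definition kth_positive_zero (f : R -> R) (k : nat) : R :=
  the_real (is_kth_positive_zero f k).

(* Reciprocal Gamma function on the whole real line, by Gauss's product
   1/Gamma(z) = lim_n z (z+1) ... (z+n) / (n! n^z); it vanishes at z = 0, -1, -2, ... *)
Definition inv_Gamma (z : R) : R :=
  real (Lim_seq (fun n =>
    prod_f_R0 (fun i => z + INR i) n / (INR (fact n) * Rpower (INR n) z))).

(* J_nu(x) = (x/2)^nu sum_m (-1)^m (x^2/4)^m / (m! Gamma(nu+m+1)), for x > 0 and
   any real order nu. *)
Definition bessel_J (nu x : R) : R :=
  Rpower (x / 2) nu *
  PSeries (fun m => (-1) ^ m / INR (fact m) * inv_Gamma (nu + INR m + 1)) (x ^ 2 / 4).

Definition bessel_Y_quotient (nu x : R) : R :=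
  (bessel_J nu x * cos (nu * PI) - bessel_J (- nu) x) / sin (nu * PI).

(* sin (nu * PI) = 0 exactly when nu is an integer; Y_nu is then the limit of the
   quotient in the order. *)
Definition bessel_Y (nu x : R) : R :=
  if Req_EM_T (sin (nu * PI)) 0
  then real (Lim (fun mu => bessel_Y_quotient mu x) nu)
  else bessel_Y_quotient nu x.

Definition dJ (nu x : R) : R := Derive (bessel_J nu) x.
Definition dY (nu x : R) : R := Derive (bessel_Y nu) x.

(* j'_{nu,k} and y'_{nu,k}, k >= 1, with the convention j'_{0,1} = 0. *)
Definition j' (nu : R) (k : nat) : R :=
  if Req_EM_T nu 0
  then (if Nat.eqb k 1 then 0 else kth_positive_zero (dJ nu) (k - 1))
  else kth_positive_zero (dJ nu) k.

Definition y' (nu : R) (k : nat) : R := kth_positive_zero (dY nu) k.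

Definition modulus (nu x : R) : R := sqrt (dJ nu x ^ 2 + dY nu x ^ 2).

Definition is_phase (nu : R) (phi : R -> R) : Prop :=
  (forall x, 0 < x ->
     continuous phi x /\
     dJ nu x = modulus nu x * cos (phi x) /\
     dY nu x = modulus nu x * sin (phi x)) /\
  filterlim phi (at_right 0) (locally (PI / 2)).

(* phi_nu, extended to 0 by its limit PI / 2; the extension only matters for nu = 0,
   since j'_{nu,1} > 0 otherwise. *)
Definition phase (nu x : R) : R :=
  if Rle_dec x 0 then PI / 2
  else epsilon (inhabits (fun _ : R => 0)) (is_phase nu) x.

Definition phase_inv (nu : R) : R -> R :=
  inverse_on (fun x => j' nu 1 <= x) (phase nu).

Definition c' (nu tau : R) (k : nat) : R :=
  phase_inv nu (PI * (tau + INR k - 1 / 2)).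

(* At x = nu this takes the value PI / 4 of the continuous extension, including for
   nu = 0, where the totalized nu / x is multiplied by 0. *)
Definition phi_lower (nu x : R) : R :=
  sqrt (x ^ 2 - nu ^ 2) - nu * acos (nu / x) + PI / 4.

Definition phi_lower_inv (nu : R) : R -> R :=
  inverse_on (fun x => nu <= x) (phi_lower nu).

Definition phi_tilde (nu x : R) : R :=
  phi_lower nu x +
  (9 * x ^ 2 - 2 * nu ^ 2) / (24 * Rpower (x ^ 2 - nu ^ 2) (3 / 2)).

Definition p_poly (nu x : R) : R :=
  8 * x ^ 6 - 3 * (8 * nu ^ 2 + 1) * x ^ 4
  + 4 * nu ^ 2 * (6 * nu ^ 2 - 1) * x ^ 2 - 8 * nu ^ 6.

Definition x_star (nu : R) : R := the_real (fun x => nu < x /\ p_poly nu x = 0).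

Definition z_star (nu : R) : R := phi_tilde nu (x_star nu).

Definition phi_tilde_inv (nu : R) : R -> R :=
  inverse_on (fun x => x_star nu <= x) (phi_tilde nu).

(* Main.v *)
Require Import Defs.
From Stdlib Require Import Reals Factorial ZArith Machin Ranalysis5 Lra Lia Psatz List ClassicalEpsilon.
From Coquelicot Require Import Coquelicot.
Open Scope R_scope.

(** The zeros in question are the points where the phase [phi] of [(J', Y')] takes
    prescribed values, and the claimed bounds are values of the inverses of [phi_lower] and
    [phi_tilde] at the same arguments. So everything follows from the enclosure
    [phi_lower < phi] on [(nu, +oo)] and [phi < phi_tilde] on [[x_star, +oo)], together with
    [z_star nu <= z_star 0], which is about [2.01]: this makes the levels in question, from
    [PI] on, lie above [z_star] ([phase_enclosure], [z_star_le_0]).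

    The enclosure is a Sturm comparison started at infinity. In the variable
    [s = phi_lower x] the function [v = x J' / (x^2 - nu^2)^(1/4)] satisfies
    [v'' + (1 - q) v = 0] with [q > 0] decreasing to [0], and so does its analogue for [Y'].
    Given a point, rotate the pair so that one solution [v] vanishes there, and follow
    Pruefer's angle of [v]. It equals the rotated phase at the point, it stays within [PI] of it,
    and it moves more slowly than [s], by [q cos^2]; both are asymptotic to [s], so
    [s < phi] ([phase_comparison], [phi_lower_lt_phase]). For the upper bound one notes that
    [phi_tilde] is [s] plus half the integral of [q] from [s] to infinity. The
    comparison equation is then the one solved by [cos (phi_tilde)] over the square root of
    [1 - q / 2]; its potential is below [1 - q] because [q'' > q^2]
    ([phase_lt_phi_tilde]).

    The comparison determines [phi] only up to a multiple of [2 PI], which must be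
    matched with the normalization of the phase at [0]. On [(0, nu]] one has [J' > 0], and
    [Y' / J'] is monotone with logarithmic divergence at least, so the phase stays in
    [(- PI / 2, PI / 2)] there. Since [phi_lower = PI / 4] at [nu] and [phi_tilde = z_star]
    at [x_star], both bounds together leave only the multiple [0] ([phase_exists],
    [phase_enclosure]).

    It remains to know that [J] and [Y], defined by a power series with Gauss's product for
    the reciprocal Gamma function and by a limit in the order, oscillate at infinity like
    [A cos] and [A sin] of [x - nu PI / 2 - PI / 4] with one constant [A > 0]. The
    Laplace integral of [e^(i x - x u) (u (u - 2 i))^(nu - 1/2)], times [x^nu], solves
    Bessel's equation, and its behaviour is explicit both at infinity and at [0]. For
    [nu >= 3/2] comparison at [0] shows that [J] is a multiple of its imaginary part
    ([J_as_hankel]). The factor depends on [nu] through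
    [Gam (2 nu + 1) / (4^nu Gam (nu + 1/2) Gam (nu + 1))], which is constant by the
    duplication formula. The recurrence in [nu] extends the asymptotics to all real
    orders ([bessel_asym_J]), hence to [Y] at orders where the defining quotient makes
    sense; and since the Laplace integral is continuous in [nu], the limit that defines [Y] at
    integer orders is again a multiple of its real part ([Y_as_hankel]). *)

(** * Integrals over the whole line *)

(** Only absolutely convergent integrals of fast decreasing functions occur
    below, so symmetric truncations are enough. *)
Definition lineint (f : R -> R) : R :=
  real (Lim_seq (fun n => RInt f (- INR n) (INR n))).

Definition decay_bound (M : R) (f : R -> R) : Prop :=
  forall y, Rabs (f y) <= M / (1 + y ^ 2).

(** The dominating function has the explicit primitive [atan]. *)
Definition decays (f : R -> R) : Prop :=
  (forall y, continuous f y) /\ exists M, decay_bound M f.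

Lemma one_sqr_pos y : 0 < 1 + y ^ 2.
Proof. nra. Qed.

Lemma decay_bound_nonneg M f : decay_bound M f -> 0 <= M.
Proof.
  intros H. specialize (H 0). pose proof (Rabs_pos (f 0)).
  replace (M / (1 + 0 ^ 2)) with M in H by field. lra.
Qed.

Lemma continuous_ex_RInt (f : R -> R) a b :
  (forall y, continuous f y) -> ex_RInt f a b.
Proof. intros H. apply (@ex_RInt_continuous R_CompleteNormedModule). auto. Qed.

Lemma continuous_cauchy y : continuous (fun y => / (1 + y ^ 2)) y.
Proof.
  apply (ex_derive_continuous (V := R_NormedModule)).
  auto_derive. pose proof (one_sqr_pos y). simpl in *. lra.
Qed.

Lemma RInt_cauchy_le M n : 0 <= M ->
  RInt (fun y => M * / (1 + y ^ 2)) (- INR n) (INR n) <= M * PI.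
Proof.
  intros HM.
  rewrite (is_RInt_unique _ _ _ (M * (atan (INR n) - atan (- INR n)))).
  - pose proof (atan_bound (INR n)). pose proof (atan_bound (- INR n)).
    apply Rmult_le_compat_l; lra.
  - apply (is_RInt_scal (V := R_NormedModule) (fun y => / (1 + y ^ 2))).
    apply (is_RInt_derive (V := R_CompleteNormedModule) atan).
    + intros x _. apply is_derive_Reals.
      apply derivable_pt_lim_atan.
    + intros; apply continuous_cauchy.
Qed.

Lemma lineint_conv_nonneg f M : (forall y, continuous f y) -> (forall y, 0 <= f y) ->
  decay_bound M f -> ex_finite_lim_seq (fun n => RInt f (- INR n) (INR n)).
Proof.
  intros Hc Hp Hb. pose proof (decay_bound_nonneg _ _ Hb) as HM.
  apply (ex_finite_lim_seq_incr _ (M * PI)).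
  - intros n. rewrite S_INR. pose proof (pos_INR n).
    assert (E : RInt f (- (INR n + 1)) (INR n + 1) =
      RInt f (- (INR n + 1)) (- INR n) + RInt f (- INR n) (INR n) + RInt f (INR n) (INR n + 1)).
    { rewrite <- (RInt_Chasles f (- (INR n + 1)) (INR n) (INR n + 1));
        try (apply continuous_ex_RInt; auto).
      rewrite <- (RInt_Chasles f (- (INR n + 1)) (- INR n) (INR n));
        try (apply continuous_ex_RInt; auto). reflexivity. }
    rewrite E.
    assert (0 <= RInt f (- (INR n + 1)) (- INR n))
      by (apply RInt_ge_0; auto; [lra | apply continuous_ex_RInt; auto]).
    assert (0 <= RInt f (INR n) (INR n + 1))
      by (apply RInt_ge_0; auto; [lra | apply continuous_ex_RInt; auto]).
    lra.
  - intros n. apply Rle_trans with (2 := RInt_cauchy_le M n HM).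
    pose proof (pos_INR n).
    apply RInt_le; [lra | apply continuous_ex_RInt; auto | | ].
    + apply continuous_ex_RInt. intros y.
      apply (continuous_scal_r (V := R_NormedModule)), continuous_cauchy.
    + intros x _. specialize (Hb x). rewrite Rabs_pos_eq in Hb by auto. exact Hb.
Qed.

Lemma decays_cauchy M : decays (fun y => M * / (1 + y ^ 2)).
Proof.
  split.
  - intros y. apply (continuous_scal_r (V := R_NormedModule)), continuous_cauchy.
  - exists (Rabs M). intros y. rewrite Rabs_mult, Rabs_inv.
    rewrite (Rabs_pos_eq (1 + y ^ 2)) by (pose proof (one_sqr_pos y); lra).
    apply Rle_refl.
Qed.

Lemma decays_scal k f : decays f -> decays (fun y => k * f y).
Proof.
  intros [Hc [M Hb]]. split.
  - intros y. apply (continuous_scal_r (V := R_NormedModule)), Hc.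
  - exists (Rabs k * M). intros y. rewrite Rabs_mult. specialize (Hb y).
    unfold Rdiv in *. rewrite Rmult_assoc. apply Rmult_le_compat_l; auto using Rabs_pos.
Qed.

Lemma decays_plus f g : decays f -> decays g -> decays (fun y => f y + g y).
Proof.
  intros [Hc [M Hb]] [Hc' [M' Hb']]. split.
  - intros y. apply (continuous_plus (V := R_NormedModule)); auto.
  - exists (M + M'). intros y. specialize (Hb y). specialize (Hb' y).
    eapply Rle_trans; [apply Rabs_triang|]. unfold Rdiv in *. lra.
Qed.

Lemma decays_minus f g : decays f -> decays g -> decays (fun y => f y - g y).
Proof.
  intros [Hc [M Hb]] [Hc' [M' Hb']]. split.
  - intros y. apply (continuous_minus (V := R_NormedModule)); auto.
  - exists (M + M'). intros y. specialize (Hb y). specialize (Hb' y).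
    unfold Rminus. eapply Rle_trans; [apply Rabs_triang|]. rewrite Rabs_Ropp.
    unfold Rdiv in *. lra.
Qed.

(** A decaying function is the difference of two nonnegative ones, for which the
    truncated integrals increase and stay bounded. *)
Lemma is_lim_lineint f : decays f ->
  is_lim_seq (fun n => RInt f (- INR n) (INR n)) (lineint f).
Proof.
  intros Hf. assert (Hf' := Hf). destruct Hf' as [Hc [M Hb]].
  assert (E : ex_finite_lim_seq (fun n => RInt f (- INR n) (INR n))).
  { pose (g := fun y => M * / (1 + y ^ 2)).
    assert (HM := decay_bound_nonneg _ _ Hb).
    assert (Hg : decays g) by apply decays_cauchy.
    assert (A1 : ex_finite_lim_seq (fun n => RInt (fun y => f y + g y) (- INR n) (INR n))).
    { apply lineint_conv_nonneg with (2 * M).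
      - apply (decays_plus f g Hf Hg).
      - intros y. specialize (Hb y). unfold g.
        unfold Rdiv in Hb. apply Rabs_le_between in Hb. lra.
      - intros y. specialize (Hb y). unfold g, Rdiv in *.
        apply Rabs_le_between in Hb. apply Rabs_le_between. lra. }
    assert (A2 : ex_finite_lim_seq (fun n => RInt g (- INR n) (INR n))).
    { apply lineint_conv_nonneg with M.
      - apply Hg.
      - intros y. unfold g. pose proof (Rinv_0_lt_compat _ (one_sqr_pos y)). nra.
      - intros y. unfold g, Rdiv. rewrite Rabs_pos_eq; [lra|].
        pose proof (Rinv_0_lt_compat _ (one_sqr_pos y)). nra. }
    destruct A1 as [l1 A1], A2 as [l2 A2]. exists (l1 - l2).
    apply is_lim_seq_ext with (fun n => RInt (fun y => f y + g y) (- INR n) (INR n)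
       - RInt g (- INR n) (INR n)).
    - intros n. rewrite (RInt_plus (V := R_CompleteNormedModule) f g);
        try (apply continuous_ex_RInt; auto; apply Hg).
      unfold plus; simpl. ring.
    - apply is_lim_seq_minus'; auto. }
  unfold lineint. apply Lim_seq_correct'. exact E.
Qed.

Lemma lineint_unique f (l : R) :
  is_lim_seq (fun n => RInt f (- INR n) (INR n)) l -> lineint f = l.
Proof. intros H. unfold lineint. rewrite (is_lim_seq_unique _ _ H). reflexivity. Qed.

Lemma lineint_ext f g : (forall y, f y = g y) -> lineint f = lineint g.
Proof.
  intros H. unfold lineint. f_equal. apply Lim_seq_ext. intros n.
  apply RInt_ext. auto.
Qed.

Lemma lineint_plus f g : decays f -> decays g -> lineint (fun y => f y + g y) = lineint f + lineint g.
Proof.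
  intros Hf Hg. apply lineint_unique.
  apply is_lim_seq_ext with (fun n => RInt f (- INR n) (INR n) + RInt g (- INR n) (INR n)).
  - intros n. symmetry. apply (RInt_plus (V := R_CompleteNormedModule) f g);
      apply continuous_ex_RInt; [apply Hf | apply Hg].
  - apply is_lim_seq_plus'; apply is_lim_lineint; auto.
Qed.

Lemma lineint_scal k f : decays f -> lineint (fun y => k * f y) = k * lineint f.
Proof.
  intros Hf. apply lineint_unique.
  apply is_lim_seq_ext with (fun n => k * RInt f (- INR n) (INR n)).
  - intros n. symmetry. apply (RInt_scal (V := R_CompleteNormedModule) f).
    apply continuous_ex_RInt; apply Hf.
  - apply (is_lim_seq_scal_l _ k (lineint f)). apply is_lim_lineint; auto.
Qed.

Lemma lineint_minus f g : decays f -> decays g -> lineint (fun y => f y - g y) = lineint f - lineint g.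
Proof.
  intros Hf Hg. rewrite (lineint_ext _ (fun y => f y + (-1) * g y)) by (intros; ring).
  rewrite lineint_plus, lineint_scal; auto using decays_scal. ring.
Qed.

Lemma lineint_le f g : decays f -> decays g -> (forall y, f y <= g y) -> lineint f <= lineint g.
Proof.
  intros Hf Hg H.
  apply (is_lim_seq_le (fun n => RInt f (- INR n) (INR n)) (fun n => RInt g (- INR n) (INR n))
    (lineint f) (lineint g)); try (apply is_lim_lineint; auto).
  intros n. pose proof (pos_INR n).
  apply RInt_le; [lra | apply continuous_ex_RInt, Hf | apply continuous_ex_RInt, Hg | auto].
Qed.

Lemma lineint_abs_le f g : decays f -> decays g -> (forall y, Rabs (f y) <= g y) ->
  Rabs (lineint f) <= lineint g.
Proof.
  intros Hf Hg H. apply Rabs_le_between. split.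
  - assert (lineint (fun y => (-1) * g y) <= lineint f).
    { apply lineint_le; auto using decays_scal. intros y. specialize (H y).
      apply Rabs_le_between in H. lra. }
    rewrite lineint_scal in H0; auto. lra.
  - apply lineint_le; auto. intros y. specialize (H y). apply Rabs_le_between in H. lra.
Qed.

Lemma lineint_cauchy_le M : 0 <= M -> lineint (fun y => M * / (1 + y ^ 2)) <= M * PI.
Proof.
  intros HM.
  apply (is_lim_seq_le (fun n => RInt (fun y => M * / (1 + y ^ 2)) (- INR n) (INR n))
    (fun _ => M * PI) (lineint (fun y => M * / (1 + y ^ 2))) (M * PI)).
  - intros n. apply RInt_cauchy_le; auto.
  - apply is_lim_lineint, decays_cauchy.
  - apply is_lim_seq_const.
Qed.

Lemma lineint_bound f M : decays f -> decay_bound M f -> Rabs (lineint f) <= M * PI.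
Proof.
  intros Hf Hb. eapply Rle_trans.
  - apply (lineint_abs_le f (fun y => M * / (1 + y ^ 2))); auto using decays_cauchy.
  - apply lineint_cauchy_le. eapply decay_bound_nonneg; eauto.
Qed.

Lemma lineint_pos f : decays f -> (forall y, 0 < f y) -> 0 < lineint f.
Proof.
  intros Hf H.
  assert (A : 0 < RInt f (- INR 1) (INR 1)).
  { apply RInt_gt_0; simpl; auto; try lra. intros; apply Hf. }
  apply Rlt_le_trans with (1 := A).
  apply (is_lim_seq_le_loc (fun _ => RInt f (- INR 1) (INR 1))
    (fun n => RInt f (- INR n) (INR n)) (RInt f (- INR 1) (INR 1)) (lineint f)).
  - exists 1%nat. intros n Hn.
    assert (INR 1 <= INR n) by (apply le_INR; auto).
    assert (Hc := proj1 Hf).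
    rewrite <- (RInt_Chasles f (- INR n) (INR 1) (INR n)); try (apply continuous_ex_RInt; auto).
    rewrite <- (RInt_Chasles f (- INR n) (- INR 1) (INR 1)); try (apply continuous_ex_RInt; auto).
    unfold plus; simpl (INR 1) in *; simpl.
    assert (0 <= RInt f (- INR n) (-(1)))
      by (apply RInt_ge_0; [lra | apply continuous_ex_RInt; auto | intros; apply Rlt_le, H]).
    assert (0 <= RInt f 1 (INR n))
      by (apply RInt_ge_0; [lra | apply continuous_ex_RInt; auto | intros; apply Rlt_le, H]).
    lra.
  - apply is_lim_seq_const.
  - apply is_lim_lineint; auto.
Qed.

Lemma is_lim_seq_cauchy_tail M : is_lim_seq (fun n => M / (1 + INR n ^ 2)) 0.
Proof.
  apply is_lim_seq_abs_0.
  apply (is_lim_seq_le_le_loc (fun _ => 0) _ (fun n => Rabs M * / INR n) 0).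
  - exists 1%nat. intros n Hn. split; [apply Rabs_pos|].
    assert (1 <= INR n) by (change 1 with (INR 1); apply le_INR; auto).
    unfold Rdiv. rewrite Rabs_mult. apply Rmult_le_compat_l; [apply Rabs_pos|].
    rewrite Rabs_pos_eq by (apply Rlt_le, Rinv_0_lt_compat; nra).
    apply Rinv_le_contravar; nra.
  - apply is_lim_seq_const.
  - replace (Finite 0) with (Rbar_mult (Rabs M) (Finite 0)) by (simpl; f_equal; ring).
    apply is_lim_seq_scal_l. 
    replace (Finite 0) with (Rbar_inv p_infty) by reflexivity.
    apply is_lim_seq_inv; [apply is_lim_seq_INR | discriminate].
Qed.

(** The boundary terms at both ends vanish. *)
Lemma lineint_derivative G g M : (forall y, is_derive G y (g y)) ->
  (forall y, continuous g y) -> decay_bound M G -> lineint g = 0.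
Proof.
  intros HG Hg Hb. apply lineint_unique.
  apply is_lim_seq_ext with (fun n => G (INR n) - G (- INR n)).
  - intros n. symmetry. apply is_RInt_unique.
    apply (is_RInt_derive (V := R_CompleteNormedModule) G); auto.
  - replace (Finite 0) with (Finite (0 - 0)) by (f_equal; ring).
    apply is_lim_seq_minus'; apply is_lim_seq_abs_0;
    apply (is_lim_seq_le_le (fun _ => 0) _ (fun n => M / (1 + INR n ^ 2)) 0);
      try apply is_lim_seq_const; try apply is_lim_seq_cauchy_tail;
      intros n; (split; [apply Rabs_pos|]).
    + apply Hb.
    + specialize (Hb (- INR n)). replace ((- INR n) ^ 2) with (INR n ^ 2) in Hb by ring. auto.
Qed.

Lemma ex_derive_continuity_pt (f : R -> R) x : ex_derive f x -> continuity_pt f x.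
Proof.
  intros H. apply continuity_pt_filterlim.
  exact (ex_derive_continuous (V := R_NormedModule) f x H).
Qed.

Lemma mean_value (f df : R -> R) a b :
  (forall x, Rmin a b <= x <= Rmax a b -> is_derive f x (df x)) ->
  exists c, Rmin a b <= c <= Rmax a b /\ f b - f a = df c * (b - a).
Proof.
  intros H. destruct (MVT_gen f a b df) as [c Hc].
  - intros x Hx. apply H. lra.
  - intros x Hx. apply ex_derive_continuity_pt. exists (df x). auto.
  - exists c. auto.
Qed.

Lemma cauchy_shift y h xi : Rabs (xi - y) <= Rabs h ->
  / (1 + xi ^ 2) <= 2 * (1 + h ^ 2) * / (1 + y ^ 2).
Proof.
  intros H. pose proof (one_sqr_pos xi). pose proof (one_sqr_pos y).
  assert ((xi - y) ^ 2 <= h ^ 2).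
  { rewrite <- (pow2_abs (xi - y)), <- (pow2_abs h).
    apply pow_incr. split; auto using Rabs_pos. }
  apply Rmult_le_reg_l with (1 + xi ^ 2); auto. rewrite Rinv_r by lra.
  apply Rmult_le_reg_r with (1 + y ^ 2); auto.
  replace ((1 + xi ^ 2) * (2 * (1 + h ^ 2) * / (1 + y ^ 2)) * (1 + y ^ 2))
    with (2 * (1 + h ^ 2) * (1 + xi ^ 2)) by (field; lra).
  assert (y ^ 2 <= 2 * xi ^ 2 + 2 * h ^ 2) by (pose proof (pow2_ge_0 (2 * xi - y)); nra).
  assert (0 <= h ^ 2 * xi ^ 2) by (apply Rmult_le_pos; apply pow2_ge_0). nra.
Qed.

Lemma decay_bound_shift M h f : decay_bound M f ->
  decay_bound (M * (2 * (1 + h ^ 2))) (fun y => f (y + h)).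
Proof.
  intros Hb y. pose proof (decay_bound_nonneg _ _ Hb).
  eapply Rle_trans; [apply Hb|]. unfold Rdiv. rewrite Rmult_assoc.
  apply Rmult_le_compat_l; auto. apply cauchy_shift.
  replace (y + h - y) with h by ring. apply Rle_refl.
Qed.

Lemma decays_shift h f : decays f -> decays (fun y => f (y + h)).
Proof.
  intros [Hc [M Hb]]. split.
  - intros y. apply (continuous_comp (fun y => y + h) f); auto.
    apply (ex_derive_continuous (V := R_NormedModule)). auto_derive; auto.
  - eexists. apply decay_bound_shift; eauto.
Qed.

(** [y |-> RInt f y (y + h)] decays and is a primitive of the difference. *)
Lemma lineint_shift h f : decays f -> lineint (fun y => f (y + h)) = lineint f.
Proof.
  intros Hf. assert (Hs := decays_shift h f Hf).
  enough (lineint (fun y => f (y + h) - f y) = 0) by (rewrite lineint_minus in H; auto; lra).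
  assert (Hf' := Hf). destruct Hf' as [Hc [M Hb]].
  pose proof (decay_bound_nonneg _ _ Hb) as HM.
  assert (HP : forall y, is_derive (RInt f 0) y (f y)).
  { intros y. apply (is_derive_RInt f _ 0); auto.
    apply filter_forall. intros z. apply (RInt_correct (V := R_CompleteNormedModule)).
    apply continuous_ex_RInt; auto. }
  apply lineint_derivative with (G := fun y => RInt f 0 (y + h) - RInt f 0 y)
     (M := Rabs h * (M * (2 * (1 + h ^ 2)))).
  - intros y. apply (is_derive_minus (V := R_NormedModule)
      (fun y => RInt f 0 (y + h))); auto.
    replace (f (y + h)) with (1 * f (y + h)) by ring.
    apply (is_derive_comp (V := R_NormedModule) (RInt f 0) (fun y => y + h)); auto.
    auto_derive; auto.
  - intros y. apply (continuous_minus (V := R_NormedModule)); auto. apply Hs.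
  - intros y.
    destruct (mean_value (RInt f 0) f y (y + h)) as [c [Hcc ->]]; auto.
    replace (y + h - y) with h by ring. rewrite Rabs_mult, Rmult_comm.
    unfold Rdiv. rewrite Rmult_assoc. apply Rmult_le_compat_l; auto using Rabs_pos.
    eapply Rle_trans; [apply Hb|]. unfold Rdiv. rewrite Rmult_assoc.
    apply Rmult_le_compat_l; auto. apply cauchy_shift.
    revert Hcc. unfold Rmin, Rmax, Rabs.
    repeat destruct Rle_dec; repeat destruct Rcase_abs; intros; lra.
Qed.

Lemma lineint_lipschitz (f f1 : R -> R -> R) a b M :
  (forall p, Rmin a b <= p <= Rmax a b -> decays (f p)) ->
  (forall p y, Rmin a b <= p <= Rmax a b -> is_derive (fun p => f p y) p (f1 p y)) ->
  (forall p, Rmin a b <= p <= Rmax a b -> decay_bound M (f1 p)) ->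
  Rabs (lineint (f b) - lineint (f a)) <= M * PI * Rabs (b - a).
Proof.
  intros Hd H1 Hb.
  assert (Ha : Rmin a b <= a <= Rmax a b) by (split; [apply Rmin_l | apply Rmax_l]).
  assert (Hbb : Rmin a b <= b <= Rmax a b) by (split; [apply Rmin_r | apply Rmax_r]).
  rewrite <- lineint_minus; auto.
  replace (M * PI * Rabs (b - a)) with (M * Rabs (b - a) * PI) by ring.
  apply lineint_bound.
  - apply decays_minus; auto.
  - intros y. destruct (mean_value (fun p => f p y) (fun p => f1 p y) a b) as [c [Hc E]].
    + intros; apply H1; auto.
    + rewrite E, Rabs_mult. specialize (Hb c Hc y). unfold Rdiv in *.
      pose proof (Rabs_pos (b - a)). nra.
Qed.

(** Differentiation under the integral sign: the second derivative in the parameter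
    controls the remainder of the first-order expansion. *)
Lemma is_derive_lineint (f f1 f2 : R -> R -> R) p0 (eps : posreal) M :
  (forall p, Rabs (p - p0) < eps -> decays (f p)) -> decays (f1 p0) ->
  (forall p y, Rabs (p - p0) < eps -> is_derive (fun p => f p y) p (f1 p y)) ->
  (forall p y, Rabs (p - p0) < eps -> is_derive (fun p => f1 p y) p (f2 p y)) ->
  (forall p, Rabs (p - p0) < eps -> decay_bound M (f2 p)) ->
  is_derive (fun p => lineint (f p)) p0 (lineint (f1 p0)).
Proof.
  intros Hd Hd1 H1 H2 Hb.
  assert (H0 : Rabs (p0 - p0) < eps)
    by (rewrite Rminus_diag, Rabs_R0; apply cond_pos).
  assert (HM : 0 <= M) by (eapply decay_bound_nonneg; eauto).
  assert (Key : forall p, Rabs (p - p0) < eps ->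
     Rabs (lineint (f p) - lineint (f p0) - (p - p0) * lineint (f1 p0)) <= M * PI * (p - p0) ^ 2).
  { intros p Hp. rewrite <- lineint_scal, <- !lineint_minus; auto using decays_scal.
    2:{ apply decays_minus; auto. }
    replace (M * PI * (p - p0) ^ 2) with (M * (p - p0) ^ 2 * PI) by ring.
    assert (forall q, Rmin p0 p <= q <= Rmax p0 p -> Rabs (q - p0) <= Rabs (p - p0)).
    { intros q. unfold Rmin, Rmax, Rabs. repeat destruct Rle_dec;
      repeat destruct Rcase_abs; intros; lra. }
    apply lineint_bound.
    - apply (decays_minus (fun y => f p y - f p0 y)); auto using decays_minus, decays_scal.
    - intros y.
      destruct (mean_value (fun p => f p y) (fun p => f1 p y) p0 p) as [c [Hc E]].
      { intros q Hq. apply H1. apply Rle_lt_trans with (2 := Hp). auto. }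
      rewrite E.
      destruct (mean_value (fun p => f1 p y) (fun p => f2 p y) p0 c) as [d [Hdd E2]].
      { intros q Hq. apply H2. apply Rle_lt_trans with (2 := Hp). apply H.
        revert Hq Hc. unfold Rmin, Rmax. repeat destruct Rle_dec; intros; lra. }
      replace (f1 c y * (p - p0) - (p - p0) * f1 p0 y)
        with (f2 d y * (c - p0) * (p - p0)) by (rewrite <- E2; ring).
      assert (Hd3 : Rabs (d - p0) < eps).
      { apply Rle_lt_trans with (2 := Hp). apply H.
        revert Hdd Hc. unfold Rmin, Rmax. repeat destruct Rle_dec; intros; lra. }
      specialize (Hb d Hd3 y). specialize (H c Hc).
      rewrite !Rabs_mult. rewrite <- (pow2_abs (p - p0)).
      unfold Rdiv in *.
      pose proof (Rabs_pos (c - p0)). pose proof (Rabs_pos (p - p0)).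
      pose proof (Rabs_pos (f2 d y)).
      apply Rle_trans with ((M * / (1 + y ^ 2)) * Rabs (p - p0) * Rabs (p - p0)); [|right; ring].
      apply Rmult_le_compat_r; auto. apply Rmult_le_compat; auto. }
  apply is_derive_Reals. intros e He.
  assert (HK : 0 < M * PI + 1) by (pose proof PI_RGT_0; nra).
  assert (Hdel : 0 < Rmin eps (e / (M * PI + 1))).
  { apply Rmin_pos; [apply cond_pos | apply Rdiv_lt_0_compat; auto]. }
  exists (mkposreal _ Hdel). simpl. intros h Hh0 Hh.
  assert (Hh1 : Rabs h < eps) by (eapply Rlt_le_trans; [apply Hh | apply Rmin_l]).
  assert (Hh2 : Rabs h < e / (M * PI + 1)) by (eapply Rlt_le_trans; [apply Hh | apply Rmin_r]).
  specialize (Key (p0 + h)). replace (p0 + h - p0) with h in Key by ring.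
  specialize (Key Hh1).
  replace ((lineint (f (p0 + h)) - lineint (f p0)) / h - lineint (f1 p0))
    with ((lineint (f (p0 + h)) - lineint (f p0) - h * lineint (f1 p0)) / h) by (field; auto).
  unfold Rdiv at 1. rewrite Rabs_mult, Rabs_inv.
  assert (Hhp : 0 < Rabs h) by (apply Rabs_pos_lt; auto).
  apply Rmult_lt_reg_r with (Rabs h); auto.
  rewrite Rmult_assoc, Rinv_l, Rmult_1_r by lra.
  apply Rle_lt_trans with (1 := Key).
  rewrite <- pow2_abs. simpl. rewrite Rmult_1_r, <- Rmult_assoc.
  apply Rmult_lt_compat_r; auto.
  apply Rlt_trans with ((M * PI + 1) * Rabs h); [nra|].
  apply Rmult_lt_reg_r with (/ (M * PI + 1)); [apply Rinv_0_lt_compat; auto|].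
  replace ((M * PI + 1) * Rabs h * / (M * PI + 1)) with (Rabs h) by (field; lra).
  exact Hh2.
Qed.

(** * The Gamma function *)

Lemma exp_ge_quadratic t : 0 <= t -> 1 + t ^ 2 / 2 <= exp t.
Proof.
  intros Ht.
  destruct (mean_value (fun t => exp t - t ^ 2 / 2) (fun t => exp t - t) 0 t) as [u [Hu E]].
  - intros x _. auto_derive; auto. field.
  - rewrite exp_0 in E. rewrite Rmin_left in Hu by lra. pose proof (exp_ineq1_le u).
    assert (0 <= (exp u - u) * (t - 0)) by (apply Rmult_le_pos; lra). lra.
Qed.

Lemma exp_dominates_square c y : 0 < c -> 1 + y ^ 2 <= (1 + 2 / c ^ 2) * exp (c * Rabs y).
Proof.
  intros Hc. pose proof (Rabs_pos y) as Hy.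
  pose proof (exp_ge_quadratic (c * Rabs y) ltac:(nra)) as A.
  rewrite <- (pow2_abs y). set (t := Rabs y) in *.
  assert (0 < c ^ 2) by nra.
  assert (E : t ^ 2 = 2 / c ^ 2 * ((c * t) ^ 2 / 2)) by (field; lra).
  assert (0 < 2 / c ^ 2) by (apply Rdiv_lt_0_compat; lra).
  assert (0 <= (c * t) ^ 2) by apply pow2_ge_0.
  rewrite E. nra.
Qed.

(** At [- infinity] the factor [exp (a y)] decides, at [+ infinity] the factor
    [exp (- k e^y)], which beats every power of [e^y]. *)
Lemma decay_gamma_kernel a k : 0 < a -> 0 < k ->
  exists M, decay_bound M (fun y => exp (a * y - k * exp y)).
Proof.
  intros Ha Hk.
  set (C1 := 1 + 2 / a ^ 2). set (C2 := (1 + 2 / 1 ^ 2) * exp ((a + 1) ^ 2 / (2 * k))).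
  assert (HC1 : 0 < C1).
  { unfold C1. assert (0 < 2 / a ^ 2) by (apply Rdiv_lt_0_compat; nra). lra. }
  assert (HC2 : 0 < C2) by (unfold C2; pose proof (exp_pos ((a + 1) ^ 2 / (2 * k))); nra).
  exists (C1 + C2). intros y. pose proof (one_sqr_pos y).
  rewrite Rabs_pos_eq by (apply Rlt_le, exp_pos).
  apply Rmult_le_reg_r with (1 + y ^ 2); auto.
  unfold Rdiv. rewrite (Rmult_assoc (C1 + C2)), Rinv_l by lra.
  destruct (Rle_lt_dec y 0) as [Hy | Hy].
  - pose proof (exp_dominates_square a y Ha) as B. rewrite Rabs_left1 in B by lra.
    assert (exp (a * y - k * exp y) <= exp (a * y)).
    { left. apply exp_increasing. pose proof (exp_pos y). nra. }
    assert (exp (a * y) * exp (a * - y) = 1).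
    { rewrite <- exp_plus. replace (a * y + a * - y) with 0 by ring. apply exp_0. }
    pose proof (exp_pos (a * y)). pose proof (exp_pos (a * y - k * exp y)).
    apply Rle_trans with (exp (a * y) * (C1 * exp (a * - y))).
    2:{ replace (exp (a * y) * (C1 * exp (a * - y)))
          with (C1 * (exp (a * y) * exp (a * - y))) by ring.
        rewrite H1. lra. }
    fold C1 in B.
    apply Rmult_le_compat; lra.
  - pose proof (exp_dominates_square 1 y Rlt_0_1) as B. rewrite Rabs_pos_eq in B by lra.
    assert (exp (a * y - k * exp y) <= exp ((a + 1) ^ 2 / (2 * k)) * exp (- (1 * y))).
    { rewrite <- exp_plus. pose proof (exp_ge_quadratic y ltac:(lra)) as H0.
      assert (a * y - k * exp y <= (a + 1) ^ 2 / (2 * k) + - (1 * y)).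
      { assert (0 <= (a + 1 - k * y) ^ 2 / (2 * k)).
        { apply Rmult_le_pos; [apply pow2_ge_0 | left; apply Rinv_0_lt_compat; lra]. }
        replace ((a + 1 - k * y) ^ 2 / (2 * k))
          with ((a + 1) ^ 2 / (2 * k) - (a + 1) * y + k * (y ^ 2 / 2)) in H1 by (field; lra).
        nra. }
      destruct H1 as [H1 | ->]; [left; apply exp_increasing; auto | right; auto]. }
    assert (exp (- (1 * y)) * exp (1 * y) = 1).
    { rewrite <- exp_plus. replace (- (1 * y) + 1 * y) with 0 by ring. apply exp_0. }
    pose proof (exp_pos (1 * y)). pose proof (exp_pos (- (1 * y))).
    pose proof (exp_pos (a * y - k * exp y)). pose proof (exp_pos ((a + 1) ^ 2 / (2 * k))).
    apply Rle_trans with (exp ((a + 1) ^ 2 / (2 * k)) * exp (- (1 * y)) *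
       ((1 + 2 / 1 ^ 2) * exp (1 * y))).
    + apply Rmult_le_compat; lra.
    + unfold C2. set (E2 := exp ((a + 1) ^ 2 / (2 * k))) in *.
      apply Rle_trans with (E2 * (1 + 2 / 1 ^ 2) * (exp (- (1 * y)) * exp (1 * y))); [right; ring|].
      rewrite H1. nra.
Qed.

Lemma decays_gamma_kernel a k : 0 < a -> 0 < k ->
  decays (fun y => exp (a * y - k * exp y)).
Proof.
  intros Ha Hk. split; [|apply decay_gamma_kernel; auto].
  intros y. apply (ex_derive_continuous (V := R_NormedModule)). auto_derive; auto.
Qed.

(** Euler's integral after the substitution [t = e^y], which makes the integrand
    smooth for every [z > 0]. *)
Definition Gam (z : R) : R := lineint (fun y => exp (z * y - 1 * exp y)).

Lemma Gam_pos z : 0 < z -> 0 < Gam z.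
Proof.
  intros Hz. apply lineint_pos; [apply decays_gamma_kernel; lra | intros; apply exp_pos].
Qed.

Lemma Gam_scale z k : 0 < z -> 0 < k ->
  lineint (fun y => exp (z * y - k * exp y)) = Rpower k (- z) * Gam z.
Proof.
  intros Hz Hk. unfold Gam.
  rewrite <- (lineint_shift (ln k) (fun y => exp (z * y - 1 * exp y)))
      by (apply decays_gamma_kernel; lra).
  rewrite <- lineint_scal.
  - apply lineint_ext. intros y. unfold Rpower. rewrite <- exp_plus. f_equal.
    rewrite exp_plus, exp_ln by auto. ring.
  - apply (decays_shift (ln k) (fun y => exp (z * y - 1 * exp y))).
    apply decays_gamma_kernel; lra.
Qed.

Lemma Gam_S z : 0 < z -> Gam (z + 1) = z * Gam z.
Proof.
  intros Hz.
  assert (D := decays_gamma_kernel z 1 Hz Rlt_0_1).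
  assert (D1 := decays_gamma_kernel (z + 1) 1 ltac:(lra) Rlt_0_1).
  destruct (decay_gamma_kernel z 1 Hz Rlt_0_1) as [M HM].
  assert (E : lineint (fun y => z * exp (z * y - 1 * exp y) - exp ((z + 1) * y - 1 * exp y)) = 0).
  { apply lineint_derivative with (2 := fun y =>
      proj1 (decays_minus _ _ (decays_scal z _ D) D1) y) (3 := HM).
    intros y. auto_derive; auto.
    replace (z * y + - (1 * exp y)) with (z * y - 1 * exp y) by ring.
    replace ((z + 1) * y - 1 * exp y) with (y + (z * y - 1 * exp y)) by ring.
    rewrite exp_plus. ring. }
  rewrite lineint_minus, lineint_scal in E; auto using decays_scal. unfold Gam. lra.
Qed.

Lemma exp_convex l z : 0 <= z <= 1 -> exp (z * l) <= z * exp l + (1 - z).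
Proof.
  intros Hz. pose proof (exp_ineq1_le (l - z * l)) as A.
  pose proof (exp_ineq1_le (0 - z * l)) as B. pose proof (exp_pos (z * l)).
  assert (exp (z * l) * exp (l - z * l) = exp l) by (rewrite <- exp_plus; f_equal; ring).
  assert (exp (z * l) * exp (0 - z * l) = 1)
    by (rewrite <- exp_plus, <- exp_0; f_equal; ring).
  assert (exp (z * l) * (1 + (l - z * l)) <= exp l)
    by (rewrite <- H0; apply Rmult_le_compat_l; lra).
  assert (exp (z * l) * (1 + (0 - z * l)) <= 1)
    by (rewrite <- H1; apply Rmult_le_compat_l; lra).
  assert (z * (exp (z * l) * (1 + (l - z * l))) <= z * exp l)
    by (apply Rmult_le_compat_l; lra).
  assert ((1 - z) * (exp (z * l) * (1 + (0 - z * l))) <= (1 - z) * 1)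
    by (apply Rmult_le_compat_l; lra).
  lra.
Qed.

(** The tangent at [t = a] to the concave function [t^z] has its correction term
    killed by the recurrence of [Gam]; this is the part of log-convexity that
    is used. *)
Lemma Gam_tangent a z : 0 < a -> 0 <= z <= 1 -> Gam (a + z) <= Rpower a z * Gam a.
Proof.
  intros Ha Hz.
  assert (D := decays_gamma_kernel a 1 Ha Rlt_0_1).
  assert (D1 := decays_gamma_kernel (a + 1) 1 ltac:(lra) Rlt_0_1).
  assert (Dz := decays_gamma_kernel (a + z) 1 ltac:(lra) Rlt_0_1).
  unfold Gam at 1.
  apply Rle_trans with (lineint (fun y => Rpower a z * ((z / a) * exp ((a + 1) * y - 1 * exp y)
     + (1 - z) * exp (a * y - 1 * exp y)))).
  - apply lineint_le; auto using decays_scal, decays_plus.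
    intros y.
    pose proof (exp_convex (y - ln a) z Hz) as A.
    replace (exp (y - ln a)) with (exp y / a) in A.
    2:{ unfold Rminus. rewrite exp_plus, exp_Ropp, exp_ln by auto. reflexivity. }
    replace ((a + z) * y - 1 * exp y)
      with (z * ln a + (z * (y - ln a) + (a * y - 1 * exp y))) by ring.
    replace ((a + 1) * y - 1 * exp y) with (y + (a * y - 1 * exp y)) by ring.
    rewrite !exp_plus. fold (Rpower a z).
    pose proof (exp_pos (z * ln a)). fold (Rpower a z) in H.
    pose proof (exp_pos (a * y - 1 * exp y)).
    apply Rmult_le_compat_l; [lra|].
    apply Rle_trans with ((z * (exp y / a) + (1 - z)) * exp (a * y - 1 * exp y)).
    + apply Rmult_le_compat_r; lra.
    + right. field. lra.
  - rewrite lineint_scal by auto using decays_scal, decays_plus.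
    rewrite lineint_plus, !lineint_scal by auto using decays_scal.
    fold (Gam (a + 1)). fold (Gam a). rewrite Gam_S by auto.
    right. field. lra.
Qed.

Definition gauss_quotient (z : R) (n : nat) : R :=
  prod_f_R0 (fun i => z + INR i) n / (INR (fact n) * Rpower (INR n) z).

Lemma prod_Gam z n : 0 < z -> prod_f_R0 (fun i => z + INR i) n * Gam z = Gam (z + INR n + 1).
Proof.
  intros Hz. induction n as [|n IH].
  - simpl. rewrite !Rplus_0_r, <- Gam_S; auto.
  - change (prod_f_R0 (fun i => z + INR i) (S n))
      with (prod_f_R0 (fun i => z + INR i) n * (z + INR (S n))).
    rewrite S_INR. pose proof (pos_INR n).
    replace (z + (INR n + 1) + 1) with ((z + INR n + 1) + 1) by ring.
    rewrite Gam_S, <- IH by lra. ring.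
Qed.

Lemma Gam_1 : Gam 1 = 1.
Proof.
  assert (D := decays_gamma_kernel 1 1 Rlt_0_1 Rlt_0_1).
  apply lineint_unique.
  apply is_lim_seq_ext with (fun n => exp (- exp (- INR n)) - exp (- exp (INR n))).
  - intros n. symmetry. apply is_RInt_unique.
    replace (exp (- exp (- INR n)) - exp (- exp (INR n)))
      with (- exp (- exp (INR n)) - - exp (- exp (- INR n))) by ring.
    apply (is_RInt_derive (V := R_CompleteNormedModule) (fun y => - exp (- exp y))).
    + intros y _. auto_derive; auto.
      replace (1 * y - 1 * exp y) with (y + - exp y) by ring. rewrite exp_plus. ring.
    + intros; apply D.
  - replace (Finite 1) with (Finite (exp (- 0) - 0)) by (f_equal; rewrite Ropp_0, exp_0; ring).
    assert (L0 : is_lim_seq (fun n => exp (- INR n)) 0).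
    { apply (is_lim_comp_seq exp (fun n => - INR n) m_infty 0).
      - apply is_lim_exp_m.
      - exists 0%nat. intros; discriminate.
      - apply (is_lim_seq_opp INR p_infty). apply is_lim_seq_INR. }
    apply is_lim_seq_minus'.
    + apply (is_lim_seq_continuous (fun t => exp (- t)) _ 0); auto.
      apply ex_derive_continuity_pt.
      auto_derive; auto.
    + apply (is_lim_seq_le_le (fun _ => 0) _ (fun n => exp (- INR n)) 0); auto.
      * intros n. split; [apply Rlt_le, exp_pos|].
        left. apply exp_increasing. pose proof (exp_ineq1_le (INR n)). lra.
      * apply is_lim_seq_const.
Qed.

Lemma Gam_fact n : Gam (INR n + 1) = INR (fact n).
Proof.
  induction n as [|n IH].
  - simpl. rewrite Rplus_0_l. apply Gam_1.
  - rewrite S_INR, Gam_S, IH by (pose proof (pos_INR n); lra).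
    rewrite fact_simpl, mult_INR, S_INR. reflexivity.
Qed.

Lemma is_lim_seq_Rpower_l (u : nat -> R) l p : 0 < l -> is_lim_seq u l ->
  is_lim_seq (fun n => Rpower (u n) p) (Rpower l p).
Proof.
  intros Hl Hu. apply (is_lim_seq_continuous (fun t => Rpower t p)); auto.
  apply ex_derive_continuity_pt.
  unfold Rpower. auto_derive. auto.
Qed.

Lemma is_lim_seq_inv_INR k : is_lim_seq (fun n => k / INR n) 0.
Proof.
  replace (Finite 0) with (Rbar_mult k (Rbar_inv p_infty)) by (simpl; f_equal; ring).
  apply is_lim_seq_scal_l. apply is_lim_seq_inv; [apply is_lim_seq_INR | discriminate].
Qed.

Lemma is_lim_seq_ratio a b c : 
  is_lim_seq (fun n => (c * INR n + a) / (INR n + b)) c.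
Proof.
  apply is_lim_seq_ext_loc with (fun n => (c + a / INR n) / (1 + b / INR n)).
  - destruct (archimed_cor1 1 Rlt_0_1) as [N0 _].
    exists (S (Z.to_nat (up (Rabs b)))). intros n Hn.
    assert (Rabs b < INR n).
    { destruct (archimed (Rabs b)) as [A _]. apply Rlt_le_trans with (1 := A).
      assert (0 <= up (Rabs b))%Z.
      { apply le_IZR. pose proof (Rabs_pos b). simpl. lra. }
      rewrite INR_IZR_INZ. apply IZR_le. lia. }
    pose proof (Rabs_pos b). assert (INR n + b <> 0).
    { pose proof (Rabs_maj2 b). lra. }
    field. split; [lra|]. intros E. apply H1. lra.
  - replace (Finite c) with (Finite ((c + 0) / (1 + 0))) by (f_equal; field).
    apply is_lim_seq_div'; [| | lra]; apply is_lim_seq_plus';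
      try apply is_lim_seq_const; apply is_lim_seq_inv_INR.
Qed.

(** [Gam_tangent] at [n + 1] and, for the lower bound, at [n + 1 + z] squeezes
    [Gam (n + 1 + z) / (n! n^z)] between sequences tending to [1]. *)
Lemma gauss_lim_unit z : 0 < z <= 1 -> is_lim_seq (gauss_quotient z) (/ Gam z).
Proof.
  intros Hz. pose proof (Gam_pos z ltac:(lra)) as HG.
  assert (E : forall n, (1 <= n)%nat ->
     gauss_quotient z n = / Gam z * (Gam (INR n + 1 + z) / (Gam (INR n + 1) * Rpower (INR n) z))).
  { intros n Hn. unfold gauss_quotient. rewrite Gam_fact.
    replace (INR n + 1 + z) with (z + INR n + 1) by ring. rewrite <- prod_Gam by lra.
    field. repeat split; try lra. apply Rgt_not_eq, exp_pos. apply INR_fact_neq_0. }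
  apply is_lim_seq_ext_loc with (fun n =>
    / Gam z * (Gam (INR n + 1 + z) / (Gam (INR n + 1) * Rpower (INR n) z))).
  { exists 1%nat. intros n Hn. symmetry. auto. }
  replace (Finite (/ Gam z)) with (Rbar_mult (/ Gam z) 1) by (simpl; f_equal; ring).
  apply is_lim_seq_scal_l.
  apply (is_lim_seq_le_le_loc (fun n => Rpower ((1 * INR n + 1) / (INR n + 0)) z *
       Rpower ((1 * INR n + (1 + z)) / (INR n + 1)) (z - 1)) _
    (fun n => Rpower ((1 * INR n + 1) / (INR n + 0)) z) 1).
  - exists 1%nat. intros n Hn.
    assert (Hn1 : 1 <= INR n) by (change 1 with (INR 1); apply le_INR; auto).
    rewrite Rplus_0_r, !Rmult_1_l.
    pose proof (Gam_tangent (INR n + 1) z ltac:(lra) ltac:(lra)) as A.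
    pose proof (Gam_tangent (INR n + 1 + z) (1 - z) ltac:(lra) ltac:(lra)) as B.
    replace (INR n + 1 + z + (1 - z)) with (INR n + 1 + 1) in B by ring.
    rewrite (Gam_S (INR n + 1)) in B by lra.
    pose proof (Gam_pos (INR n + 1) ltac:(lra)) as G1.
    pose proof (Gam_pos (INR n + 1 + z) ltac:(lra)) as G2.
    unfold Rdiv. rewrite <- !Rpower_mult_distr by
      (try apply Rinv_0_lt_compat; lra).
    replace (Rpower (/ INR n) z) with (/ Rpower (INR n) z).
    2:{ unfold Rpower. rewrite ln_Rinv by lra. rewrite <- exp_Ropp. f_equal. ring. }
    assert (0 < Rpower (INR n) z) by apply exp_pos.
    replace (Rpower (INR n + 1) z * / Rpower (INR n) z *
      (Rpower (INR n + (1 + z)) (z - 1) * Rpower (/ (INR n + 1)) (z - 1)))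
      with ((INR n + 1) * Rpower (INR n + (1 + z)) (z - 1) * / Rpower (INR n) z).
    2:{ replace (Rpower (/ (INR n + 1)) (z - 1)) with ((INR n + 1) * / Rpower (INR n + 1) z).
        - field. split; apply Rgt_not_eq, exp_pos.
        - unfold Rpower. rewrite ln_Rinv by lra. rewrite <- exp_Ropp.
          rewrite <- (exp_ln (INR n + 1)) at 1 by lra. rewrite <- exp_plus. f_equal. ring. }
    rewrite Rinv_mult, <- Rmult_assoc.
    split; apply Rmult_le_compat_r; try (left; apply Rinv_0_lt_compat; auto).
    + apply Rmult_le_reg_r with (Gam (INR n + 1)); auto.
      rewrite (Rmult_assoc (Gam (INR n + 1 + z))), Rinv_l, Rmult_1_r by lra.
      replace (INR n + (1 + z)) with (INR n + 1 + z) by ring.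
      assert (Hp : 0 < Rpower (INR n + 1 + z) (1 - z)) by apply exp_pos.
      apply Rmult_le_reg_l with (1 := Hp).
      apply Rle_trans with (2 := B). right.
      replace (Rpower (INR n + 1 + z) (1 - z) * ((INR n + 1) * Rpower (INR n + 1 + z) (z - 1) *
        Gam (INR n + 1))) with ((Rpower (INR n + 1 + z) (1 - z) * Rpower (INR n + 1 + z) (z - 1))
        * ((INR n + 1) * Gam (INR n + 1))) by ring.
      rewrite <- Rpower_plus. replace (1 - z + (z - 1)) with 0 by ring.
      rewrite Rpower_O by lra. ring.
    + apply Rmult_le_reg_r with (Gam (INR n + 1)); auto.
      rewrite (Rmult_assoc (Gam (INR n + 1 + z))), Rinv_l, Rmult_1_r by lra. exact A.
  - replace (Finite 1) with (Finite (Rpower 1 z * Rpower 1 (z - 1)))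
      by (unfold Rpower; rewrite ln_1, !Rmult_0_r, exp_0; f_equal; ring).
    apply is_lim_seq_mult'; apply is_lim_seq_Rpower_l; try lra; apply is_lim_seq_ratio.
  - replace (Finite 1) with (Finite (Rpower 1 z))
      by (unfold Rpower; rewrite ln_1, !Rmult_0_r, exp_0; f_equal; ring).
    apply is_lim_seq_Rpower_l; try lra; apply is_lim_seq_ratio.
Qed.

Lemma prod_shift z n :
  prod_f_R0 (fun i => z + INR i) (S n) = z * prod_f_R0 (fun i => z + 1 + INR i) n.
Proof.
  induction n as [|n IH].
  - simpl. ring.
  - change (prod_f_R0 (fun i => z + INR i) (S (S n)))
      with (prod_f_R0 (fun i => z + INR i) (S n) * (z + INR (S (S n)))).
    rewrite IH.
    change (prod_f_R0 (fun i => z + 1 + INR i) (S n))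
      with (prod_f_R0 (fun i => z + 1 + INR i) n * (z + 1 + INR (S n))).
    rewrite !S_INR. ring.
Qed.

Lemma gauss_quotient_S z n : (1 <= n)%nat ->
  gauss_quotient z (S n) =
  z * gauss_quotient (z + 1) n * Rpower ((1 * INR n + 0) / (INR n + 1)) (z + 1).
Proof.
  intros Hn. assert (Hn1 : 1 <= INR n) by (change 1 with (INR 1); apply le_INR; auto).
  unfold gauss_quotient. rewrite prod_shift, fact_simpl, mult_INR, S_INR.
  rewrite Rmult_1_l, Rplus_0_r. unfold Rdiv at 3.
  rewrite <- Rpower_mult_distr by (try apply Rinv_0_lt_compat; lra).
  replace (Rpower (/ (INR n + 1)) (z + 1)) with (/ ((INR n + 1) * Rpower (INR n + 1) z)).
  - field. repeat split; try apply INR_fact_neq_0; try lra; apply Rgt_not_eq, exp_pos.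
  - rewrite <- (Rpower_1 (INR n + 1)) at 1 by lra. rewrite <- Rpower_plus.
    unfold Rpower. rewrite ln_Rinv by lra. rewrite <- exp_Ropp. f_equal. ring.
Qed.

Lemma is_lim_shift_factor z :
  is_lim_seq (fun n => Rpower ((1 * INR n + 0) / (INR n + 1)) (z + 1)) 1.
Proof.
  replace (Finite 1) with (Finite (Rpower 1 (z + 1)))
    by (unfold Rpower; rewrite ln_1, Rmult_0_r, exp_0; reflexivity).
  apply is_lim_seq_Rpower_l; try lra. apply is_lim_seq_ratio.
Qed.

Lemma gauss_lim_down z (l : R) : is_lim_seq (gauss_quotient (z + 1)) l ->
  is_lim_seq (gauss_quotient z) (z * l).
Proof.
  intros H. apply is_lim_seq_incr_1.
  apply is_lim_seq_ext_loc with (fun n =>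
    z * gauss_quotient (z + 1) n * Rpower ((1 * INR n + 0) / (INR n + 1)) (z + 1)).
  - exists 1%nat. intros n Hn. symmetry. apply gauss_quotient_S; auto.
  - replace (Finite (z * l)) with (Finite (z * l * 1)) by (f_equal; ring).
    apply is_lim_seq_mult'; [|apply is_lim_shift_factor].
    apply (is_lim_seq_scal_l _ z l); auto.
Qed.

Lemma gauss_lim_up z (l : R) : z <> 0 -> is_lim_seq (gauss_quotient z) l ->
  is_lim_seq (gauss_quotient (z + 1)) (l / z).
Proof.
  intros Hz H. apply is_lim_seq_incr_1 in H.
  apply is_lim_seq_ext_loc with (fun n =>
    gauss_quotient z (S n) / Rpower ((1 * INR n + 0) / (INR n + 1)) (z + 1) / z).
  - exists 1%nat. intros n Hn. rewrite gauss_quotient_S by auto. field.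
    split; auto. apply Rgt_not_eq, exp_pos.
  - replace (Finite (l / z)) with (Finite (l / 1 / z)) by (f_equal; field; auto).
    apply is_lim_seq_div'; [|apply is_lim_seq_const|auto].
    apply is_lim_seq_div'; [auto | apply is_lim_shift_factor | lra].
Qed.

Lemma gauss_lim_pos z : 0 < z -> is_lim_seq (gauss_quotient z) (/ Gam z).
Proof.
  assert (A : forall n z, 0 < z <= INR n + 1 -> is_lim_seq (gauss_quotient z) (/ Gam z)).
  { induction n as [|n IH]; intros w Hw.
    - simpl in Hw. apply gauss_lim_unit. lra.
    - rewrite S_INR in Hw. destruct (Rle_lt_dec w 1) as [Hw1 | Hw1].
      + apply gauss_lim_unit. lra.
      + replace w with (w - 1 + 1) by ring.
        replace (/ Gam (w - 1 + 1)) with (/ Gam (w - 1) / (w - 1)).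
        * apply gauss_lim_up; [lra|]. apply IH. lra.
        * rewrite Gam_S by lra. pose proof (Gam_pos (w - 1) ltac:(lra)). field. lra. }
  intros Hz. destruct (nfloor_ex z ltac:(lra)) as [n Hn]. apply (A n). lra.
Qed.

Lemma is_lim_inv_Gamma z : is_lim_seq (gauss_quotient z) (inv_Gamma z).
Proof.
  assert (A : forall n z, - INR n < z -> ex_finite_lim_seq (gauss_quotient z)).
  { induction n as [|n IH]; intros w Hw.
    - simpl in Hw. exists (/ Gam w). apply gauss_lim_pos. lra.
    - rewrite S_INR in Hw. destruct (IH (w + 1)) as [l Hl]; [lra|].
      exists (w * l). apply gauss_lim_down; auto. }
  assert (E : ex_finite_lim_seq (gauss_quotient z)).
  { destruct (nfloor_ex (Rabs z) (Rabs_pos z)) as [n Hn]. apply (A (S n)).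
    rewrite S_INR. pose proof (Rabs_maj2 z). lra. }
  exact (Lim_seq_correct' _ E).
Qed.

Lemma inv_Gamma_pos_eq z : 0 < z -> inv_Gamma z = / Gam z.
Proof.
  intros Hz. pose proof (is_lim_seq_unique _ _ (is_lim_inv_Gamma z)) as A.
  rewrite (is_lim_seq_unique _ _ (gauss_lim_pos z Hz)) in A. injection A. auto.
Qed.

Lemma inv_Gamma_rec z : inv_Gamma z = z * inv_Gamma (z + 1).
Proof.
  pose proof (is_lim_seq_unique _ _ (is_lim_inv_Gamma z)) as A.
  rewrite (is_lim_seq_unique _ _ (gauss_lim_down z _ (is_lim_inv_Gamma (z + 1)))) in A.
  injection A. auto.
Qed.

(** The even and the odd factors of the product for [2 z]. *)
Lemma prod_split z n :
  prod_f_R0 (fun i => 2 * z + INR i) (2 * n + 1) =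
  2 ^ (2 * n + 2) * prod_f_R0 (fun i => z + INR i) n * prod_f_R0 (fun i => z + 1 / 2 + INR i) n.
Proof.
  induction n as [|n IH].
  - simpl. field.
  - replace (2 * S n + 1)%nat with (S (S (2 * n + 1))) by lia.
    change (prod_f_R0 (fun i => 2 * z + INR i) (S (S (2 * n + 1))))
      with (prod_f_R0 (fun i => 2 * z + INR i) (2 * n + 1) * (2 * z + INR (S (2 * n + 1)))
        * (2 * z + INR (S (S (2 * n + 1))))).
    rewrite IH.
    change (prod_f_R0 (fun i => z + INR i) (S n))
      with (prod_f_R0 (fun i => z + INR i) n * (z + INR (S n))).
    change (prod_f_R0 (fun i => z + 1 / 2 + INR i) (S n))
      with (prod_f_R0 (fun i => z + 1 / 2 + INR i) n * (z + 1 / 2 + INR (S n))).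
    replace (2 * S n + 2)%nat with (S (S (2 * n + 2))) by lia.
    rewrite !S_INR, plus_INR, mult_INR. simpl (INR 2). simpl (INR 1).
    rewrite <- !tech_pow_Rmult. field.
Qed.

(** Legendre's duplication formula, up to the value of the constant: splitting Gauss's
    product for [2 z] into its even and odd factors leaves a quotient whose limit
    depends on [z] only through [2^(2z)]. *)
Lemma Gam_duplication z w : 0 < z -> 0 < w ->
  Gam (2 * z) / (Gam z * Gam (z + 1 / 2) * Rpower 2 (2 * z)) =
  Gam (2 * w) / (Gam w * Gam (w + 1 / 2) * Rpower 2 (2 * w)).
Proof.
  assert (Lsub : forall z, 0 < z ->
    is_lim_seq (fun n => gauss_quotient (2 * z) (2 * n + 1)) (/ Gam (2 * z))).
  { intros u Hu. apply (is_lim_seq_subseq (gauss_quotient (2 * u)) _ (fun n => (2 * n + 1)%nat)).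
    - apply eventually_subseq. intros n. lia.
    - apply gauss_lim_pos. lra. }
  pose (kap := fun n => INR (fact (2 * n + 1)) / (2 ^ (2 * n + 2) * INR (fact n) * INR (fact n)
      * Rpower (INR n) (1 / 2))).
  assert (E : forall z n, 0 < z -> (1 <= n)%nat ->
    gauss_quotient z n * gauss_quotient (z + 1 / 2) n / gauss_quotient (2 * z) (2 * n + 1)
    / Rpower ((2 * INR n + 1) / (INR n + 0)) (2 * z) = kap n).
  { intros u n Hu Hn. assert (Hn1 : 1 <= INR n) by (change 1 with (INR 1); apply le_INR; auto).
    assert (P : forall v m, 0 < v -> 0 < prod_f_R0 (fun i => v + INR i) m).
    { intros v m Hv. induction m as [|m IH]; [simpl; lra|].
      change (prod_f_R0 (fun i => v + INR i) (S m))
        with (prod_f_R0 (fun i => v + INR i) m * (v + INR (S m))).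
      apply Rmult_lt_0_compat; auto. pose proof (pos_INR (S m)). lra. }
    unfold gauss_quotient, kap. rewrite prod_split.
    replace (INR (2 * n + 1)) with (2 * INR n + 1)
      by (rewrite plus_INR, mult_INR; simpl; ring).
    rewrite Rplus_0_r.
    assert (ER : Rpower ((2 * INR n + 1) / INR n) (2 * u) =
      Rpower (2 * INR n + 1) (2 * u) * / (Rpower (INR n) u * Rpower (INR n) u)).
    { unfold Rdiv. rewrite <- Rpower_mult_distr by (try apply Rinv_0_lt_compat; lra).
      f_equal. rewrite <- Rpower_plus. unfold Rpower. rewrite ln_Rinv by lra.
      rewrite <- exp_Ropp. f_equal. ring. }
    rewrite ER.
    rewrite Rpower_plus.
    pose proof (P u n Hu). pose proof (P (u + 1 / 2) n ltac:(lra)).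
    field.
    repeat split; try apply INR_fact_neq_0; try (apply Rgt_not_eq, exp_pos); try lra.
    apply pow_nonzero; lra. }
  assert (L : forall z, 0 < z -> is_lim_seq kap (/ Gam z * / Gam (z + 1 / 2) / / Gam (2 * z)
     / Rpower 2 (2 * z))).
  { intros u Hu. eapply is_lim_seq_ext_loc.
    - exists 1%nat. intros n Hn. apply (E u n Hu Hn).
    - pose proof (Gam_pos (2 * u) ltac:(lra)).
      apply is_lim_seq_div'.
      + apply is_lim_seq_div'; auto.
        * apply is_lim_seq_mult'; apply gauss_lim_pos; lra.
        * apply Rinv_neq_0_compat. lra.
      + apply is_lim_seq_Rpower_l; [lra|]. apply is_lim_seq_ratio.
      + apply Rgt_not_eq, exp_pos. }
  intros Hz Hw.
  pose proof (is_lim_seq_unique _ _ (L z Hz)) as A.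
  rewrite (is_lim_seq_unique _ _ (L w Hw)) in A. injection A. intros B.
  assert (F : forall u, 0 < u -> Gam (2 * u) / (Gam u * Gam (u + 1 / 2) * Rpower 2 (2 * u)) =
    / Gam u * / Gam (u + 1 / 2) / / Gam (2 * u) / Rpower 2 (2 * u)).
  { intros u Hu. pose proof (Gam_pos u Hu). pose proof (Gam_pos (u + 1 / 2) ltac:(lra)).
    pose proof (Gam_pos (2 * u) ltac:(lra)). field.
    repeat split; try lra. apply Rgt_not_eq, exp_pos. }
  rewrite (F z Hz), (F w Hw). auto.
Qed.

(** * The Bessel functions of the first kind *)

Definition bessel_coef (nu : R) (m : nat) : R :=
  (-1) ^ m / INR (fact m) * inv_Gamma (nu + INR m + 1).

Lemma bounded_of_eventually_decreasing (u : nat -> R) N :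
  (forall n, (N <= n)%nat -> Rabs (u (S n)) <= Rabs (u n)) ->
  exists K, forall n, Rabs (u n) <= K.
Proof.
  intros H.
  assert (A : exists K, forall n, (n <= N)%nat -> Rabs (u n) <= K).
  { clear H. induction N as [|N [K IH]].
    - exists (Rabs (u 0%nat)). intros n Hn. replace n with 0%nat by lia. lra.
    - exists (Rmax K (Rabs (u (S N)))). intros n Hn.
      destruct (Nat.eq_dec n (S N)) as [->|Hne]; [apply Rmax_r|].
      eapply Rle_trans; [apply IH; lia | apply Rmax_l]. }
  destruct A as [K A]. exists K. intros n.
  destruct (Nat.le_gt_cases n N) as [Hn | Hn]; [auto|].
  replace n with (N + (n - N))%nat by lia.
  induction (n - N)%nat as [|d IH]; [rewrite Nat.add_0_r; auto|].
  rewrite Nat.add_succ_r. eapply Rle_trans; [apply H; lia | auto].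
Qed.

Lemma inv_Gamma_bounded nu : exists K, forall m, Rabs (inv_Gamma (nu + INR m + 1)) <= K.
Proof.
  destruct (nfloor_ex (Rabs nu) (Rabs_pos nu)) as [N HN].
  apply (bounded_of_eventually_decreasing _ (S N)). intros n Hn.
  apply le_INR in Hn. rewrite S_INR in Hn.
  rewrite (inv_Gamma_rec (nu + INR n + 1)). rewrite Rabs_mult.
  replace (nu + INR n + 1 + 1) with (nu + INR (S n) + 1) by (rewrite S_INR; ring).
  pose proof (Rabs_maj2 nu). rewrite (Rabs_pos_eq (nu + INR n + 1)) by lra.
  pose proof (Rabs_pos (inv_Gamma (nu + INR (S n) + 1))). nra.
Qed.

Lemma pow_over_fact_bounded r : exists M, forall n, Rabs (r ^ n / INR (fact n)) <= M.
Proof.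
  destruct (filterlim_bounded (K := R_AbsRing) (V := R_NormedModule)
    (fun n => r ^ n / INR (fact n))) as [M HM].
  - exists 0. 
    assert (A : ex_series (fun n => r ^ n / INR (fact n))).
    { exists (exp r). assert (B := is_exp_Reals r). unfold is_pseries in B.
      eapply is_series_ext; [|exact B]. intros n. rewrite pow_n_pow. reflexivity. }
    exact (ex_series_lim_0 _ A).
  - exists M. exact HM.
Qed.

(** The reciprocal Gamma factors stay bounded by the recurrence, so the coefficients are
    dominated by those of the exponential. *)
Lemma bessel_radius nu : CV_radius (bessel_coef nu) = p_infty.
Proof.
  assert (A : forall r : R, Rbar_le r (CV_radius (bessel_coef nu))).
  { intros r. apply (proj1 (CV_radius_bounded (bessel_coef nu))).
    destruct (inv_Gamma_bounded nu) as [K HK].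
    destruct (pow_over_fact_bounded r) as [M HM].
    exists (K * M). intros n. specialize (HK n). specialize (HM n).
    unfold bessel_coef.
    replace ((-1) ^ n / INR (fact n) * inv_Gamma (nu + INR n + 1) * r ^ n)
      with ((-1) ^ n * (inv_Gamma (nu + INR n + 1) * (r ^ n / INR (fact n))))
      by (field; apply INR_fact_neq_0).
    rewrite Rabs_mult, pow_1_abs, Rmult_1_l, Rabs_mult.
    apply Rmult_le_compat; auto using Rabs_pos. }
  destruct (CV_radius (bessel_coef nu)) as [r | |] eqn:E; auto.
  - exfalso. specialize (A (r + 1)). simpl in A. lra.
  - exfalso. exact (A 0).
Qed.

Definition bessel_S (nu z : R) : R := PSeries (bessel_coef nu) z.

Lemma bessel_J_S nu x : bessel_J nu x = Rpower (x / 2) nu * bessel_S nu (x ^ 2 / 4).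
Proof. reflexivity. Qed.

Lemma bessel_coef_derive nu m : PS_derive (bessel_coef nu) m = - bessel_coef (nu + 1) m.
Proof.
  unfold PS_derive, bessel_coef.
  replace (nu + 1 + INR m + 1) with (nu + INR (S m) + 1) by (rewrite S_INR; ring).
  rewrite fact_simpl, mult_INR. simpl ((-1) ^ S m). field.
  split; [apply INR_fact_neq_0 | apply not_0_INR; lia].
Qed.

Lemma is_derive_bessel_S nu z : is_derive (bessel_S nu) z (- bessel_S (nu + 1) z).
Proof.
  unfold bessel_S.
  replace (- PSeries (bessel_coef (nu + 1)) z) with (PSeries (PS_derive (bessel_coef nu)) z).
  - apply is_derive_PSeries. rewrite bessel_radius. exact I.
  - rewrite <- PSeries_opp. apply PSeries_ext. intros n. apply bessel_coef_derive.
Qed.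

(** Termwise the recurrence of the reciprocal Gamma function. *)
Lemma bessel_S_pred nu z : bessel_S (nu - 1) z = nu * bessel_S nu z - z * bessel_S (nu + 1) z.
Proof.
  assert (Hex : forall mu, ex_pseries (bessel_coef mu) z).
  { intros mu. apply CV_radius_inside. rewrite bessel_radius. exact I. }
  unfold bessel_S. rewrite <- PSeries_scal, <- PSeries_incr_1.
  rewrite <- PSeries_minus.
  - apply PSeries_ext. intros n. unfold PS_minus, PS_plus, PS_opp, PS_scal. simpl.
    unfold plus, opp, scal; simpl; unfold mult; simpl.
    assert (E : forall m, bessel_coef (nu - 1) m = (nu + INR m) * bessel_coef nu m).
    { intros m. unfold bessel_coef. rewrite (inv_Gamma_rec (nu - 1 + INR m + 1)).
      replace (nu - 1 + INR m + 1 + 1) with (nu + INR m + 1) by ring. ring. }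
    rewrite E. destruct n as [|n].
    + simpl. unfold zero; simpl. ring.
    + simpl PS_incr_1. assert (D := bessel_coef_derive nu n). unfold PS_derive in D. lra.
  - apply ex_pseries_scal; auto. apply Rmult_comm.
  - apply ex_pseries_incr_1; auto.
Qed.

Lemma is_derive_Rpower_half nu x : 0 < x ->
  is_derive (fun x => Rpower (x / 2) nu) x (nu / x * Rpower (x / 2) nu).
Proof.
  intros Hx. unfold Rpower, Rdiv. auto_derive; [lra|]. field. lra.
Qed.

Lemma is_derive_bessel_J nu x : 0 < x ->
  is_derive (bessel_J nu) x (nu / x * bessel_J nu x - bessel_J (nu + 1) x).
Proof.
  intros Hx. rewrite !bessel_J_S.
  apply (is_derive_ext (fun x => Rpower (x / 2) nu * bessel_S nu (x ^ 2 / 4))).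
  { intros; reflexivity. }
  replace (nu / x * (Rpower (x / 2) nu * bessel_S nu (x ^ 2 / 4)) -
    Rpower (x / 2) (nu + 1) * bessel_S (nu + 1) (x ^ 2 / 4))
   with (nu / x * Rpower (x / 2) nu * bessel_S nu (x ^ 2 / 4) +
     Rpower (x / 2) nu * (x / 2 * - bessel_S (nu + 1) (x ^ 2 / 4))).
  - apply (is_derive_mult (K := R_AbsRing) (fun x => Rpower (x / 2) nu)
      (fun x => bessel_S nu (x ^ 2 / 4))).
    + apply is_derive_Rpower_half; auto.
    + apply (is_derive_comp (V := R_NormedModule) (bessel_S nu) (fun x => x ^ 2 / 4)).
      * apply is_derive_bessel_S.
      * auto_derive; auto. field.
    + intros; apply Rmult_comm.
  - rewrite Rpower_plus, Rpower_1 by lra. field. lra.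
Qed.

Lemma bessel_J_rec nu x : 0 < x ->
  bessel_J (nu - 1) x = 2 * nu / x * bessel_J nu x - bessel_J (nu + 1) x.
Proof.
  intros Hx. rewrite !bessel_J_S, bessel_S_pred.
  assert (E : Rpower (x / 2) (nu + 1) = Rpower (x / 2) nu * (x / 2))
    by (rewrite Rpower_plus, Rpower_1; lra).
  assert (E' : Rpower (x / 2) nu = Rpower (x / 2) (nu - 1) * (x / 2)).
  { replace nu with (nu - 1 + 1) at 1 by ring. rewrite Rpower_plus, Rpower_1; lra. }
  rewrite E, E'. field. lra.
Qed.

(** The derivative is carried as a second function: Wronskians and asymptotics refer to
    it at every point. *)
Definition bessel_sol (nu : R) (f f1 : R -> R) : Prop :=
  forall x, 0 < x -> is_derive f x (f1 x) /\
    is_derive f1 x (- (f1 x / x) - (1 - nu ^ 2 / x ^ 2) * f x).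

Definition bessel_J1 (nu x : R) : R := nu / x * bessel_J nu x - bessel_J (nu + 1) x.

Lemma bessel_sol_J nu : bessel_sol nu (bessel_J nu) (bessel_J1 nu).
Proof.
  intros x Hx. split; [apply is_derive_bessel_J; auto|].
  unfold bessel_J1.
  assert (D := is_derive_bessel_J nu x Hx). assert (D1 := is_derive_bessel_J (nu + 1) x Hx).
  assert (E := bessel_J_rec (nu + 1) x Hx).
  replace (nu + 1 - 1) with nu in E by ring.
  evar (l : R). replace (- _ - _) with l; unfold l.
  - apply (is_derive_minus (V := R_NormedModule) (fun x => nu / x * bessel_J nu x)); [|apply D1].
    apply (is_derive_mult (K := R_AbsRing) (fun x => nu / x) (bessel_J nu)); [|apply D|].
    + instantiate (1 := - nu / x ^ 2). auto_derive; [lra|]. field. lra.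
    + intros; apply Rmult_comm.
  - unfold minus, plus, opp, mult; simpl.
    replace (bessel_J (nu + 1 + 1) x) with
      (2 * (nu + 1) / x * bessel_J (nu + 1) x - bessel_J nu x) by lra.
    field. lra.
Qed.

Lemma bessel_sol_neg nu f f1 : bessel_sol (- nu) f f1 -> bessel_sol nu f f1.
Proof.
  intros H x Hx. destruct (H x Hx) as [H1 H2]. split; auto.
  replace (nu ^ 2) with ((- nu) ^ 2) by ring. auto.
Qed.

Lemma is_lim_bessel_S nu : filterlim (fun x => bessel_S nu (x ^ 2 / 4)) (at_right 0)
  (locally (inv_Gamma (nu + 1))).
Proof.
  replace (inv_Gamma (nu + 1)) with (bessel_S nu (0 ^ 2 / 4)).
  - apply (filterlim_filter_le_1 (F := locally 0)); [apply filter_le_within|].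
    apply (ex_derive_continuous (V := R_NormedModule) (fun x => bessel_S nu (x ^ 2 / 4))).
    eexists. apply (is_derive_comp (V := R_NormedModule) (bessel_S nu) (fun x => x ^ 2 / 4)).
    + apply is_derive_bessel_S.
    + auto_derive; auto.
  - replace (0 ^ 2 / 4) with 0 by field. unfold bessel_S. rewrite PSeries_0.
    unfold bessel_coef. simpl. rewrite Rplus_0_r. field.
Qed.

Lemma is_lim_bessel_J_0 nu : filterlim (fun x => Rpower x (- nu) * bessel_J nu x) (at_right 0)
  (locally (Rpower 2 (- nu) * inv_Gamma (nu + 1))).
Proof.
  apply filterlim_ext_loc with (fun x => Rpower 2 (- nu) * bessel_S nu (x ^ 2 / 4)).
  - exists (mkposreal 1 Rlt_0_1). intros x _ Hx. rewrite bessel_J_S.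
    unfold Rdiv at 2. rewrite <- Rpower_mult_distr by lra.
    replace (Rpower (/ 2) nu) with (Rpower 2 (- nu))
      by (unfold Rpower; rewrite ln_Rinv by lra; f_equal; ring).
    replace (Rpower x (- nu) * (Rpower x nu * Rpower 2 (- nu) * bessel_S nu (x ^ 2 / 4)))
      with ((Rpower x (- nu) * Rpower x nu) * (Rpower 2 (- nu) * bessel_S nu (x ^ 2 / 4))) by ring.
    rewrite <- Rpower_plus. replace (- nu + nu) with 0 by ring. rewrite Rpower_O by auto. ring.
  - apply (filterlim_comp _ _ _ (fun x => bessel_S nu (x ^ 2 / 4)) (fun t => Rpower 2 (- nu) * t)
      _ (locally (inv_Gamma (nu + 1)))); [apply is_lim_bessel_S|].
    apply (filterlim_scal_r (V := R_NormedModule) (Rpower 2 (- nu)) (inv_Gamma (nu + 1))).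
Qed.

(** * Laplace integrals for the Hankel functions *)

Lemma exp_le_exp a b : a <= b -> exp a <= exp b.
Proof. intros [H | ->]; [left; apply exp_increasing; auto | right; auto]. Qed.

(** Powers of [u^2 + 4] are absorbed by an arbitrarily small exponential, uniformly for
    bounded exponents. *)
Lemma log_growth m k : 0 <= m -> 0 < k -> exists C, forall mu u, Rabs mu <= m -> 0 <= u ->
  Rabs (mu / 2 * ln (u ^ 2 + 4)) <= k * u + C.
Proof.
  intros Hm Hk. set (a := (m + 1) / k).
  assert (Ha : 0 < a) by (apply Rdiv_lt_0_compat; lra).
  exists (k * 2 + m * Rabs (ln a)). intros mu u Hmu Hu.
  assert (L0 : 0 <= ln (u ^ 2 + 4)) by (rewrite <- ln_1; apply ln_le; nra).
  assert (L1 : ln (u ^ 2 + 4) <= 2 * ln (u + 2)).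
  { replace (2 * ln (u + 2)) with (ln ((u + 2) * (u + 2))) by (rewrite ln_mult; lra).
    apply ln_le; nra. }
  assert (L2 : ln (u + 2) <= (u + 2) / a + ln a).
  { assert (0 < (u + 2) / a) by (apply Rdiv_lt_0_compat; lra).
    pose proof (exp_ineq1_le (ln ((u + 2) / a))) as A. rewrite exp_ln in A by auto.
    replace (u + 2) with ((u + 2) / a * a) at 1 by (field; lra).
    rewrite ln_mult by lra. lra. }
  rewrite Rabs_mult, (Rabs_pos_eq (ln _)) by auto.
  unfold Rdiv at 1. rewrite Rabs_mult, (Rabs_pos_eq (/ 2)) by lra.
  pose proof (Rabs_pos mu). pose proof (Rle_abs (ln a)).
  assert (E : m * ((u + 2) / a) <= k * (u + 2)).
  { unfold a. replace (m * ((u + 2) / ((m + 1) / k))) with (k * (u + 2) * (m / (m + 1)))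
      by (field; lra).
    assert (m / (m + 1) <= 1).
    { apply Rmult_le_reg_r with (m + 1); [lra|]. unfold Rdiv. rewrite Rmult_assoc, Rinv_l; lra. }
    assert (0 <= k * (u + 2)) by nra. nra. }
  apply Rle_trans with (Rabs mu * ((u + 2) / a + Rabs (ln a))).
  - assert (0 <= Rabs mu * ((u + 2) / a + Rabs (ln a) - ln (u ^ 2 + 4) / 2))
      by (apply Rmult_le_pos; lra). lra.
  - assert (0 <= (u + 2) / a) by (left; apply Rdiv_lt_0_compat; lra).
    pose proof (Rabs_pos (ln a)).
    assert (Rabs mu * ((u + 2) / a + Rabs (ln a)) <= m * ((u + 2) / a + Rabs (ln a)))
      by (apply Rmult_le_compat_r; lra). lra.
Qed.

Definition hankel_arg (y : R) : R := atan (2 * exp (- y)).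

Definition hankel_env (nu j x y : R) : R :=
  exp ((nu + 1 / 2 + j) * y - x * exp y + (nu - 1 / 2) / 2 * ln (exp y ^ 2 + 4)).

(** With [u = e^y] and [mu = nu - 1/2] this is the real part of
    [e^(i theta) e^(i x - x u) u^j (u (u - 2 i))^mu u], the integrand of the Laplace
    integral for a Hankel function; [theta] selects real and imaginary part. *)
Definition hankel_kernel (nu j theta x y : R) : R :=
  hankel_env nu j x y * cos (x - (nu - 1 / 2) * hankel_arg y + theta).

Definition hankel_L (nu j theta x : R) : R := lineint (hankel_kernel nu j theta x).

Lemma hankel_kernel_le_env nu j theta x y :
  Rabs (hankel_kernel nu j theta x y) <= hankel_env nu j x y.
Proof.
  unfold hankel_kernel. rewrite Rabs_mult, Rabs_pos_eq by (left; apply exp_pos).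
  rewrite <- Rmult_1_r. apply Rmult_le_compat_l; [left; apply exp_pos|].
  apply Rabs_le. apply COS_bound.
Qed.

Lemma hankel_env_bound nu k : 0 < k -> exists C, forall j x y,
  hankel_env nu j x y <= exp C * exp ((nu + 1 / 2 + j) * y - (x - k) * exp y).
Proof.
  intros Hk. destruct (log_growth (Rabs (nu - 1 / 2)) k (Rabs_pos _) Hk) as [C HC].
  exists C. intros j x y. unfold hankel_env. rewrite <- exp_plus. apply exp_le_exp.
  specialize (HC (nu - 1 / 2) (exp y) (Rle_refl _) (Rlt_le _ _ (exp_pos y))).
  apply Rabs_le_between in HC. lra.
Qed.

(** Uniform in [x >= x0], as differentiation under the integral sign requires. *)
Lemma hankel_decay_locally nu j x0 : 0 < nu + 1 / 2 + j -> 0 < x0 ->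
  exists M, forall theta x, x0 <= x -> decay_bound M (hankel_kernel nu j theta x).
Proof.
  intros Ha Hx0.
  destruct (hankel_env_bound nu (x0 / 2) ltac:(lra)) as [C HC].
  destruct (decay_gamma_kernel (nu + 1 / 2 + j) (x0 / 2) Ha ltac:(lra)) as [M HM].
  exists (exp C * M). intros theta x Hx y.
  eapply Rle_trans; [apply hankel_kernel_le_env|].
  eapply Rle_trans; [apply HC|]. specialize (HM y).
  rewrite Rabs_pos_eq in HM by (left; apply exp_pos).
  unfold Rdiv in *. rewrite Rmult_assoc.
  apply Rmult_le_compat_l; [left; apply exp_pos|].
  eapply Rle_trans; [|apply HM]. apply exp_le_exp. pose proof (exp_pos y). nra.
Qed.

Lemma continuous_hankel_kernel nu j theta x y : continuous (hankel_kernel nu j theta x) y.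
Proof.
  apply (ex_derive_continuous (V := R_NormedModule)).
  unfold hankel_kernel, hankel_env, hankel_arg. auto_derive.
  pose proof (exp_pos y). repeat split; auto. nra.
Qed.

Lemma decays_hankel_kernel nu j theta x : 0 < nu + 1 / 2 + j -> 0 < x ->
  decays (hankel_kernel nu j theta x).
Proof.
  intros Ha Hx. split; [intros; apply continuous_hankel_kernel|].
  destruct (hankel_decay_locally nu j x Ha Hx) as [M HM]. exists M. apply HM. lra.
Qed.

Lemma hankel_env_S nu j x y : hankel_env nu (j + 1) x y = exp y * hankel_env nu j x y.
Proof. unfold hankel_env. rewrite <- exp_plus. f_equal. ring. Qed.

Lemma cos_shift_add a theta : cos (a + (theta + PI / 2)) = - sin (a + theta).
Proof.
  replace (a + (theta + PI / 2)) with (PI / 2 + (a + theta)) by ring.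
  rewrite cos_plus, cos_PI2, sin_PI2. ring.
Qed.

Lemma is_derive_hankel_kernel nu j theta x y :
  is_derive (fun x => hankel_kernel nu j theta x y) x
    (hankel_kernel nu j (theta + PI / 2) x y - hankel_kernel nu (j + 1) theta x y).
Proof.
  unfold hankel_kernel. rewrite hankel_env_S, cos_shift_add.
  unfold hankel_env. auto_derive; auto.
  change (exp y ^ 2) with (exp y * (exp y * 1)). unfold Rminus. ring.
Qed.

Lemma is_derive_hankel_L nu j theta x : 0 < nu + 1 / 2 + j -> 0 < x ->
  is_derive (hankel_L nu j theta) x (hankel_L nu j (theta + PI / 2) x - hankel_L nu (j + 1) theta x).
Proof.
  intros Ha Hx. unfold hankel_L.
  rewrite <- lineint_minus by (apply decays_hankel_kernel; lra).
  assert (Hx2 : 0 < x / 2) by lra.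
  destruct (hankel_decay_locally nu j (x / 2) Ha Hx2) as [M0 HM0].
  destruct (hankel_decay_locally nu (j + 1) (x / 2) ltac:(lra) Hx2) as [M1 HM1].
  destruct (hankel_decay_locally nu (j + 1 + 1) (x / 2) ltac:(lra) Hx2) as [M2 HM2].
  assert (HX : forall p, Rabs (p - x) < mkposreal _ Hx2 -> x / 2 <= p).
  { simpl. intros p Hp. apply Rabs_def2 in Hp. lra. }
  apply (is_derive_lineint (hankel_kernel nu j theta)
    (fun x y => hankel_kernel nu j (theta + PI / 2) x y - hankel_kernel nu (j + 1) theta x y)
    (fun x y => (hankel_kernel nu j (theta + PI / 2 + PI / 2) x y
       - hankel_kernel nu (j + 1) (theta + PI / 2) x y)
      - (hankel_kernel nu (j + 1) (theta + PI / 2) x y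
       - hankel_kernel nu (j + 1 + 1) theta x y))
    x (mkposreal _ Hx2) (M0 + M1 + (M1 + M2))).
  - intros p Hp. apply decays_hankel_kernel; auto. apply HX in Hp. lra.
  - apply decays_minus; apply decays_hankel_kernel; lra.
  - intros. apply is_derive_hankel_kernel.
  - intros. apply (is_derive_minus (V := R_NormedModule)
      (fun x => hankel_kernel nu j (theta + PI / 2) x y)); apply is_derive_hankel_kernel.
  - intros p Hp y. apply HX in Hp.
    pose proof (HM0 (theta + PI / 2 + PI / 2) p Hp y) as A0.
    pose proof (HM1 (theta + PI / 2) p Hp y) as A1.
    pose proof (HM2 theta p Hp y) as A2.
    apply Rabs_le_between in A0. apply Rabs_le_between in A1. apply Rabs_le_between in A2.
    apply Rabs_le_between. unfold Rdiv in *. lra.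
Qed.

Lemma is_derive_hankel_arg y :
  is_derive hankel_arg y (- (2 * exp y / (exp y ^ 2 + 4))).
Proof.
  unfold hankel_arg.
  evar (l : R). replace (- _) with l; unfold l.
  - apply (is_derive_comp (V := R_NormedModule) atan (fun y => 2 * exp (- y))).
    + apply is_derive_Reals, derivable_pt_lim_atan.
    + auto_derive; auto.
  - unfold scal; simpl; unfold mult; simpl.
    rewrite exp_Ropp. pose proof (exp_pos y). field. nra.
Qed.

Lemma decays_comb a b f g h k : decays f -> decays g -> decays h -> decays k ->
  decays (fun y => a * (f y - g y) - b * (h y - 2 * k y)).
Proof.
  intros. apply decays_minus; apply decays_scal; apply decays_minus; auto.
  apply decays_scal; auto.
Qed.

Lemma lineint_comb a b f g h k : decays f -> decays g -> decays h -> decays k ->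
  lineint (fun y => a * (f y - g y) - b * (h y - 2 * k y)) =
  a * (lineint f - lineint g) - b * (lineint h - 2 * lineint k).
Proof.
  intros. assert (decays (fun y => f y - g y)) by (apply decays_minus; auto).
  assert (decays (fun y => 2 * k y)) by (apply decays_scal; auto).
  assert (decays (fun y => h y - 2 * k y)) by (apply decays_minus; auto).
  rewrite lineint_minus by (apply decays_scal; auto).
  rewrite !lineint_scal, !lineint_minus, lineint_scal by auto. reflexivity.
Qed.

(** The integrand of the left side minus that of the right side is a total derivative:
    in complex notation, that of [- e^(i x - x u) (u (u - 2 i))^(mu + 1) / x]. *)
Lemma hankel_L_relation nu theta x : 0 < nu + 1 / 2 -> 0 < x ->
  x * (hankel_L nu (0 + 1 + 1) theta x - 2 * hankel_L nu (0 + 1) (theta + PI / 2) x) =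
  (2 * nu + 1) * (hankel_L nu (0 + 1) theta x - hankel_L nu 0 (theta + PI / 2) x).
Proof.
  intros Ha Hx.
  assert (D : forall j th, 0 <= j -> decays (hankel_kernel nu j th x))
    by (intros; apply decays_hankel_kernel; lra).
  enough (E : lineint (fun y =>
     (2 * nu + 1) * (hankel_kernel nu (0 + 1) theta x y - hankel_kernel nu 0 (theta + PI / 2) x y)
     - x * (hankel_kernel nu (0 + 1 + 1) theta x y
            - 2 * hankel_kernel nu (0 + 1) (theta + PI / 2) x y)) = 0).
  { rewrite (lineint_comb (2 * nu + 1) x) in E by (apply D; lra). unfold hankel_L. lra. }
  assert (DD : decays (fun y => hankel_kernel nu (0 + 1) theta x y
     - 2 * hankel_kernel nu 0 (theta + PI / 2) x y)).
  { apply (decays_minus _ (fun y => 2 * hankel_kernel nu 0 (theta + PI / 2) x y)).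
    - apply D; lra.
    - apply decays_scal, D; lra. }
  destruct DD as [_ [M HM]].
  apply lineint_derivative with (3 := HM).
  - intros y. unfold hankel_kernel. rewrite !hankel_env_S, !cos_shift_add.
    apply (is_derive_ext (fun y => hankel_env nu 0 x y *
      (exp y * cos (x - (nu - 1 / 2) * hankel_arg y + theta)
       + 2 * sin (x - (nu - 1 / 2) * hankel_arg y + theta)))).
    { intros t. rewrite hankel_env_S, cos_shift_add. apply Rminus_diag_uniq. ring. }
    assert (DA := is_derive_hankel_arg y).
    unfold hankel_env. auto_derive.
    + pose proof (exp_pos y). repeat split; try (eexists; exact DA); auto. nra.
    + replace (Derive (fun x0 => hankel_arg x0) y) with (Derive hankel_arg y) by reflexivity.
      rewrite (is_derive_unique _ _ _ DA).
      pose proof (exp_pos y) as Hu. set (u := exp y) in *.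
      set (A := x - (nu - 1 / 2) * hankel_arg y + theta).
      change (x + - ((nu - 1 / 2) * hankel_arg y) + theta) with A.
      set (E := exp ((nu + 1 / 2 + 0) * y - x * u + (nu - 1 / 2) / 2 * ln (u ^ 2 + 4))).
      change (exp ((nu + 1 / 2 + 0) * y + - (x * u) +
        (nu - 1 / 2) / 2 * ln (u * (u * 1) + 4))) with E.
      apply Rminus_diag_uniq. field. nra.
  - apply decays_comb; apply D; lra.
Qed.

(** The relation above turns into Bessel's equation after multiplication by [x^nu]. *)
Definition hankel (nu theta x : R) : R := Rpower x nu * hankel_L nu 0 theta x.

Definition hankel1 (nu theta x : R) : R :=
  Rpower x nu * (nu / x * hankel_L nu 0 theta x
    + (hankel_L nu 0 (theta + PI / 2) x - hankel_L nu (0 + 1) theta x)).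

Lemma is_derive_Rpower_l nu x : 0 < x ->
  is_derive (fun x => Rpower x nu) x (nu / x * Rpower x nu).
Proof. intros Hx. unfold Rpower. auto_derive; [lra|]. field. lra. Qed.

Lemma hankel_L_add_PI nu j theta x : 0 < nu + 1 / 2 + j -> 0 < x ->
  hankel_L nu j (theta + PI / 2 + PI / 2) x = - hankel_L nu j theta x.
Proof.
  intros Ha Hx. unfold hankel_L.
  replace (- lineint (hankel_kernel nu j theta x))
    with ((-1) * lineint (hankel_kernel nu j theta x)) by ring.
  rewrite <- lineint_scal by (apply decays_hankel_kernel; auto).
  apply lineint_ext. intros y. unfold hankel_kernel. rewrite cos_shift_add.
  replace (x - (nu - 1 / 2) * hankel_arg y + (theta + PI / 2))
    with (PI / 2 + (x - (nu - 1 / 2) * hankel_arg y + theta)) by ring.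
  rewrite sin_plus, sin_PI2, cos_PI2. ring.
Qed.

Lemma bessel_sol_hankel nu theta : 0 < nu + 1 / 2 ->
  bessel_sol nu (hankel nu theta) (hankel1 nu theta).
Proof.
  intros Hnu x Hx.
  assert (DL : forall th, is_derive (hankel_L nu 0 th) x
     (hankel_L nu 0 (th + PI / 2) x - hankel_L nu (0 + 1) th x))
    by (intros; apply is_derive_hankel_L; lra).
  assert (DL1 : forall th, is_derive (hankel_L nu (0 + 1) th) x
     (hankel_L nu (0 + 1) (th + PI / 2) x - hankel_L nu (0 + 1 + 1) th x))
    by (intros; apply is_derive_hankel_L; lra).
  assert (DP := is_derive_Rpower_l nu x Hx).
  assert (R0 := hankel_L_relation nu theta x Hnu Hx).
  split.
  - unfold hankel1.
    evar (l : R). replace (Rpower x nu * _) with l; unfold l.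
    + apply (is_derive_mult (K := R_AbsRing) (fun x => Rpower x nu) (hankel_L nu 0 theta));
        [apply DP | apply DL | intros; apply Rmult_comm].
    + unfold plus, mult; simpl. unfold mult; simpl. ring.
  - evar (l : R). replace (- _ - _) with l; unfold l.
    + apply (is_derive_mult (K := R_AbsRing) (fun x => Rpower x nu)
        (fun x => nu / x * hankel_L nu 0 theta x
          + (hankel_L nu 0 (theta + PI / 2) x - hankel_L nu (0 + 1) theta x)));
        [apply DP | | intros; apply Rmult_comm].
      apply (is_derive_plus (V := R_NormedModule) (fun x => nu / x * hankel_L nu 0 theta x)).
      * apply (is_derive_mult (K := R_AbsRing) (fun x => nu / x));
          [|apply DL | intros; apply Rmult_comm].
        instantiate (1 := - nu / x ^ 2). auto_derive; [lra|]. field. lra.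
      * apply (is_derive_minus (V := R_NormedModule)); [apply DL | apply DL1].
    + unfold minus, plus, opp, mult; simpl. unfold mult; simpl.
      rewrite hankel_L_add_PI by lra. unfold hankel, hankel1.
      replace (hankel_L nu (0 + 1 + 1) theta x) with
        (2 * hankel_L nu (0 + 1) (theta + PI / 2) x + (2 * nu + 1) / x *
          (hankel_L nu (0 + 1) theta x - hankel_L nu 0 (theta + PI / 2) x)).
      * field. lra.
      * apply Rmult_eq_reg_l with x; [|lra].
        rewrite Rmult_plus_distr_l.
        replace (x * ((2 * nu + 1) / x * (hankel_L nu (0 + 1) theta x
            - hankel_L nu 0 (theta + PI / 2) x)))
          with ((2 * nu + 1) * (hankel_L nu (0 + 1) theta x - hankel_L nu 0 (theta + PI / 2) x))
          by (field; lra).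
        rewrite <- R0. ring.
Qed.

(** * Asymptotics of the Laplace integrals *)

Lemma Rpower_le_neg a b p : 0 < b <= a -> 0 <= p -> Rpower a (- p) <= Rpower b (- p).
Proof.
  intros Hab Hp. unfold Rpower. apply exp_le_exp.
  assert (ln b <= ln a) by (apply ln_le; lra). nra.
Qed.

Lemma mean_value_bound (f df : R -> R) a b K :
  (forall x, Rmin a b <= x <= Rmax a b -> is_derive f x (df x)) ->
  (forall x, Rmin a b <= x <= Rmax a b -> Rabs (df x) <= K) ->
  Rabs (f b - f a) <= K * Rabs (b - a).
Proof.
  intros H1 H2. destruct (mean_value f df a b H1) as [c [Hc ->]].
  rewrite Rabs_mult. apply Rmult_le_compat_r; auto using Rabs_pos.
Qed.

(** Along the segments from [- 2 i] and from [u] to [u - 2 i], the derivative of the real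
    part of [e^(i phi) w^mu] has this form up to a real factor. *)
Lemma Rabs_trig_le a b t : Rabs (a * cos t + b * sin t) <= Rabs a + Rabs b.
Proof.
  eapply Rle_trans; [apply Rabs_triang|]. rewrite !Rabs_mult.
  pose proof (COS_bound t). pose proof (SIN_bound t).
  assert (Rabs (cos t) <= 1) by (apply Rabs_le; lra).
  assert (Rabs (sin t) <= 1) by (apply Rabs_le; lra).
  pose proof (Rabs_pos a). pose proof (Rabs_pos b). nra.
Qed.

(** For large [x] only small [u] matter; there [(u - 2 i)^mu] is close to [(- 2 i)^mu]. *)
Lemma hankel_kernel_small_u nu : exists C, 0 < C /\ forall theta x y,
  Rabs (hankel_kernel nu 0 theta x y -
     Rpower 2 (nu - 1 / 2) * cos (x - (nu - 1 / 2) * (PI / 2) + theta)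
       * exp ((nu + 1 / 2) * y - x * exp y))
  <= C * exp ((nu + 1 / 2 + 1) * y - (x - 1) * exp y).
Proof.
  set (mu := nu - 1 / 2).
  destruct (log_growth (Rabs mu) 1 (Rabs_pos _) Rlt_0_1) as [C HC].
  exists ((Rabs mu + 1) * exp C). pose proof (Rabs_pos mu).
  split; [pose proof (exp_pos C); nra|].
  intros theta x y. pose proof (exp_pos y) as Hu. 
  unfold hankel_kernel, hankel_env, hankel_arg. fold mu.
  rewrite Rplus_0_r. set (u := exp y) in *.
  set (k := fun t => exp (mu / 2 * ln (t ^ 2 + 4)) *
     cos (x + theta - mu * (PI / 2) + mu * atan (t / 2))).
  assert (E : exp ((nu + 1 / 2) * y - x * u + mu / 2 * ln (u ^ 2 + 4)) *
      cos (x - mu * atan (2 * exp (- y)) + theta) -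
      Rpower 2 mu * cos (x - mu * (PI / 2) + theta) * exp ((nu + 1 / 2) * y - x * u)
      = exp ((nu + 1 / 2) * y - x * u) * (k u - k 0)).
  { unfold k. rewrite exp_plus.
    replace (0 ^ 2 + 4) with (2 * 2) by ring. rewrite ln_mult by lra.
    replace (mu / 2 * (ln 2 + ln 2)) with (mu * ln 2) by field. fold (Rpower 2 mu).
    replace (0 / 2) with 0 by field. rewrite atan_0, Rmult_0_r, Rplus_0_r.
    replace (2 * exp (- y)) with (/ (u / 2)) by (unfold u; rewrite exp_Ropp; field; apply Rgt_not_eq, exp_pos).
    rewrite atan_inv by lra.
    replace (x - mu * (PI / 2 - atan (u / 2)) + theta)
      with (x + theta - mu * (PI / 2) + mu * atan (u / 2)) by ring.
    replace (x - mu * (PI / 2) + theta) with (x + theta - mu * (PI / 2)) by ring. ring. }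
  rewrite E. clear E.
  assert (B : Rabs (k u - k 0) <= Rabs mu * exp (1 * u + C) * Rabs (u - 0)).
  { apply mean_value_bound with (df := fun t => exp (mu / 2 * ln (t ^ 2 + 4)) * (mu / (t ^ 2 + 4)) *
       (t * cos (x + theta - mu * (PI / 2) + mu * atan (t / 2))
        + (- 2) * sin (x + theta - mu * (PI / 2) + mu * atan (t / 2)))).
    - intros t _. unfold k.
      unfold Rdiv. auto_derive; [repeat split; nra|].
      change (t ^ 2) with (t * (t * 1)). apply Rminus_diag_uniq.
      field. repeat split; nra.
    - intros t. rewrite Rmin_left, Rmax_right by lra. intros Ht.
      rewrite !Rabs_mult, (Rabs_pos_eq (exp _)) by (left; apply exp_pos).
      unfold Rdiv at 2. rewrite Rabs_mult, Rabs_inv, (Rabs_pos_eq (t ^ 2 + 4)) by nra.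
      pose proof (Rabs_trig_le t (-2) (x + theta - mu * (PI / 2) + mu * atan (t / 2))) as T.
      rewrite (Rabs_pos_eq t), (Rabs_left (-2)) in T by lra.
      set (w := Rabs (t * cos _ + _)) in *.
      assert (Hw : / (t ^ 2 + 4) * w <= 1).
      { apply Rmult_le_reg_l with (t ^ 2 + 4); [nra|].
        rewrite <- Rmult_assoc, Rinv_r by nra. nra. }
      assert (Hx : exp (mu / 2 * ln (t ^ 2 + 4)) <= exp (1 * u + C)).
      { apply exp_le_exp. specialize (HC mu t (Rle_refl _) ltac:(lra)).
        apply Rabs_le_between in HC. lra. }
      pose proof (exp_pos (mu / 2 * ln (t ^ 2 + 4))).
      replace (exp (mu / 2 * ln (t ^ 2 + 4)) * (Rabs mu * / (t ^ 2 + 4)) * w)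
        with (Rabs mu * exp (mu / 2 * ln (t ^ 2 + 4)) * (/ (t ^ 2 + 4) * w)) by ring.
      rewrite <- (Rmult_1_r (Rabs mu * exp (1 * u + C))).
      apply Rmult_le_compat; try nra.
      apply Rmult_le_pos; [left; apply Rinv_0_lt_compat; nra | apply Rabs_pos]. }
  rewrite Rabs_mult, (Rabs_pos_eq (exp _)) by (left; apply exp_pos).
  rewrite Rminus_0_r, (Rabs_pos_eq u) in B by lra.
  apply Rle_trans with (exp ((nu + 1 / 2) * y - x * u) * (Rabs mu * exp (1 * u + C) * u)).
  - apply Rmult_le_compat_l; auto. left; apply exp_pos.
  - replace ((nu + 1 / 2 + 1) * y - (x - 1) * u)
      with (((nu + 1 / 2) * y - x * u) + (1 * u + y)) by ring.
    rewrite !exp_plus. fold u.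
    pose proof (exp_pos ((nu + 1 / 2) * y - x * u)). pose proof (exp_pos (1 * u)).
    pose proof (exp_pos C).
    apply Rle_trans with ((Rabs mu * exp C) * (exp ((nu + 1 / 2) * y - x * u) * (exp (1 * u) * u)));
      [right; ring|].
    apply Rmult_le_compat_r; [|nra].
    left; repeat apply Rmult_lt_0_compat; auto.
Qed.

(** The modulus of [(- 2 i)^mu Gam (mu + 1)]. *)
Definition hankel_amp (nu : R) : R := Rpower 2 (nu - 1 / 2) * Gam (nu + 1 / 2).

Lemma hankel_amp_pos nu : 0 < nu + 1 / 2 -> 0 < hankel_amp nu.
Proof. intros H. apply Rmult_lt_0_compat; [apply exp_pos | apply Gam_pos; auto]. Qed.

Lemma tail_power x a : 2 <= x -> 0 < a ->
  Rpower x a * Rpower (x - 1) (- (a + 1)) <= Rpower 2 (a + 1) / x.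
Proof.
  intros Hx Ha.
  apply Rle_trans with (Rpower x a * Rpower (x / 2) (- (a + 1))).
  - apply Rmult_le_compat_l; [left; apply exp_pos|]. apply Rpower_le_neg; lra.
  - right. unfold Rpower, Rdiv. rewrite <- (exp_ln (/ x)) by (apply Rinv_0_lt_compat; lra).
    rewrite ln_mult, !ln_Rinv by (try apply Rinv_0_lt_compat; lra).
    rewrite <- !exp_plus. f_equal. ring.
Qed.

(** The error is an integral of [u] times the Gamma kernel, one power of [1 / x] smaller
    than the main term. *)
Lemma hankel_L_infty nu : 0 < nu + 1 / 2 -> exists C, 0 < C /\ forall theta x, 2 <= x ->
  Rabs (Rpower x (nu + 1 / 2) * hankel_L nu 0 theta x -
     hankel_amp nu * cos (x - (nu - 1 / 2) * (PI / 2) + theta)) <= C / x /\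
  Rabs (Rpower x (nu + 1 / 2) * hankel_L nu (0 + 1) theta x) <= C / x.
Proof.
  intros Ha. destruct (hankel_kernel_small_u nu) as [C1 [HC1 B1]].
  destruct (hankel_env_bound nu 1 Rlt_0_1) as [C2 B2].
  set (a := nu + 1 / 2) in *.
  pose proof (Gam_pos (a + 1) ltac:(lra)) as G.
  pose proof (exp_pos (ln 2 * (a + 1))) as P2. 
  assert (HP : 0 < Rpower 2 (a + 1)) by apply exp_pos.
  exists ((C1 + exp C2) * Gam (a + 1) * Rpower 2 (a + 1)).
  pose proof (exp_pos C2).
  split; [repeat apply Rmult_lt_0_compat; auto; lra|].
  intros theta x Hx.
  assert (DK : forall k, 0 < k -> decays (fun y => exp (a * y - k * exp y)))
    by (intros; apply decays_gamma_kernel; lra).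
  assert (DK1 : forall k, 0 < k -> decays (fun y => exp ((a + 1) * y - k * exp y)))
    by (intros; apply decays_gamma_kernel; lra).
  assert (Hfin : forall K I, 0 < K <= C1 + exp C2 ->
    Rabs I <= lineint (fun y => K * exp ((a + 1) * y - (x - 1) * exp y)) ->
    Rabs (Rpower x a * I) <= (C1 + exp C2) * Gam (a + 1) * Rpower 2 (a + 1) / x).
  { intros K I HK HI. rewrite lineint_scal, Gam_scale in HI by (try apply DK1; lra).
    pose proof (tail_power x a Hx Ha) as T.
    assert (0 < Rpower x a) by apply exp_pos.
    assert (0 < Rpower (x - 1) (- (a + 1))) by apply exp_pos.
    rewrite Rabs_mult, (Rabs_pos_eq (Rpower x a)) by lra.
    apply Rle_trans with (K * Gam (a + 1) * (Rpower x a * Rpower (x - 1) (- (a + 1)))).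
    - apply Rle_trans with (Rpower x a * (K * (Rpower (x - 1) (- (a + 1)) * Gam (a + 1))));
        [|right; ring].
      apply Rmult_le_compat_l; lra.
    - apply Rle_trans with ((C1 + exp C2) * Gam (a + 1) * (Rpower 2 (a + 1) / x));
        [|right; unfold Rdiv; ring].
      apply Rmult_le_compat; try nra. }
  split.
  - set (k0 := Rpower 2 (nu - 1 / 2) * cos (x - (nu - 1 / 2) * (PI / 2) + theta)) in *.
    replace (Rpower x a * hankel_L nu 0 theta x -
      hankel_amp nu * cos (x - (nu - 1 / 2) * (PI / 2) + theta)) with
      (Rpower x a * (hankel_L nu 0 theta x - k0 * lineint (fun y => exp (a * y - x * exp y)))).
    + apply (Hfin C1); [lra|]. unfold hankel_L.
      assert (D1 : decays (fun y => k0 * exp (a * y - x * exp y)))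
        by (apply decays_scal, DK; lra).
      assert (D2 : decays (hankel_kernel nu 0 theta x))
        by (apply decays_hankel_kernel; fold a; lra).
      rewrite <- lineint_scal by (apply DK; lra). rewrite <- lineint_minus by auto.
      apply lineint_abs_le; [apply decays_minus; auto | apply decays_scal, DK1; lra |].
      intros y. apply B1.
    + rewrite Gam_scale by lra. unfold hankel_amp, k0. fold a.
      replace (Rpower x a * (hankel_L nu 0 theta x - Rpower 2 (nu - 1 / 2) *
        cos (x - (nu - 1 / 2) * (PI / 2) + theta) * (Rpower x (- a) * Gam a)))
      with (Rpower x a * hankel_L nu 0 theta x - Rpower 2 (nu - 1 / 2) *
        cos (x - (nu - 1 / 2) * (PI / 2) + theta) * ((Rpower x a * Rpower x (- a)) * Gam a)) by ring.
      rewrite <- Rpower_plus. replace (a + - a) with 0 by ring. rewrite Rpower_O by lra. ring.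
  - apply (Hfin (exp C2)); [lra|]. unfold hankel_L.
    apply lineint_abs_le; [apply decays_hankel_kernel; fold a; lra | apply decays_scal, DK1; lra |].
    intros y. eapply Rle_trans; [apply hankel_kernel_le_env|].
    eapply Rle_trans; [apply B2|]. fold a.
    replace (a + (0 + 1)) with (a + 1) by ring. apply Rle_refl.
Qed.

(** The asymptotics of the derivative is included because Wronskians are evaluated at
    infinity. *)
Definition bessel_asym (f f1 : R -> R) (A alpha : R) : Prop :=
  is_lim (fun x => sqrt x * f x - A * cos (x - alpha)) p_infty 0 /\
  is_lim (fun x => sqrt x * f1 x + A * sin (x - alpha)) p_infty 0.

Lemma is_lim_0_bound f C x0 : (forall x, x0 <= x -> Rabs (f x) <= C / x) ->
  is_lim f p_infty 0.
Proof.
  intros H. apply is_lim_spec. intros eps.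
  set (M := Rmax x0 (Rmax 1 ((Rabs C + 1) / eps))).
  exists M. intros x Hx. rewrite Rminus_0_r.
  assert (x0 <= M) by apply Rmax_l.
  assert (1 <= M) by (eapply Rle_trans; [|apply Rmax_r]; apply Rmax_l).
  assert ((Rabs C + 1) / eps <= M) by (eapply Rle_trans; [|apply Rmax_r]; apply Rmax_r).
  pose proof (cond_pos eps). pose proof (Rabs_pos C).
  apply Rle_lt_trans with (C / x); [apply H; lra|].
  apply Rmult_lt_reg_r with x; [lra|]. unfold Rdiv. rewrite Rmult_assoc, Rinv_l by lra.
  assert (Rabs C + 1 <= M * eps).
  { apply Rmult_le_reg_r with (/ eps); [apply Rinv_0_lt_compat; auto|].
    rewrite (Rmult_assoc M), Rinv_r by lra. lra. }
  pose proof (Rle_abs C). nra.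
Qed.

Lemma bessel_asym_hankel nu theta : 0 < nu + 1 / 2 ->
  bessel_asym (hankel nu theta) (hankel1 nu theta) (hankel_amp nu)
    ((nu - 1 / 2) * (PI / 2) - theta).
Proof.
  intros Ha. destruct (hankel_L_infty nu Ha) as [C [HC B]].
  assert (S : forall x, 2 <= x -> Rpower x (nu + 1 / 2) = sqrt x * Rpower x nu).
  { intros x Hx. rewrite Rpower_plus, <- Rpower_sqrt by lra.
    replace (1 / 2) with (/ 2) by field. ring. }
  split.
  - apply is_lim_0_bound with C 2. intros x Hx.
    destruct (B theta x Hx) as [B1 _]. rewrite S in B1 by auto.
    unfold hankel. rewrite <- Rmult_assoc.
    replace (x - ((nu - 1 / 2) * (PI / 2) - theta)) with (x - (nu - 1 / 2) * (PI / 2) + theta)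
      by ring. exact B1.
  - pose proof (hankel_amp_pos nu Ha) as HA.
    apply is_lim_0_bound with (Rabs nu * (C + hankel_amp nu) + 2 * C) 2. intros x Hx.
    destruct (B theta x Hx) as [B1 B2].
    destruct (B (theta + PI / 2) x Hx) as [B3 _].
    rewrite S in B1, B2, B3 by auto. rewrite cos_shift_add in B3.
    replace (x - ((nu - 1 / 2) * (PI / 2) - theta)) with (x - (nu - 1 / 2) * (PI / 2) + theta)
      by ring.
    set (t := x - (nu - 1 / 2) * (PI / 2) + theta) in *.
    unfold hankel1. set (P := Rpower x nu) in *.
    set (L0 := hankel_L nu 0 theta x) in *. set (L1 := hankel_L nu (0 + 1) theta x) in *.
    set (L0' := hankel_L nu 0 (theta + PI / 2) x) in *.
    replace (sqrt x * (P * (nu / x * L0 + (L0' - L1))) + hankel_amp nu * sin t)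
      with (nu / x * (sqrt x * P * L0) + (sqrt x * P * L0' - hankel_amp nu * - sin t)
        - sqrt x * P * L1) by ring.
    assert (B4 : Rabs (sqrt x * P * L0) <= C + hankel_amp nu).
    { replace (sqrt x * P * L0) with ((sqrt x * P * L0 - hankel_amp nu * cos t)
        + hankel_amp nu * cos t) by ring.
      eapply Rle_trans; [apply Rabs_triang|]. apply Rplus_le_compat.
      - apply Rle_trans with (1 := B1). apply Rmult_le_reg_r with x; [lra|].
        unfold Rdiv. rewrite Rmult_assoc, Rinv_l by lra. nra.
      - rewrite Rabs_mult, (Rabs_pos_eq (hankel_amp nu)) by lra.
        assert (Rabs (cos t) <= 1) by (apply Rabs_le, COS_bound). nra. }
    unfold Rminus at 1. eapply Rle_trans; [apply Rabs_triang|]. rewrite Rabs_Ropp.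
    eapply Rle_trans; [apply Rplus_le_compat_r, Rabs_triang|].
    rewrite Rabs_mult. unfold Rdiv at 1. rewrite (Rabs_mult nu), Rabs_inv, (Rabs_pos_eq x) by lra.
    apply Rle_trans with (Rabs nu * / x * (C + hankel_amp nu) + C / x + C / x);
      [|right; unfold Rdiv; ring].
    apply Rplus_le_compat; auto. apply Rplus_le_compat; auto.
    apply Rmult_le_compat_l; auto.
    apply Rmult_le_pos; [apply Rabs_pos | left; apply Rinv_0_lt_compat; lra].
Qed.

(** For small [x] only large [u] matter; there [(u - 2 i)^mu] is close to [u^mu]. *)
Lemma hankel_kernel_large_u nu j : 3 / 2 <= nu -> exists C, 0 < C /\ forall theta x y,
  Rabs (hankel_kernel nu j theta x y -
     cos (x + theta) * exp ((2 * nu + j) * y - x * exp y))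
  <= C * (exp ((2 * nu + j - 1) * y - x * exp y) + exp ((nu + 1 / 2 + j) * y - x * exp y)).
Proof.
  intros Hnu. set (mu := nu - 1 / 2). assert (Hmu : 1 <= mu) by (unfold mu; lra).
  set (p := (mu - 1) / 2). assert (Hp : 0 <= p) by (unfold p; lra).
  set (D := exp (p * ln 2) + exp (p * ln 8)).
  exists (4 * mu * D).
  assert (HD : 0 < D) by (unfold D; pose proof (exp_pos (p * ln 2)); pose proof (exp_pos (p * ln 8)); lra).
  split; [nra|]. intros theta x y. pose proof (exp_pos y) as Hu.
  unfold hankel_kernel, hankel_env, hankel_arg. fold mu. set (u := exp y) in *.
  set (k := fun b => exp (mu / 2 * ln (u ^ 2 + b ^ 2)) * cos (x + theta - mu * atan (b / u))).
  set (E0 := exp ((nu + 1 / 2 + j) * y - x * u)).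
  assert (E : exp ((nu + 1 / 2 + j) * y - x * u + mu / 2 * ln (u ^ 2 + 4)) *
      cos (x - mu * atan (2 * exp (- y)) + theta) -
      cos (x + theta) * exp ((2 * nu + j) * y - x * u) = E0 * (k 2 - k 0)).
  { unfold k, E0. rewrite exp_plus. replace (2 ^ 2) with 4 by ring.
    replace (u ^ 2 + 0 ^ 2) with (u * u) by ring. rewrite ln_mult by lra.
    assert (Hlu : ln u = y) by (unfold u; apply ln_exp). rewrite !Hlu.
    replace (0 / u) with 0 by (field; lra). rewrite atan_0, Rmult_0_r, Rminus_0_r.
    replace (2 * exp (- y)) with (2 / u) by (unfold u; rewrite exp_Ropp; field; apply Rgt_not_eq, exp_pos).
    replace ((2 * nu + j) * y - x * u) with ((nu + 1 / 2 + j) * y - x * u + mu / 2 * (y + y))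
      by (unfold mu; field).
    rewrite (exp_plus ((nu + 1 / 2 + j) * y - x * u) (mu / 2 * (y + y))).
    replace (x - mu * atan (2 / u) + theta) with (x + theta - mu * atan (2 / u)) by ring. ring. }
  rewrite E. clear E.
  assert (B : Rabs (k 2 - k 0) <= 2 * mu * exp (p * ln (u ^ 2 + 4)) * Rabs (2 - 0)).
  { apply mean_value_bound with (df := fun b => exp (mu / 2 * ln (u ^ 2 + b ^ 2)) *
       (mu / (u ^ 2 + b ^ 2)) * (b * cos (x + theta - mu * atan (b / u))
        + u * sin (x + theta - mu * atan (b / u)))).
    - intros b _. unfold k.
      unfold Rdiv. auto_derive; [repeat split; nra|].
      change (b ^ 2) with (b * (b * 1)). change (u ^ 2) with (u * (u * 1)). unfold Rminus.
      apply Rminus_diag_uniq. field. repeat split; nra.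
    - intros b. rewrite Rmin_left, Rmax_right by lra. intros Hb.
      set (q := u ^ 2 + b ^ 2). assert (Hq : 0 < q) by (unfold q; nra).
      rewrite !Rabs_mult, (Rabs_pos_eq (exp _)) by (left; apply exp_pos).
      unfold Rdiv at 2. rewrite Rabs_mult, Rabs_inv, (Rabs_pos_eq q), (Rabs_pos_eq mu) by lra.
      pose proof (Rabs_trig_le b u (x + theta - mu * atan (b / u))) as T.
      rewrite (Rabs_pos_eq b), (Rabs_pos_eq u) in T by lra.
      set (w := Rabs (b * cos _ + _)) in *.
      assert (Hs : b + u <= 2 * sqrt q).
      { assert (b <= sqrt q) by (rewrite <- (sqrt_pow2 b) by lra; apply sqrt_le_1; unfold q; nra).
        assert (u <= sqrt q) by (rewrite <- (sqrt_pow2 u) by lra; apply sqrt_le_1; unfold q; nra).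
        lra. }
      assert (Hx : exp (mu / 2 * ln q) = exp (p * ln q) * sqrt q).
      { rewrite <- Rpower_sqrt by auto. unfold Rpower. rewrite <- exp_plus. f_equal. unfold p. field. }
      assert (Hsq : sqrt q * sqrt q = q) by (apply sqrt_sqrt; lra).
      assert (Hsp : 0 < sqrt q) by (apply sqrt_lt_R0; auto).
      rewrite Hx.
      assert (HE : exp (p * ln q) <= exp (p * ln (u ^ 2 + 4))).
      { apply exp_le_exp. apply Rmult_le_compat_l; auto. apply ln_le; unfold q; nra. }
      apply Rle_trans with (2 * mu * exp (p * ln q)); [|nra].
      apply Rmult_le_reg_r with q; auto.
      replace (exp (p * ln q) * sqrt q * (mu * / q) * w * q)
        with (mu * exp (p * ln q) * (sqrt q * w)) by (field; lra).
      replace (2 * mu * exp (p * ln q) * q) with (mu * exp (p * ln q) * (2 * q)) by ring.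
      apply Rmult_le_compat_l; [pose proof (exp_pos (p * ln q)); nra|].
      rewrite <- Hsq at 2. nra. }
  rewrite Rabs_mult, (Rabs_pos_eq E0) by (left; apply exp_pos).
  rewrite Rminus_0_r, (Rabs_pos_eq 2) in B by lra.
  assert (HE0 : 0 < E0) by apply exp_pos.
  assert (G : exp (p * ln (u ^ 2 + 4)) <= D * (exp (2 * p * y) + 1)).
  { assert (X : forall c d, 0 < c <= d -> exp (p * ln c) <= exp (p * ln d)).
    { intros c d Hcd. apply exp_le_exp, Rmult_le_compat_l; auto. apply ln_le; lra. }
    pose proof (exp_pos (p * ln 2)). pose proof (exp_pos (p * ln 8)). pose proof (exp_pos (2 * p * y)).
    destruct (Rle_lt_dec 2 u) as [H2 | H2].
    - apply Rle_trans with (exp (p * ln (2 * (u * u)))); [apply X; nra|].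
      rewrite !ln_mult by nra. assert (Hlu : ln u = y) by (unfold u; apply ln_exp).
      rewrite !Hlu.
      rewrite Rmult_plus_distr_l, exp_plus. replace (p * (y + y)) with (2 * p * y) by ring.
      unfold D. nra.
    - apply Rle_trans with (exp (p * ln 8)); [apply X; nra|]. unfold D. nra. }
  apply Rle_trans with (E0 * (2 * mu * (D * (exp (2 * p * y) + 1)) * 2)).
  { apply Rmult_le_compat_l; [lra|]. apply Rle_trans with (1 := B). nra. }
  right.
  replace ((2 * nu + j - 1) * y - x * u) with ((nu + 1 / 2 + j) * y - x * u + 2 * p * y)
    by (unfold p, mu; field).
  rewrite (exp_plus _ (2 * p * y)). fold E0. ring.
Qed.

Lemma hankel_L_zero nu j : 3 / 2 <= nu -> 0 <= j -> exists C, forall theta x, 0 < x <= 1 ->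
  Rabs (Rpower x (2 * nu + j) * hankel_L nu j theta x - Gam (2 * nu + j) * cos theta) <= C * x.
Proof.
  intros Hnu Hj. destruct (hankel_kernel_large_u nu j Hnu) as [C [HC B]].
  set (a1 := 2 * nu + j). set (a2 := 2 * nu + j - 1). set (a3 := nu + 1 / 2 + j).
  pose proof (Gam_pos a1 ltac:(unfold a1; lra)) as G1.
  pose proof (Gam_pos a2 ltac:(unfold a2; lra)) as G2.
  pose proof (Gam_pos a3 ltac:(unfold a3; lra)) as G3.
  exists (C * (Gam a2 + Gam a3) + Gam a1). intros theta x Hx.
  assert (D1 : decays (fun y => exp (a1 * y - x * exp y))) by (apply decays_gamma_kernel; unfold a1; lra).
  assert (D2 : decays (fun y => exp (a2 * y - x * exp y))) by (apply decays_gamma_kernel; unfold a2; lra).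
  assert (D3 : decays (fun y => exp (a3 * y - x * exp y))) by (apply decays_gamma_kernel; unfold a3; lra).
  assert (DK : decays (hankel_kernel nu j theta x)) by (apply decays_hankel_kernel; lra).
  assert (A : Rabs (hankel_L nu j theta x - cos (x + theta) * (Rpower x (- a1) * Gam a1))
     <= C * (Rpower x (- a2) * Gam a2 + Rpower x (- a3) * Gam a3)).
  { unfold hankel_L. rewrite <- !Gam_scale by (unfold a1, a2, a3; lra).
    rewrite <- lineint_plus, <- !lineint_scal, <- lineint_minus
      by auto using decays_scal, decays_plus.
    apply lineint_abs_le; auto using decays_scal, decays_plus, decays_minus. }
  assert (P1 : Rpower x a1 * Rpower x (- a1) = 1).
  { rewrite <- Rpower_plus. replace (a1 + - a1) with 0 by ring. apply Rpower_O; lra. }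
  assert (P2 : Rpower x a1 * Rpower x (- a2) = x).
  { rewrite <- Rpower_plus. replace (a1 + - a2) with 1 by (unfold a1, a2; ring).
    apply Rpower_1; lra. }
  assert (P3 : Rpower x a1 * Rpower x (- a3) <= x).
  { rewrite <- Rpower_plus. rewrite <- (Rpower_1 x) at 2 by lra. unfold Rpower.
    apply exp_le_exp.
    assert (ln x <= 0) by (rewrite <- ln_1; apply ln_le; lra).
    assert (1 <= a1 + - a3) by (unfold a1, a3; lra). nra. }
  assert (HP : 0 < Rpower x a1) by apply exp_pos.
  assert (Q : Rabs (cos (x + theta) - cos theta) <= x).
  { replace x with (1 * Rabs ((x + theta) - theta)) at 2
      by (replace (x + theta - theta) with x by ring; rewrite Rabs_pos_eq; lra).
    apply mean_value_bound with (df := fun t => - sin t).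
    - intros t _. auto_derive; auto. ring.
    - intros t _. rewrite Rabs_Ropp. apply Rabs_le, SIN_bound. }
  replace (Rpower x a1 * hankel_L nu j theta x - Gam a1 * cos theta) with
    (Rpower x a1 * (hankel_L nu j theta x - cos (x + theta) * (Rpower x (- a1) * Gam a1))
     + Gam a1 * (cos (x + theta) - cos theta)).
  2:{ replace (Rpower x a1 * (hankel_L nu j theta x - cos (x + theta) * (Rpower x (- a1) * Gam a1)))
      with (Rpower x a1 * hankel_L nu j theta x
        - cos (x + theta) * ((Rpower x a1 * Rpower x (- a1)) * Gam a1)) by ring.
      rewrite P1. ring. }
  eapply Rle_trans; [apply Rabs_triang|]. rewrite !Rabs_mult.
  rewrite (Rabs_pos_eq (Rpower x a1)), (Rabs_pos_eq (Gam a1)) by lra.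
  rewrite Rmult_plus_distr_r. apply Rplus_le_compat; [|apply Rmult_le_compat_l; lra].
  apply Rle_trans with (Rpower x a1 * (C * (Rpower x (- a2) * Gam a2 + Rpower x (- a3) * Gam a3))).
  - apply Rmult_le_compat_l; [lra | auto].
  - replace (Rpower x a1 * (C * (Rpower x (- a2) * Gam a2 + Rpower x (- a3) * Gam a3)))
      with (C * ((Rpower x a1 * Rpower x (- a2)) * Gam a2 + (Rpower x a1 * Rpower x (- a3)) * Gam a3))
      by ring.
    rewrite P2. replace (C * (Gam a2 + Gam a3) * x) with (C * ((Gam a2 + Gam a3) * x)) by ring.
    apply Rmult_le_compat_l; [lra|]. nra.
Qed.

(** * Wronskians and the connection formulas *)

Lemma is_derive_zero_const (f : R -> R) a b : 0 < a -> 0 < b ->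
  (forall x, 0 < x -> is_derive f x 0) -> f a = f b.
Proof.
  intros Ha Hb H. destruct (mean_value f (fun _ => 0) a b) as [c [_ E]]; [|lra].
  intros x Hx. apply H. apply Rlt_le_trans with (2 := proj1 Hx). apply Rmin_pos; auto.
Qed.

Definition wronskian (f f1 g g1 : R -> R) (x : R) : R := x * (f x * g1 x - f1 x * g x).

Lemma wronskian_const nu f f1 g g1 x y : bessel_sol nu f f1 -> bessel_sol nu g g1 ->
  0 < x -> 0 < y -> wronskian f f1 g g1 x = wronskian f f1 g g1 y.
Proof.
  intros Hf Hg Hx Hy. apply is_derive_zero_const; auto. intros t Ht.
  destruct (Hf t Ht) as [F1 F2]. destruct (Hg t Ht) as [G1 G2]. unfold wronskian.
  auto_derive.
  - repeat split; eexists; eassumption.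
  - replace (Derive (fun x => f x) t) with (f1 t) by (symmetry; apply is_derive_unique, F1).
    replace (Derive (fun x => g x) t) with (g1 t) by (symmetry; apply is_derive_unique, G1).
    replace (Derive (fun x => f1 x) t) with (- (f1 t / t) - (1 - nu ^ 2 / t ^ 2) * f t)
      by (symmetry; apply is_derive_unique, F2).
    replace (Derive (fun x => g1 x) t) with (- (g1 t / t) - (1 - nu ^ 2 / t ^ 2) * g t)
      by (symmetry; apply is_derive_unique, G2).
    apply Rminus_diag_uniq. field. lra.
Qed.

Definition vanish (f : R -> R) : Prop := is_lim f p_infty 0.

Lemma vanish_spec f : vanish f <-> forall eps : posreal, exists M, forall x, M < x -> Rabs (f x) < eps.
Proof.
  unfold vanish. rewrite <- is_lim_spec. simpl.
  split; intros H eps; destruct (H eps) as [M HM]; exists M; intros x Hx;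
    specialize (HM x Hx); rewrite Rminus_0_r in *; auto.
Qed.

Lemma vanish_ext f g M : (forall x, M < x -> f x = g x) -> vanish f -> vanish g.
Proof.
  intros H. apply is_lim_ext_loc. exists M. auto.
Qed.

Lemma vanish_plus f g : vanish f -> vanish g -> vanish (fun x => f x + g x).
Proof.
  intros Hf Hg. unfold vanish. replace (Finite 0) with (Finite (0 + 0)) by (f_equal; ring).
  apply (is_lim_plus' f g); auto.
Qed.

Lemma vanish_bounded f g K M : vanish f -> (forall x, M < x -> Rabs (g x) <= K) ->
  vanish (fun x => f x * g x).
Proof.
  intros Hf Hg. apply vanish_spec. rewrite vanish_spec in Hf. intros eps.
  assert (HK : 0 < Rabs K + 1) by (pose proof (Rabs_pos K); lra).
  destruct (Hf (mkposreal _ (Rdiv_lt_0_compat _ _ (cond_pos eps) HK))) as [M' HM'].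
  exists (Rmax M M'). intros x Hx.
  assert (M < x) by (eapply Rle_lt_trans; [apply Rmax_l | exact Hx]).
  assert (M' < x) by (eapply Rle_lt_trans; [apply Rmax_r | exact Hx]).
  specialize (HM' x H0). specialize (Hg x H). simpl in HM'.
  rewrite Rabs_mult. pose proof (Rabs_pos (f x)). pose proof (Rabs_pos (g x)).
  pose proof (Rle_abs K). pose proof (cond_pos eps).
  apply Rle_lt_trans with (Rabs (f x) * (Rabs K + 1)); [nra|].
  apply Rlt_le_trans with (eps / (Rabs K + 1) * (Rabs K + 1)).
  - apply Rmult_lt_compat_r; auto.
  - right. field. lra.
Qed.

Lemma vanish_scal k f : vanish f -> vanish (fun x => k * f x).
Proof.
  intros Hf. apply (vanish_ext (fun x => f x * k) _ 0); [intros; ring|].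
  apply vanish_bounded with (Rabs k) 0; auto. intros; lra.
Qed.

Lemma vanish_inv k : vanish (fun x => k / x).
Proof.
  apply is_lim_0_bound with (Rabs k) 1. intros x Hx. unfold Rdiv.
  rewrite Rabs_mult, Rabs_inv, (Rabs_pos_eq x) by lra. apply Rle_refl.
Qed.

Lemma vanish_const c : vanish (fun _ => c) -> c = 0.
Proof.
  intros H. unfold vanish in H. apply is_lim_unique in H. rewrite Lim_const in H.
  injection H. auto.
Qed.

Lemma vanish_eventually_bounded f : vanish f -> exists M, forall x, M < x -> Rabs (f x) <= 1.
Proof.
  intros H. rewrite vanish_spec in H. destruct (H (mkposreal 1 Rlt_0_1)) as [M HM].
  exists M. intros x Hx. left. apply (HM x Hx).
Qed.

Lemma Rabs_cos_le t : Rabs (cos t) <= 1.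
Proof. apply Rabs_le, COS_bound. Qed.
Lemma Rabs_sin_le t : Rabs (sin t) <= 1.
Proof. apply Rabs_le, SIN_bound. Qed.

Lemma asym_bounded f f1 A al : bessel_asym f f1 A al -> exists M,
  (forall x, M < x -> Rabs (sqrt x * f x) <= 1 + Rabs A) /\
  (forall x, M < x -> Rabs (sqrt x * f1 x) <= 1 + Rabs A).
Proof.
  intros [H1 H2].
  destruct (vanish_eventually_bounded _ H1) as [M1 B1].
  destruct (vanish_eventually_bounded _ H2) as [M2 B2].
  exists (Rmax M1 M2). pose proof (Rabs_pos A).
  split; intros x Hx.
  - specialize (B1 x (Rle_lt_trans _ _ _ (Rmax_l _ _) Hx)).
    replace (sqrt x * f x) with ((sqrt x * f x - A * cos (x - al)) + A * cos (x - al)) by ring.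
    eapply Rle_trans; [apply Rabs_triang|]. apply Rplus_le_compat; auto.
    rewrite Rabs_mult. pose proof (Rabs_cos_le (x - al)). nra.
  - specialize (B2 x (Rle_lt_trans _ _ _ (Rmax_r _ _) Hx)).
    replace (sqrt x * f1 x) with ((sqrt x * f1 x + A * sin (x - al)) + A * - sin (x - al)) by ring.
    eapply Rle_trans; [apply Rabs_triang|]. apply Rplus_le_compat; auto.
    rewrite Rabs_mult, Rabs_Ropp. pose proof (Rabs_sin_le (x - al)). nra.
Qed.

(** A constant Wronskian can be read off at infinity, where only the leading terms
    contribute. *)
Lemma wronskian_asym nu f f1 g g1 A al B be x :
  bessel_sol nu f f1 -> bessel_sol nu g g1 ->
  bessel_asym f f1 A al -> bessel_asym g g1 B be -> 0 < x ->
  wronskian f f1 g g1 x = A * B * sin (be - al).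
Proof.
  intros Sf Sg Af Ag Hx. apply Rminus_diag_uniq. apply vanish_const.
  destruct (asym_bounded _ _ _ _ Ag) as [M [G0 G1]].
  destruct Af as [F0 F1]. destruct Ag as [g0 g01].
  apply (vanish_ext (fun t =>
     ((sqrt t * f t - A * cos (t - al)) * (sqrt t * g1 t)
      + (sqrt t * g1 t + B * sin (t - be)) * (A * cos (t - al)))
    + ((sqrt t * f1 t + A * sin (t - al)) * - (sqrt t * g t)
      + (sqrt t * g t - B * cos (t - be)) * (A * sin (t - al)))) _ 0).
  - intros t Ht. rewrite (wronskian_const nu f f1 g g1 x t) by auto. unfold wronskian.
    replace (t * (f t * g1 t - f1 t * g t))
      with (sqrt t * sqrt t * (f t * g1 t - f1 t * g t)) by (rewrite sqrt_sqrt; lra).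
    replace (be - al) with ((t - al) - (t - be)) by ring. rewrite (sin_minus (t - al)). ring.
  - apply vanish_plus; apply vanish_plus.
    + apply vanish_bounded with (1 + Rabs B) M; auto.
    + apply vanish_bounded with (Rabs A) 0; auto. intros t _. rewrite Rabs_mult.
      pose proof (Rabs_cos_le (t - al)). pose proof (Rabs_pos A). nra.
    + apply vanish_bounded with (1 + Rabs B) M; auto. intros t Ht. rewrite Rabs_Ropp; auto.
    + apply vanish_bounded with (Rabs A) 0; auto. intros t _. rewrite Rabs_mult.
      pose proof (Rabs_sin_le (t - al)). pose proof (Rabs_pos A). nra.
Qed.

Lemma bessel_sol_lin nu a b f f1 g g1 : bessel_sol nu f f1 -> bessel_sol nu g g1 ->
  bessel_sol nu (fun x => a * f x + b * g x) (fun x => a * f1 x + b * g1 x).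
Proof.
  intros Hf Hg x Hx. destruct (Hf x Hx) as [F1 F2]. destruct (Hg x Hx) as [G1 G2].
  split.
  - apply (is_derive_plus (V := R_NormedModule) (fun x => a * f x) (fun x => b * g x));
      apply is_derive_scal; auto.
  - replace (- ((a * f1 x + b * g1 x) / x) - (1 - nu ^ 2 / x ^ 2) * (a * f x + b * g x))
      with (a * (- (f1 x / x) - (1 - nu ^ 2 / x ^ 2) * f x)
          + b * (- (g1 x / x) - (1 - nu ^ 2 / x ^ 2) * g x)) by (field; lra).
    apply (is_derive_plus (V := R_NormedModule) (fun x => a * f1 x) (fun x => b * g1 x));
      apply is_derive_scal; auto.
Qed.

Lemma bessel_sol_scal nu k f f1 : bessel_sol nu f f1 ->
  bessel_sol nu (fun x => k * f x) (fun x => k * f1 x).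
Proof.
  intros Hf x Hx. destruct (Hf x Hx) as [F1 F2]. split; [apply is_derive_scal; auto|].
  replace (- (k * f1 x / x) - (1 - nu ^ 2 / x ^ 2) * (k * f x))
    with (k * (- (f1 x / x) - (1 - nu ^ 2 / x ^ 2) * f x)) by (field; lra).
  apply is_derive_scal; auto.
Qed.

Lemma bessel_asym_scal k f f1 A al : bessel_asym f f1 A al ->
  bessel_asym (fun x => k * f x) (fun x => k * f1 x) (k * A) al.
Proof.
  intros [H0 H1]. split.
  - apply (vanish_ext (fun x => k * (sqrt x * f x - A * cos (x - al))) _ 0);
      [intros; ring | apply vanish_scal; auto].
  - apply (vanish_ext (fun x => k * (sqrt x * f1 x + A * sin (x - al))) _ 0);
      [intros; ring | apply vanish_scal; auto].
Qed.

(** The Wronskians of the difference with two independent solutions vanish at infinity,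
    hence everywhere. *)
Lemma bessel_sol_asym_unique nu f f1 g g1 A al x : 0 < nu + 1 / 2 ->
  bessel_sol nu f f1 -> bessel_sol nu g g1 ->
  bessel_asym f f1 A al -> bessel_asym g g1 A al -> 0 < x -> f x = g x.
Proof.
  intros Hnu Sf Sg [F0 F1] [G0 G1] Hx.
  set (d := fun x => 1 * f x + -1 * g x). set (d1 := fun x => 1 * f1 x + -1 * g1 x).
  assert (Sd : bessel_sol nu d d1) by (apply bessel_sol_lin; auto).
  assert (Ad : bessel_asym d d1 0 0).
  { split.
    - apply (vanish_ext (fun x => (sqrt x * f x - A * cos (x - al)) +
        (-1) * (sqrt x * g x - A * cos (x - al))) _ 0); [intros; unfold d; ring|].
      apply vanish_plus; [|apply vanish_scal]; auto.
    - apply (vanish_ext (fun x => (sqrt x * f1 x + A * sin (x - al)) +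
        (-1) * (sqrt x * g1 x + A * sin (x - al))) _ 0); [intros; unfold d1; ring|].
      apply vanish_plus; [|apply vanish_scal]; auto. }
  assert (W := fun th => wronskian_asym nu d d1 _ _ _ _ _ _ x Sd
     (bessel_sol_hankel nu th Hnu) Ad (bessel_asym_hankel nu th Hnu) Hx).
  assert (W0 := W 0). assert (W1 := W (- (PI / 2))).
  assert (WH := wronskian_asym nu _ _ _ _ _ _ _ _ x (bessel_sol_hankel nu 0 Hnu)
     (bessel_sol_hankel nu (- (PI / 2)) Hnu) (bessel_asym_hankel nu 0 Hnu)
     (bessel_asym_hankel nu (- (PI / 2)) Hnu) Hx).
  replace ((nu - 1 / 2) * (PI / 2) - - (PI / 2) - ((nu - 1 / 2) * (PI / 2) - 0))
    with (PI / 2) in WH by ring.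
  rewrite sin_PI2 in WH. pose proof (hankel_amp_pos nu Hnu).
  assert (E : d x * (hankel_amp nu * hankel_amp nu * 1) = 0).
  { rewrite <- WH.
    replace (d x * wronskian (hankel nu 0) (hankel1 nu 0) (hankel nu (- (PI / 2)))
      (hankel1 nu (- (PI / 2))) x) with
      (hankel nu 0 x * wronskian d d1 (hankel nu (- (PI / 2))) (hankel1 nu (- (PI / 2))) x
       - hankel nu (- (PI / 2)) x * wronskian d d1 (hankel nu 0) (hankel1 nu 0) x)
      by (unfold wronskian; ring).
    rewrite W0, W1. ring. }
  assert (d x = 0).
  { apply Rmult_integral in E. destruct E as [E | E]; auto. nra. }
  unfold d in H0. lra.
Qed.

Definition tends0 (f : R -> R) (l : R) : Prop := filterlim f (at_right 0) (locally l).

Lemma tends0_bound f C l : (forall x, 0 < x <= 1 -> Rabs (f x - l) <= C * x) -> tends0 f l.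
Proof.
  intros H. apply filterlim_locally. intros eps.
  assert (HC : 0 < Rabs C + 1) by (pose proof (Rabs_pos C); lra).
  assert (Hd : 0 < Rmin 1 (eps / (Rabs C + 1)))
    by (apply Rmin_pos; [lra | apply Rdiv_lt_0_compat; auto; apply cond_pos]).
  exists (mkposreal _ Hd). intros x Hx Hx0. change (Rabs (f x - l) < eps).
  assert (Hx' : Rabs (x - 0) < Rmin 1 (eps / (Rabs C + 1))) by exact Hx.
  rewrite Rminus_0_r, Rabs_pos_eq in Hx' by lra.
  assert (x < 1) by (eapply Rlt_le_trans; [apply Hx' | apply Rmin_l]).
  assert (x < eps / (Rabs C + 1)) by (eapply Rlt_le_trans; [apply Hx' | apply Rmin_r]).
  apply Rle_lt_trans with (C * x); [apply H; lra|].
  apply Rle_lt_trans with ((Rabs C + 1) * x); [pose proof (Rle_abs C); nra|].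
  apply Rlt_le_trans with ((Rabs C + 1) * (eps / (Rabs C + 1))).
  - apply Rmult_lt_compat_l; auto.
  - right. field. lra.
Qed.

Lemma tends0_plus f g a b : tends0 f a -> tends0 g b -> tends0 (fun x => f x + g x) (a + b).
Proof.
  intros Hf Hg. unfold tends0. 
  apply (filterlim_comp_2 (G := locally a) (H := locally b) (I := locally (a + b)) f g Rplus);
    auto. apply (filterlim_plus (V := R_NormedModule) a b).
Qed.

Lemma tends0_mult f g a b : tends0 f a -> tends0 g b -> tends0 (fun x => f x * g x) (a * b).
Proof.
  intros Hf Hg. unfold tends0.
  apply (filterlim_comp_2 (G := locally a) (H := locally b) (I := locally (a * b)) f g Rmult);
    auto. apply (filterlim_mult (K := R_AbsRing) a b).
Qed.

Lemma tends0_const c : tends0 (fun _ => c) c.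
Proof. apply filterlim_const. Qed.

Lemma tends0_ext f g l : (forall x, 0 < x -> f x = g x) -> tends0 f l -> tends0 g l.
Proof.
  intros H. apply filterlim_ext_loc. exists (mkposreal 1 Rlt_0_1). intros x _ Hx. auto.
Qed.

Lemma tends0_unique f a b : tends0 f a -> tends0 f b -> a = b.
Proof. intros Ha Hb. exact (filterlim_locally_unique f a b Ha Hb). Qed.

Lemma tends0_id : tends0 (fun x => x) 0.
Proof. apply tends0_bound with 1. intros x Hx. rewrite Rminus_0_r, Rabs_pos_eq; lra. Qed.

Lemma tends0_Rpower p : 1 <= p -> tends0 (fun x => Rpower x p) 0.
Proof.
  intros Hp. apply tends0_bound with 1. intros x Hx. rewrite Rminus_0_r, Rmult_1_l.
  rewrite Rabs_pos_eq by (left; apply exp_pos). rewrite <- (Rpower_1 x) at 2 by lra.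
  unfold Rpower. apply exp_le_exp. assert (ln x <= 0) by (rewrite <- ln_1; apply ln_le; lra). nra.
Qed.

Lemma tends0_hankel nu theta : 3 / 2 <= nu ->
  tends0 (fun x => Rpower x nu * hankel nu theta x) (Gam (2 * nu) * cos theta).
Proof.
  intros Hnu. destruct (hankel_L_zero nu 0 Hnu (Rle_refl 0)) as [C HC].
  apply tends0_bound with C. intros x Hx. specialize (HC theta x Hx).
  rewrite Rplus_0_r in HC. unfold hankel. rewrite <- Rmult_assoc, <- Rpower_plus by lra.
  replace (nu + nu) with (2 * nu) by ring. exact HC.
Qed.

Lemma tends0_hankel1 nu theta : 3 / 2 <= nu ->
  tends0 (fun x => Rpower x (nu + 1) * hankel1 nu theta x) (- nu * Gam (2 * nu) * cos theta).
Proof.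
  intros Hnu. 
  assert (T : forall j th, 0 <= j -> tends0 (fun x => Rpower x (2 * nu + j) * hankel_L nu j th x)
     (Gam (2 * nu + j) * cos th)).
  { intros j th Hj. destruct (hankel_L_zero nu j Hnu Hj) as [C HC].
    apply tends0_bound with C. auto. }
  assert (T0 := T 0 theta (Rle_refl 0)). assert (T0' := T 0 (theta + PI / 2) (Rle_refl 0)).
  assert (T1 := T (0 + 1) theta ltac:(lra)).
  apply (tends0_ext (fun x => nu * (Rpower x (2 * nu + 0) * hankel_L nu 0 theta x)
    + (x * (Rpower x (2 * nu + 0) * hankel_L nu 0 (theta + PI / 2) x)
       + (-1) * (Rpower x (2 * nu + (0 + 1)) * hankel_L nu (0 + 1) theta x)))).
  - intros x Hx. unfold hankel1.
    replace (Rpower x (2 * nu + (0 + 1))) with (Rpower x nu * (Rpower x nu * x))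
      by (rewrite <- (Rpower_1 x Hx) at 3; rewrite <- !Rpower_plus by auto; f_equal; ring).
    replace (Rpower x (2 * nu + 0)) with (Rpower x nu * Rpower x nu)
      by (rewrite <- Rpower_plus by auto; f_equal; ring).
    rewrite Rpower_plus, Rpower_1 by auto. field. lra.
  - replace (- nu * Gam (2 * nu) * cos theta) with
      (nu * (Gam (2 * nu + 0) * cos theta) + (0 * (Gam (2 * nu + 0) * cos (theta + PI / 2))
        + (-1) * (Gam (2 * nu + (0 + 1)) * cos theta))).
    + apply tends0_plus; [|apply tends0_plus].
      * exact (tends0_mult _ _ _ _ (tends0_const nu) T0).
      * exact (tends0_mult _ _ _ _ tends0_id T0').
      * exact (tends0_mult _ _ _ _ (tends0_const (-1)) T1).
    + replace (2 * nu + (0 + 1)) with (2 * nu + 1) by ring.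
      replace (2 * nu + 0) with (2 * nu) by ring. rewrite Gam_S by lra. ring.
Qed.

Definition J_0coef (nu : R) : R := Rpower 2 (- nu) * inv_Gamma (nu + 1).

Lemma tends0_J nu : tends0 (fun x => Rpower x (- nu) * bessel_J nu x) (J_0coef nu).
Proof. apply is_lim_bessel_J_0. Qed.

Lemma tends0_J1 nu : tends0 (fun x => Rpower x (1 - nu) * bessel_J1 nu x) (nu * J_0coef nu).
Proof.
  apply (tends0_ext (fun x => nu * (Rpower x (- nu) * bessel_J nu x)
    + (-1) * (x * (x * (Rpower x (- (nu + 1)) * bessel_J (nu + 1) x))))).
  - intros x Hx. unfold bessel_J1.
    replace (Rpower x (1 - nu)) with (x * Rpower x (- nu))
      by (rewrite <- (Rpower_1 x Hx) at 1; rewrite <- Rpower_plus by auto; f_equal; ring).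
    replace (Rpower x (- (nu + 1))) with (Rpower x (- nu) / x).
    + field. lra.
    + unfold Rdiv. replace (/ x) with (Rpower x (- (1))).
      * rewrite <- Rpower_plus by auto. f_equal. ring.
      * rewrite Rpower_Ropp, Rpower_1; auto.
  - replace (nu * J_0coef nu) with (nu * J_0coef nu + (-1) * (0 * (0 * J_0coef (nu + 1)))) by ring.
    apply tends0_plus.
    + exact (tends0_mult _ _ _ _ (tends0_const nu) (tends0_J nu)).
    + exact (tends0_mult _ _ _ _ (tends0_const (-1)) (tends0_mult _ _ _ _ tends0_id
        (tends0_mult _ _ _ _ tends0_id (tends0_J (nu + 1))))).
Qed.

(** This is [sqrt (2 / PI)], in the form in which the duplication formula delivers it. *)
Definition bessel_amp : R :=
  Rpower 2 (3 / 2) * (Gam (2 * 1) / (Gam 1 * Gam (1 + 1 / 2) * Rpower 2 (2 * 1))).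

Lemma bessel_amp_pos : 0 < bessel_amp.
Proof.
  unfold bessel_amp. apply Rmult_lt_0_compat; [apply exp_pos|].
  apply Rdiv_lt_0_compat; [apply Gam_pos; lra|].
  repeat apply Rmult_lt_0_compat; try (apply Gam_pos; lra). apply exp_pos.
Qed.

(** Expand [J] in the two Hankel solutions. The behaviour at [0] kills the coefficient
    of the singular one; the Wronskian at [0] gives the other coefficient, and the
    duplication formula shows that the resulting amplitude is the same for all orders. *)
Lemma J_as_hankel nu x : 3 / 2 <= nu -> 0 < x ->
  bessel_J nu x = bessel_amp / hankel_amp nu * hankel nu (- (PI / 2)) x.
Proof.
  intros Hnu Hx. assert (Ha : 0 < nu + 1 / 2) by lra.
  pose proof (hankel_amp_pos nu Ha) as HC. set (C := hankel_amp nu) in *.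
  set (HR := hankel nu 0). set (HR1 := hankel1 nu 0).
  set (HI := hankel nu (- (PI / 2))). set (HI1 := hankel1 nu (- (PI / 2))).
  assert (SR : bessel_sol nu HR HR1) by (apply bessel_sol_hankel; auto).
  assert (SI : bessel_sol nu HI HI1) by (apply bessel_sol_hankel; auto).
  assert (SJ := bessel_sol_J nu).
  set (J := bessel_J nu) in *. set (J1 := bessel_J1 nu) in *.
  assert (WH : forall t, 0 < t -> wronskian HR HR1 HI HI1 t = C * C).
  { intros t Ht. unfold HR, HR1, HI, HI1.
    rewrite (wronskian_asym nu _ _ _ _ _ _ _ _ t (bessel_sol_hankel nu 0 Ha)
     (bessel_sol_hankel nu (- (PI / 2)) Ha) (bessel_asym_hankel nu 0 Ha)
     (bessel_asym_hankel nu (- (PI / 2)) Ha) Ht).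
    replace ((nu - 1 / 2) * (PI / 2) - - (PI / 2) - ((nu - 1 / 2) * (PI / 2) - 0))
      with (PI / 2) by ring. rewrite sin_PI2. unfold C. ring. }
  set (w1 := wronskian J J1 HI HI1 1). set (w2 := wronskian J J1 HR HR1 1).
  assert (W1 : forall t, 0 < t -> wronskian J J1 HI HI1 t = w1)
    by (intros; apply (wronskian_const nu); auto; lra).
  assert (W2 : forall t, 0 < t -> wronskian J J1 HR HR1 t = w2)
    by (intros; apply (wronskian_const nu); auto; lra).
  assert (Rep : forall t, 0 < t -> J t * (C * C) = w1 * HR t - w2 * HI t).
  { intros t Ht. rewrite <- (WH t Ht), <- (W1 t Ht), <- (W2 t Ht). unfold wronskian. ring. }
  pose proof (Gam_pos (2 * nu) ltac:(lra)) as HG.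
  assert (TR := tends0_hankel nu 0 Hnu). rewrite cos_0, Rmult_1_r in TR.
  assert (TR1 := tends0_hankel1 nu 0 Hnu). rewrite cos_0, Rmult_1_r in TR1.
  assert (TI := tends0_hankel nu (- (PI / 2)) Hnu). rewrite cos_neg, cos_PI2, Rmult_0_r in TI.
  assert (Z : w1 = 0).
  { assert (T1 : tends0 (fun t => (C * C) * (Rpower t (2 * nu) * (Rpower t (- nu) * bessel_J nu t)))
       ((C * C) * (0 * J_0coef nu))).
    { apply tends0_mult; [apply tends0_const|]. apply tends0_mult; [|apply tends0_J].
      apply tends0_Rpower; lra. }
    assert (T2 : tends0 (fun t => (C * C) * (Rpower t (2 * nu) * (Rpower t (- nu) * bessel_J nu t)))
       (w1 * Gam (2 * nu) + (- w2) * 0)).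
    { apply (tends0_ext (fun t => w1 * (Rpower t nu * HR t) + (- w2) * (Rpower t nu * HI t))).
      - intros t Ht. specialize (Rep t Ht). 
        replace (Rpower t (2 * nu) * (Rpower t (- nu) * bessel_J nu t))
          with (Rpower t nu * J t).
        + replace (C * C * (Rpower t nu * J t)) with (Rpower t nu * (J t * (C * C))) by ring.
          rewrite Rep. ring.
        + rewrite <- Rmult_assoc, <- Rpower_plus by auto. f_equal. f_equal. ring.
      - apply tends0_plus; apply tends0_mult; try apply tends0_const; auto. }
    pose proof (tends0_unique _ _ _ T1 T2) as U.
    replace (C * C * (0 * J_0coef nu)) with 0 in U by ring.
    rewrite Rmult_0_r, Rplus_0_r in U. symmetry in U. apply Rmult_integral in U. lra. }
  assert (V : w2 = - (Gam (2 * nu + 1) * J_0coef nu)).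
  { rewrite Gam_S by lra.
    apply (tends0_unique (fun _ => w2)); [apply tends0_const|].
    apply (tends0_ext (fun t => (Rpower t (- nu) * bessel_J nu t) * (Rpower t (nu + 1) * HR1 t)
       + (-1) * ((Rpower t (1 - nu) * bessel_J1 nu t) * (Rpower t nu * HR t)))).
    - intros t Ht. rewrite <- (W2 t Ht). unfold wronskian.
      replace (Rpower t (- nu) * bessel_J nu t * (Rpower t (nu + 1) * HR1 t))
        with ((Rpower t (- nu) * Rpower t (nu + 1)) * (J t * HR1 t)) by (unfold J; ring).
      replace (Rpower t (1 - nu) * bessel_J1 nu t * (Rpower t nu * HR t))
        with ((Rpower t (1 - nu) * Rpower t nu) * (J1 t * HR t)) by (unfold J1; ring).
      rewrite <- !Rpower_plus by auto.
      replace (- nu + (nu + 1)) with 1 by ring. replace (1 - nu + nu) with 1 by ring.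
      rewrite Rpower_1 by auto. ring.
    - replace (- (2 * nu * Gam (2 * nu) * J_0coef nu)) with
        (J_0coef nu * (- nu * Gam (2 * nu)) + (-1) * ((nu * J_0coef nu) * Gam (2 * nu))) by ring.
      apply tends0_plus; [|apply tends0_mult; [apply tends0_const|]]; apply tends0_mult; auto.
      + apply tends0_J.
      + apply tends0_J1. }
  specialize (Rep x Hx). rewrite Z, V in Rep.
  assert (E : J x = Gam (2 * nu + 1) * J_0coef nu / (C * C) * HI x).
  { apply Rmult_eq_reg_r with (C * C); [|nra]. rewrite Rep. field. lra. }
  rewrite E. f_equal.
  assert (Dup := Gam_duplication (nu + 1 / 2) 1 ltac:(lra) Rlt_0_1).
  unfold bessel_amp. rewrite <- Dup. unfold J_0coef, C, hankel_amp.
  rewrite inv_Gamma_pos_eq by lra.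
  replace (2 * (nu + 1 / 2)) with (2 * nu + 1) by field.
  replace (nu + 1 / 2 + 1 / 2) with (nu + 1) by field.
  pose proof (Gam_pos (nu + 1 / 2) ltac:(lra)). pose proof (Gam_pos (nu + 1) ltac:(lra)).
  replace (Rpower 2 (- nu)) with
    (Rpower 2 (3 / 2) * Rpower 2 (nu - 1 / 2) * / Rpower 2 (2 * nu + 1)).
  - field. repeat split; try lra; apply Rgt_not_eq, exp_pos.
  - rewrite <- Rpower_Ropp, <- !Rpower_plus by lra. f_equal. field.
Qed.

Lemma bessel_asym_ext f f1 g g1 A al : (forall x, 0 < x -> f x = g x) ->
  (forall x, 0 < x -> f1 x = g1 x) -> bessel_asym f f1 A al -> bessel_asym g g1 A al.
Proof.
  intros H H1 [F0 F1]. split.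
  - revert F0. apply is_lim_ext_loc. exists 0. intros x Hx. rewrite H; auto.
  - revert F1. apply is_lim_ext_loc. exists 0. intros x Hx. rewrite H1; auto.
Qed.

Lemma derivative_unique_on (f g f1 g1 : R -> R) x : 0 < x -> (forall x, 0 < x -> f x = g x) ->
  is_derive f x (f1 x) -> is_derive g x (g1 x) -> f1 x = g1 x.
Proof.
  intros Hx H Hf Hg. apply is_derive_unique in Hg. rewrite <- Hg. symmetry.
  apply is_derive_unique. apply (is_derive_ext_loc f); auto.
  exists (mkposreal x Hx). intros y Hy. apply H.
  assert (Rabs (y - x) < x) by exact Hy. apply Rabs_def2 in H0. lra.
Qed.

Lemma bessel_asym_J_large nu : 3 / 2 <= nu ->
  bessel_asym (bessel_J nu) (bessel_J1 nu) bessel_amp (nu * (PI / 2) + PI / 4).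
Proof.
  intros Hnu. assert (Ha : 0 < nu + 1 / 2) by lra.
  pose proof (hankel_amp_pos nu Ha) as HC.
  set (k := bessel_amp / hankel_amp nu).
  apply (bessel_asym_ext (fun x => k * hankel nu (- (PI / 2)) x)
    (fun x => k * hankel1 nu (- (PI / 2)) x)).
  - intros x Hx. symmetry. apply J_as_hankel; auto.
  - intros x Hx. apply (derivative_unique_on (fun x => k * hankel nu (- (PI / 2)) x) (bessel_J nu)
      (fun x => k * hankel1 nu (- (PI / 2)) x)); auto.
    + intros t Ht. symmetry. apply J_as_hankel; auto.
    + apply is_derive_scal. apply bessel_sol_hankel; auto.
    + apply bessel_sol_J; auto.
  - assert (B := bessel_asym_scal k _ _ _ _ (bessel_asym_hankel nu (- (PI / 2)) Ha)).
    replace (k * hankel_amp nu) with bessel_amp in B by (unfold k; field; lra).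
    replace ((nu - 1 / 2) * (PI / 2) - - (PI / 2)) with (nu * (PI / 2) + PI / 4) in B by field.
    exact B.
Qed.

Lemma bessel_asym_J_down nu A al : bessel_asym (bessel_J nu) (bessel_J1 nu) A al ->
  bessel_asym (bessel_J (nu - 1)) (bessel_J1 (nu - 1)) A (al - PI / 2).
Proof.
  intros As. destruct (asym_bounded _ _ _ _ As) as [M [B0 B1]]. destruct As as [F0 F1].
  assert (K : vanish (fun x => sqrt x * bessel_J (nu - 1) x - A * cos (x - (al - PI / 2)))).
  { apply (vanish_ext (fun x => (sqrt x * bessel_J1 nu x + A * sin (x - al))
       + nu / x * (sqrt x * bessel_J nu x)) _ 0).
    - intros x Hx. rewrite bessel_J_rec by auto. unfold bessel_J1.
      replace (x - (al - PI / 2)) with (PI / 2 + (x - al)) by ring.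
      rewrite cos_plus, cos_PI2, sin_PI2. field. lra.
    - apply vanish_plus; auto. apply vanish_bounded with (1 + Rabs A) M; auto.
      apply vanish_inv. }
  split; [exact K|].
  assert (BK : exists M, forall x, M < x -> Rabs (sqrt x * bessel_J (nu - 1) x) <= 1 + Rabs A).
  { destruct (vanish_eventually_bounded _ K) as [M' BM]. exists M'. intros x Hx.
    replace (sqrt x * bessel_J (nu - 1) x) with ((sqrt x * bessel_J (nu - 1) x
      - A * cos (x - (al - PI / 2))) + A * cos (x - (al - PI / 2))) by ring.
    eapply Rle_trans; [apply Rabs_triang|]. apply Rplus_le_compat; auto.
    rewrite Rabs_mult. pose proof (Rabs_cos_le (x - (al - PI / 2))). pose proof (Rabs_pos A). nra. }
  destruct BK as [M' BK].
  apply (vanish_ext (fun x => (nu - 1) / x * (sqrt x * bessel_J (nu - 1) x)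
    + (-1) * (sqrt x * bessel_J nu x - A * cos (x - al))) _ 0).
  - intros x Hx. unfold bessel_J1. replace (nu - 1 + 1) with nu by ring.
    replace (x - (al - PI / 2)) with (PI / 2 + (x - al)) by ring.
    rewrite sin_plus, cos_PI2, sin_PI2. field. lra.
  - apply vanish_plus; [|apply vanish_scal; auto].
    apply vanish_bounded with (1 + Rabs A) M'; auto. apply vanish_inv.
Qed.

(** All real orders, negative ones included: descend from large orders. *)
Lemma bessel_asym_J nu :
  bessel_asym (bessel_J nu) (bessel_J1 nu) bessel_amp (nu * (PI / 2) + PI / 4).
Proof.
  assert (A : forall n nu, 3 / 2 - INR n <= nu ->
    bessel_asym (bessel_J nu) (bessel_J1 nu) bessel_amp (nu * (PI / 2) + PI / 4)).
  { induction n as [|n IH]; intros mu Hmu.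
    - apply bessel_asym_J_large. simpl in Hmu. lra.
    - rewrite S_INR in Hmu. specialize (IH (mu + 1) ltac:(lra)).
      apply bessel_asym_J_down in IH. replace (mu + 1 - 1) with mu in IH by ring.
      replace ((mu + 1) * (PI / 2) + PI / 4 - PI / 2) with (mu * (PI / 2) + PI / 4) in IH by field.
      exact IH. }
  destruct (nfloor_ex (Rabs (nu - 3 / 2)) (Rabs_pos _)) as [n Hn].
  apply (A (S n)). rewrite S_INR. pose proof (Rabs_maj2 (nu - 3 / 2)). lra.
Qed.

(** * The Bessel functions of the second kind *)

(** The derivative of [bessel_Y_quotient nu]. *)
Definition bessel_Yq1 (nu x : R) : R :=
  cos (nu * PI) / sin (nu * PI) * bessel_J1 nu x + (- / sin (nu * PI)) * bessel_J1 (- nu) x.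

Lemma bessel_Yq_sol nu : sin (nu * PI) <> 0 ->
  bessel_sol nu (bessel_Y_quotient nu) (bessel_Yq1 nu) /\
  bessel_asym (bessel_Y_quotient nu) (bessel_Yq1 nu) bessel_amp
    (nu * (PI / 2) + PI / 4 + PI / 2).
Proof.
  intros Hs.
  assert (E : forall x, cos (nu * PI) / sin (nu * PI) * bessel_J nu x
     + (- / sin (nu * PI)) * bessel_J (- nu) x = bessel_Y_quotient nu x).
  { intros x. unfold bessel_Y_quotient. field. auto. }
  split.
  - assert (S := bessel_sol_lin nu (cos (nu * PI) / sin (nu * PI)) (- / sin (nu * PI)) _ _ _ _
      (bessel_sol_J nu) (bessel_sol_neg _ _ _ (bessel_sol_J (- nu)))).
    intros x Hx. destruct (S x Hx) as [S1 S2]. split.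
    + apply (is_derive_ext _ _ _ _ E). exact S1.
    + rewrite <- E. exact S2.
  - destruct (bessel_asym_J nu) as [P0 P1]. destruct (bessel_asym_J (- nu)) as [N0 N1].
    set (c := cos (nu * PI)) in *. set (s := sin (nu * PI)) in *.
    assert (T : forall x, c = cos (2 * (nu * (PI / 2))) /\ s = sin (2 * (nu * (PI / 2))) /\
      - nu * (PI / 2) + PI / 4 = PI / 4 - nu * (PI / 2) /\
      x - (nu * (PI / 2) + PI / 4 + PI / 2) = (x - (nu * (PI / 2) + PI / 4)) - PI / 2 /\
      x - (- nu * (PI / 2) + PI / 4) = (x - (nu * (PI / 2) + PI / 4)) + 2 * (nu * (PI / 2))).
    { intros x. unfold c, s. replace (2 * (nu * (PI / 2))) with (nu * PI) by field.
      repeat split; field. }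
    split.
    + apply (vanish_ext (fun x => c / s * (sqrt x * bessel_J nu x
         - bessel_amp * cos (x - (nu * (PI / 2) + PI / 4)))
       + (- / s) * (sqrt x * bessel_J (- nu) x
         - bessel_amp * cos (x - (- nu * (PI / 2) + PI / 4)))) _ 0).
      * intros x Hx. rewrite <- E. destruct (T x) as [Tc [Ts [_ [T1 T2]]]].
        rewrite T1, T2. set (a := x - (nu * (PI / 2) + PI / 4)).
        rewrite cos_plus, cos_minus, sin_PI2, cos_PI2, <- Tc, <- Ts. field. auto.
      * apply vanish_plus; apply vanish_scal; auto.
    + apply (vanish_ext (fun x => c / s * (sqrt x * bessel_J1 nu x
         + bessel_amp * sin (x - (nu * (PI / 2) + PI / 4)))
       + (- / s) * (sqrt x * bessel_J1 (- nu) x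
         + bessel_amp * sin (x - (- nu * (PI / 2) + PI / 4)))) _ 0).
      * intros x Hx. unfold bessel_Yq1. fold c s. destruct (T x) as [Tc [Ts [_ [T1 T2]]]].
        rewrite T1, T2. set (a := x - (nu * (PI / 2) + PI / 4)).
        rewrite sin_plus, sin_minus, sin_PI2, cos_PI2, <- Tc, <- Ts. field. auto.
      * apply vanish_plus; apply vanish_scal; auto.
Qed.

(** Both sides have the asymptotics [sin (x - nu PI / 2 - PI / 4)]. *)
Lemma Y_quotient_as_hankel nu x : 0 <= nu -> sin (nu * PI) <> 0 -> 0 < x ->
  bessel_Y_quotient nu x = bessel_amp / hankel_amp nu * hankel nu (- PI) x.
Proof.
  intros Hnu Hs Hx. destruct (bessel_Yq_sol nu Hs) as [S A].
  assert (Ha : 0 < nu + 1 / 2) by lra. pose proof (hankel_amp_pos nu Ha).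
  set (k := bessel_amp / hankel_amp nu).
  apply (bessel_sol_asym_unique nu _ (bessel_Yq1 nu) (fun x => k * hankel nu (- PI) x)
    (fun x => k * hankel1 nu (- PI) x) bessel_amp (nu * (PI / 2) + PI / 4 + PI / 2)); auto.
  - apply bessel_sol_scal, bessel_sol_hankel; auto.
  - assert (B := bessel_asym_scal k _ _ _ _ (bessel_asym_hankel nu (- PI) Ha)).
    replace (k * hankel_amp nu) with bessel_amp in B by (unfold k; field; lra).
    replace ((nu - 1 / 2) * (PI / 2) - - PI) with (nu * (PI / 2) + PI / 4 + PI / 2) in B by field.
    exact B.
Qed.

Lemma neg_part_exp y : Rabs y <= 4 * (exp (- y / 4) + exp y).
Proof.
  pose proof (exp_pos (- y / 4)). pose proof (exp_pos y).
  pose proof (exp_ineq1_le (- y / 4)). pose proof (exp_ineq1_le y).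
  apply Rabs_le. lra.
Qed.

Lemma one_le_exps y : 1 <= exp (- y / 4) + exp y.
Proof.
  pose proof (exp_pos (- y / 4)). pose proof (exp_pos y).
  pose proof (exp_ineq1_le (- y / 4)). pose proof (exp_ineq1_le y).
  destruct (Rle_lt_dec y 0); lra.
Qed.

(** A domination that is uniform in the order and absorbs the factors [y] and [e^y]
    produced by differentiating with respect to the order. *)
Lemma gamma_weight_bound a k : 1 / 2 <= a -> 0 < k -> exists M, 0 <= M /\ forall z y,
  a <= z <= a + 1 -> exp (z * y - k * exp y) * (exp (- y / 4) + exp y) <= M / (1 + y ^ 2).
Proof.
  intros Ha Hk.
  assert (D : forall b, 0 < b -> exists M, forall y, exp (b * y - k * exp y) <= M / (1 + y ^ 2)).
  { intros b Hb. destruct (decay_gamma_kernel b k Hb Hk) as [M HM]. exists M. intros y.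
    eapply Rle_trans; [apply Rle_abs | apply HM]. }
  destruct (D (a - 1 / 4) ltac:(lra)) as [M1 H1]. destruct (D (a + 1) ltac:(lra)) as [M2 H2].
  destruct (D (a + 3 / 4) ltac:(lra)) as [M3 H3]. destruct (D (a + 2) ltac:(lra)) as [M4 H4].
  assert (B : forall z y, a <= z <= a + 1 -> exp (z * y - k * exp y) * (exp (- y / 4) + exp y)
     <= (M1 + M2 + M3 + M4) / (1 + y ^ 2)).
  { intros z y Hz. specialize (H1 y). specialize (H2 y). specialize (H3 y). specialize (H4 y).
    assert (E : exp (z * y - k * exp y) <= exp (a * y - k * exp y) + exp ((a + 1) * y - k * exp y)).
    { pose proof (exp_pos (a * y - k * exp y)). pose proof (exp_pos ((a + 1) * y - k * exp y)).
      destruct (Rle_lt_dec y 0).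
      - assert (exp (z * y - k * exp y) <= exp (a * y - k * exp y)) by (apply exp_le_exp; nra). lra.
      - assert (exp (z * y - k * exp y) <= exp ((a + 1) * y - k * exp y))
          by (apply exp_le_exp; nra). lra. }
    pose proof (exp_pos (- y / 4)). pose proof (exp_pos y).
    eapply Rle_trans; [apply Rmult_le_compat_r; [lra | exact E]|].
    replace ((exp (a * y - k * exp y) + exp ((a + 1) * y - k * exp y)) * (exp (- y / 4) + exp y))
      with (exp (a * y - k * exp y) * exp (- y / 4) + exp (a * y - k * exp y) * exp y
       + exp ((a + 1) * y - k * exp y) * exp (- y / 4) + exp ((a + 1) * y - k * exp y) * exp y)
      by ring.
    rewrite <- !exp_plus.
    replace (a * y - k * exp y + - y / 4) with ((a - 1 / 4) * y - k * exp y) by field.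
    replace (a * y - k * exp y + y) with ((a + 1) * y - k * exp y) by ring.
    replace ((a + 1) * y - k * exp y + - y / 4) with ((a + 3 / 4) * y - k * exp y) by field.
    replace ((a + 1) * y - k * exp y + y) with ((a + 2) * y - k * exp y) by ring.
    unfold Rdiv in *. lra. }
  exists (M1 + M2 + M3 + M4). split; auto.
  specialize (B a 0 ltac:(lra)). pose proof (exp_pos (a * 0 - k * exp 0)).
  pose proof (one_le_exps 0). replace (1 + 0 ^ 2) with 1 in B by ring. unfold Rdiv in B at 2.
  rewrite Rinv_1, Rmult_1_r in B. nra.
Qed.

Lemma is_lim_seq_of_lipschitz (f : R -> R) a K :
  (forall b, a <= b <= a + 1 -> Rabs (f b - f a) <= K * Rabs (b - a)) ->
  is_lim_seq (fun n => f (a + / (INR n + 1))) (f a).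
Proof.
  intros H. 
  assert (Hn : forall n, 0 < / (INR n + 1) <= 1).
  { intros n. pose proof (pos_INR n). split; [apply Rinv_0_lt_compat; lra|].
    rewrite <- Rinv_1. apply Rinv_le_contravar; lra. }
  assert (L : is_lim_seq (fun n => K * / (INR n + 1)) 0).
  { replace (Finite 0) with (Rbar_mult K 0) by (simpl; f_equal; ring).
    apply is_lim_seq_scal_l.
    apply (is_lim_seq_ext (fun n => / INR (S n))); [intros; rewrite S_INR; auto|].
    apply (is_lim_seq_incr_1 (fun n => / INR n)).
    apply (is_lim_seq_ext (fun n => 1 / INR n)); [intros; unfold Rdiv; ring|].
    apply is_lim_seq_inv_INR. }
  assert (L2 : is_lim_seq (fun n => f (a + / (INR n + 1)) - f a) 0).
  { apply is_lim_seq_abs_0.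
    apply (is_lim_seq_le_le (fun _ => 0) _ (fun n => K * / (INR n + 1)) 0); auto.
    - intros n. split; [apply Rabs_pos|]. specialize (Hn n).
      specialize (H (a + / (INR n + 1)) ltac:(lra)).
      replace (a + / (INR n + 1) - a) with (/ (INR n + 1)) in H by ring.
      rewrite (Rabs_pos_eq (/ (INR n + 1))) in H by lra. auto.
    - apply is_lim_seq_const. }
  apply (is_lim_seq_ext (fun n => (f (a + / (INR n + 1)) - f a) + f a)); [intros; ring|].
  replace (Finite (f a)) with (Finite (0 + f a)) by (f_equal; ring).
  apply is_lim_seq_plus'; auto. apply is_lim_seq_const.
Qed.

Lemma Gam_lipschitz a : 1 / 2 <= a -> exists K, forall b, a <= b <= a + 1 ->
  Rabs (Gam b - Gam a) <= K * Rabs (b - a).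
Proof.
  intros Ha. destruct (gamma_weight_bound a 1 Ha Rlt_0_1) as [M [HM0 HM]].
  exists (4 * M * PI). intros b Hb.
  apply (lineint_lipschitz (fun z y => exp (z * y - 1 * exp y))
    (fun z y => y * exp (z * y - 1 * exp y))); rewrite Rmin_left, Rmax_right by lra.
  - intros p Hp. apply decays_gamma_kernel; lra.
  - intros p y Hp. auto_derive; auto. unfold Rminus. ring.
  - intros p Hp y. specialize (HM p y ltac:(lra)).
    rewrite Rabs_mult, (Rabs_pos_eq (exp _)) by (left; apply exp_pos).
    pose proof (neg_part_exp y). pose proof (exp_pos (p * y - 1 * exp y)).
    apply Rle_trans with (4 * (exp (p * y - 1 * exp y) * (exp (- y / 4) + exp y))); [nra|].
    unfold Rdiv in *. lra.
Qed.

Lemma hankel_L_lipschitz nu theta x : 0 <= nu -> 0 < x -> exists K, forall b, nu <= b <= nu + 1 ->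
  Rabs (hankel_L b 0 theta x - hankel_L nu 0 theta x) <= K * Rabs (b - nu).
Proof.
  intros Hnu Hx.
  destruct (gamma_weight_bound (nu + 1 / 2) (x / 2) ltac:(lra) ltac:(lra)) as [M [HM0 HM]].
  destruct (log_growth (nu + 2) (x / 2) ltac:(lra) ltac:(lra)) as [C HC].
  destruct (log_growth 1 1 ltac:(lra) ltac:(lra)) as [C' HC'].
  set (K := exp C * (4 + 1 + Rabs C' + 2)).
  exists (K * M * PI). intros b Hb.
  apply (lineint_lipschitz (fun v y => hankel_kernel v 0 theta x y)
    (fun v y => hankel_env v 0 x y * ((y + / 2 * ln (exp y ^ 2 + 4)) *
       cos (x - (v - 1 / 2) * hankel_arg y + theta)
       + hankel_arg y * sin (x - (v - 1 / 2) * hankel_arg y + theta))));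
    rewrite Rmin_left, Rmax_right by lra.
  - intros p Hp. apply decays_hankel_kernel; lra.
  - intros p y Hp. unfold hankel_kernel, hankel_env. auto_derive; auto.
    change (exp y ^ 2) with (exp y * (exp y * 1)). unfold Rminus, Rdiv. ring.
  - intros p Hp y. pose proof (exp_pos y) as Hu.
    rewrite Rabs_mult, (Rabs_pos_eq (hankel_env _ _ _ _)) by (left; apply exp_pos).
    set (G := exp ((p + 1 / 2) * y - x / 2 * exp y)).
    set (W := exp (- y / 4) + exp y).
    assert (E1 : hankel_env p 0 x y <= exp C * G).
    { unfold hankel_env, G. rewrite <- exp_plus. apply exp_le_exp.
      specialize (HC (p - 1 / 2) (exp y) ltac:(apply Rabs_le; lra) ltac:(lra)).
      apply Rabs_le_between in HC. lra. }
    assert (E2 : Rabs ((y + / 2 * ln (exp y ^ 2 + 4)) *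
       cos (x - (p - 1 / 2) * hankel_arg y + theta)
       + hankel_arg y * sin (x - (p - 1 / 2) * hankel_arg y + theta))
       <= (4 + 1 + Rabs C' + 2) * W).
    { eapply Rle_trans; [apply Rabs_trig_le|].
      pose proof (neg_part_exp y) as N1. pose proof (one_le_exps y) as N2. fold W in N1, N2.
      specialize (HC' 1 (exp y) ltac:(rewrite Rabs_R1; lra) ltac:(lra)).
      replace (1 / 2) with (/ 2) in HC' by field.
      assert (N3 : Rabs (hankel_arg y) <= 2).
      { apply Rabs_le. unfold hankel_arg. pose proof (atan_bound (2 * exp (- y))).
        pose proof PI_4. lra. }
      assert (exp y <= W) by (unfold W; pose proof (exp_pos (- y / 4)); lra).
      pose proof (Rle_abs C'). pose proof (Rabs_pos C').
      eapply Rle_trans; [apply Rplus_le_compat_r, Rabs_triang|]. nra. }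
    specialize (HM (p + 1 / 2) y ltac:(lra)). fold G W in HM.
    pose proof (exp_pos ((p + 1 / 2) * y - x / 2 * exp y)) as HG. fold G in HG.
    pose proof (exp_pos C).
    apply Rle_trans with ((exp C * G) * ((4 + 1 + Rabs C' + 2) * W)).
    + apply Rmult_le_compat; auto using Rabs_pos. left; apply exp_pos.
    + replace (exp C * G * ((4 + 1 + Rabs C' + 2) * W)) with (K * (G * W)) by (unfold K; ring).
      unfold Rdiv. rewrite Rmult_assoc. apply Rmult_le_compat_l; auto.
      unfold K. pose proof (Rabs_pos C'). apply Rmult_le_pos; lra.
Qed.

(** The values at integer order are limits over orders at which the quotient is a
    multiple of a Hankel integral, which is continuous in the order. *)
Lemma Y_as_hankel nu x : 0 <= nu -> 0 < x ->
  bessel_Y nu x = bessel_amp / hankel_amp nu * hankel nu (- PI) x.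
Proof.
  intros Hnu Hx. unfold bessel_Y. destruct (Req_EM_T (sin (nu * PI)) 0) as [Hs | Hs];
    [|apply Y_quotient_as_hankel; auto].
  assert (L : is_lim_seq (fun n => bessel_Y_quotient (Rbar_loc_seq nu n) x)
     (bessel_amp / hankel_amp nu * hankel nu (- PI) x)).
  { apply (is_lim_seq_ext_loc (fun n => bessel_amp / hankel_amp (nu + / (INR n + 1))
       * hankel (nu + / (INR n + 1)) (- PI) x)).
    - exists 1%nat. intros n Hn. simpl Rbar_loc_seq.
      assert (1 <= INR n) by (change 1 with (INR 1); apply le_INR; auto).
      assert (Hi : 0 < / (INR n + 1)) by (apply Rinv_0_lt_compat; lra).
      assert (Hi2 : / (INR n + 1) < 1).
      { rewrite <- Rinv_1. apply Rinv_lt_contravar; lra. }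
      symmetry. apply Y_quotient_as_hankel; auto; [lra|].
      rewrite Rmult_plus_distr_r, sin_plus, Hs, Rmult_0_l, Rplus_0_l.
      pose proof PI_RGT_0.
      assert (0 < sin (/ (INR n + 1) * PI)) by (apply sin_gt_0; nra).
      pose proof (sin2_cos2 (nu * PI)) as SC. rewrite Hs in SC. unfold Rsqr in SC.
      apply Rmult_integral_contrapositive_currified; [|lra].
      intros E. rewrite E in SC. lra.
    - pose proof (hankel_amp_pos nu ltac:(lra)).
      destruct (Gam_lipschitz (nu + 1 / 2) ltac:(lra)) as [K1 HK1].
      destruct (hankel_L_lipschitz nu (- PI) x Hnu Hx) as [K2 HK2].
      assert (LG := is_lim_seq_of_lipschitz _ _ _ HK1).
      assert (LL := is_lim_seq_of_lipschitz (fun v => hankel_L v 0 (- PI) x) nu K2 HK2).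
      assert (Ln : is_lim_seq (fun n => nu + / (INR n + 1)) nu).
      { apply (is_lim_seq_of_lipschitz (fun t => t) nu 1). intros. lra. }
      assert (LP : forall c d, is_lim_seq (fun n => Rpower c (nu + / (INR n + 1) - d))
         (Rpower c (nu - d))).
      { intros c d. apply (is_lim_seq_continuous (fun v => Rpower c (v - d)) _ nu); auto.
        apply ex_derive_continuity_pt. unfold Rpower. auto_derive. auto. }
      apply is_lim_seq_mult'.
      + apply is_lim_seq_div'; [apply is_lim_seq_const| |lra].
        unfold hankel_amp. apply is_lim_seq_mult'; auto.
        apply (is_lim_seq_ext (fun n => Gam (nu + 1 / 2 + / (INR n + 1)))); auto.
        intros n. f_equal. ring.
      + unfold hankel. apply is_lim_seq_mult'; auto.
        apply (is_lim_seq_ext (fun n => Rpower x (nu + / (INR n + 1) - 0)));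
          [intros; f_equal; ring|].
        replace (Finite (Rpower x nu)) with (Finite (Rpower x (nu - 0))) by (do 2 f_equal; ring).
        auto. }
  unfold Lim. rewrite (is_lim_seq_unique _ _ L). reflexivity.
Qed.

Definition bessel_Y1 (nu x : R) : R := bessel_amp / hankel_amp nu * hankel1 nu (- PI) x.

Lemma bessel_Y_sol nu : 0 <= nu -> bessel_sol nu (bessel_Y nu) (bessel_Y1 nu).
Proof.
  intros Hnu. assert (Ha : 0 < nu + 1 / 2) by lra.
  set (k := bessel_amp / hankel_amp nu).
  assert (L := bessel_sol_scal nu k _ _ (bessel_sol_hankel nu (- PI) Ha)).
  intros t Ht. destruct (L t Ht) as [L1 L2]. split.
  - apply (is_derive_ext_loc (fun x => k * hankel nu (- PI) x)); [|exact L1].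
    exists (mkposreal t Ht). intros y Hy. symmetry. apply Y_as_hankel; auto.
    assert (B : Rabs (y - t) < t) by exact Hy. apply Rabs_def2 in B. lra.
  - rewrite (Y_as_hankel nu t) by auto. exact L2.
Qed.

Lemma bessel_asym_Y nu : 0 <= nu -> bessel_asym (bessel_Y nu) (bessel_Y1 nu) bessel_amp
  (nu * (PI / 2) + PI / 4 + PI / 2).
Proof.
  intros Hnu. assert (Ha : 0 < nu + 1 / 2) by lra. pose proof (hankel_amp_pos nu Ha).
  set (k := bessel_amp / hankel_amp nu).
  apply (bessel_asym_ext (fun x => k * hankel nu (- PI) x) (fun x => k * hankel1 nu (- PI) x)).
  - intros x Hx. symmetry. apply Y_as_hankel; auto.
  - reflexivity.
  - assert (B := bessel_asym_scal k _ _ _ _ (bessel_asym_hankel nu (- PI) Ha)).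
    replace (k * hankel_amp nu) with bessel_amp in B by (unfold k; field; lra).
    replace ((nu - 1 / 2) * (PI / 2) - - PI) with (nu * (PI / 2) + PI / 4 + PI / 2) in B by field.
    exact B.
Qed.

Lemma bessel_wronskian nu x : 0 <= nu -> 0 < x ->
  x * (bessel_J nu x * bessel_Y1 nu x - bessel_J1 nu x * bessel_Y nu x) = bessel_amp * bessel_amp.
Proof.
  intros Hnu Hx.
  assert (W := wronskian_asym nu _ _ _ _ _ _ _ _ x (bessel_sol_J nu) (bessel_Y_sol nu Hnu)
    (bessel_asym_J nu) (bessel_asym_Y nu Hnu) Hx).
  unfold wronskian in W. rewrite W.
  replace (nu * (PI / 2) + PI / 4 + PI / 2 - (nu * (PI / 2) + PI / 4)) with (PI / 2) by ring.
  rewrite sin_PI2. ring.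
Qed.

(** * Polar angles and the comparison of phases *)

Lemma PI_bounds : 3.1415926 < PI < 3.1415927.
Proof.
  pose proof (PI_2_3_7_ineq 4) as H.
  unfold tg_alt, PI_2_3_7_tg, Ratan_seq in H.
  cbn [sum_f_R0 Nat.mul Nat.add pow INR] in H. lra.
Qed.

Lemma ivt (f : R -> R) a b v : a <= b -> (forall x, a <= x <= b -> continuous f x) ->
  f a <= v <= f b -> exists c, a <= c <= b /\ f c = v.
Proof.
  intros Hab Hc Hv.
  destruct (Rle_lt_or_eq_dec _ _ (proj1 Hv)) as [H1 | H1]; [|exists a; split; [lra|auto]].
  destruct (Rle_lt_or_eq_dec _ _ (proj2 Hv)) as [H2 | H2]; [|exists b; split; [lra|auto]].
  assert (Hlt : a < b) by (destruct Hab as [|E]; auto; subst; lra).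
  destruct (IVT_interv (fun x => f x - v) a b) as [c [Hc1 Hc2]]; auto; try lra.
  - intros x Hx. apply continuity_pt_filterlim.
    exact (continuous_minus (V := R_NormedModule) f (fun _ => v) x (Hc x Hx)
      (continuous_const v x)).
  - exists c. split; auto. lra.
Qed.

Lemma polar_angle_pos a b : 0 < a ->
  a = sqrt (a ^ 2 + b ^ 2) * cos (atan (b / a)) /\ b = sqrt (a ^ 2 + b ^ 2) * sin (atan (b / a)).
Proof.
  intros Ha. rewrite cos_atan, sin_atan.
  assert (E : sqrt (a ^ 2 + b ^ 2) = a * sqrt (1 + (b / a)²)).
  { rewrite <- (sqrt_pow2 a) at 2 by lra. rewrite <- sqrt_mult_alt by nra.
    f_equal. unfold Rsqr. field. lra. }
  assert (0 < sqrt (1 + (b / a)²)) by (apply sqrt_lt_R0; pose proof (Rle_0_sqr (b / a)); lra).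
  rewrite E. split; field; lra.
Qed.

(** The angle is the integral of its rate; that it is an angle follows since the
    components in the rotated frame, divided by the length, have derivative zero. *)
Lemma polar_lift l (a b a1 b1 g : R -> R) x1 th1 : l < x1 ->
  (forall x, l < x -> is_derive a x (a1 x)) -> (forall x, l < x -> is_derive b x (b1 x)) ->
  (forall x, l < x -> continuous g x) -> (forall x, l < x -> 0 < a x ^ 2 + b x ^ 2) ->
  (forall x, l < x -> g x * (a x ^ 2 + b x ^ 2) = a x * b1 x - b x * a1 x) ->
  a x1 = sqrt (a x1 ^ 2 + b x1 ^ 2) * cos th1 -> b x1 = sqrt (a x1 ^ 2 + b x1 ^ 2) * sin th1 ->
  exists th, th x1 = th1 /\ forall x, l < x -> is_derive th x (g x) /\
    a x = sqrt (a x ^ 2 + b x ^ 2) * cos (th x) /\ b x = sqrt (a x ^ 2 + b x ^ 2) * sin (th x).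
Proof.
  intros Hl Da Db Cg Hpos Hg Ha1 Hb1.
  set (th := fun x => th1 + RInt g x1 x). exists th.
  assert (Hth1 : th x1 = th1).
  { unfold th. rewrite RInt_point. unfold zero; simpl. ring. }
  split; [exact Hth1|].
  assert (Dth : forall x, l < x -> is_derive th x (g x)).
  { intros x Hx. unfold th. replace (g x) with (0 + g x) by ring.
    apply (is_derive_plus (V := R_NormedModule) (fun _ => th1));
      [exact (is_derive_const (V := R_NormedModule) th1 x)|].
    apply (is_derive_RInt g _ x1); [|auto].
    exists (mkposreal (x - l) ltac:(lra)). intros z Hz.
    assert (Hz' : Rabs (z - x) < x - l) by exact Hz. apply Rabs_def2 in Hz'.
    apply (RInt_correct (V := R_CompleteNormedModule)).
    apply (ex_RInt_continuous (V := R_CompleteNormedModule)).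
    intros w Hw. apply Cg. apply Rlt_le_trans with (2 := proj1 Hw). apply Rmin_glb_lt; lra. }
  set (rho := fun x => sqrt (a x ^ 2 + b x ^ 2)).
  assert (Hrho : forall x, l < x -> 0 < rho x /\ rho x * rho x = a x ^ 2 + b x ^ 2).
  { intros x Hx. specialize (Hpos x Hx). split; [apply sqrt_lt_R0; auto|].
    apply sqrt_sqrt. lra. }
  assert (Drho : forall x, l < x -> is_derive rho x ((a x * a1 x + b x * b1 x) / rho x)).
  { intros x Hx. specialize (Hpos x Hx). destruct (Hrho x Hx) as [R1 R2]. unfold rho in *.
    assert (Ea : ex_derive a x) by (exists (a1 x); auto).
    assert (Eb : ex_derive b x) by (exists (b1 x); auto).
    auto_derive.
    - repeat split; auto.
    - replace (Derive (fun x => a x) x) with (a1 x) by (symmetry; apply is_derive_unique, Da; auto).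
      replace (Derive (fun x => b x) x) with (b1 x) by (symmetry; apply is_derive_unique, Db; auto).
      simpl in *. field. lra. }
  assert (Zero : forall s c : R -> R, (forall x, l < x -> is_derive s x (g x * c x)) ->
     (forall x, l < x -> is_derive c x (- g x * s x)) ->
     forall x, l < x -> (a x * c x + b x * s x) / rho x = (a x1 * c x1 + b x1 * s x1) / rho x1).
  { intros s c Ds Dc x Hx.
    destruct (mean_value (fun x => (a x * c x + b x * s x) / rho x) (fun _ => 0) x1 x)
      as [z [_ E]]; [|lra].
    intros t [Ht _]. assert (Hlt : l < t).
    { apply Rlt_le_trans with (2 := Ht). apply Rmin_glb_lt; lra. }
    destruct (Hrho t Hlt) as [R1 R2].
    assert (Ea : ex_derive a t) by (exists (a1 t); auto).
    assert (Eb : ex_derive b t) by (exists (b1 t); auto).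
    assert (Es : ex_derive s t) by (exists (g t * c t); auto).
    assert (Ec : ex_derive c t) by (exists (- g t * s t); auto).
    assert (Er : ex_derive rho t) by (eexists; apply Drho; auto).
    auto_derive.
    - repeat split; auto. lra.
    - replace (Derive (fun x => a x) t) with (a1 t) by (symmetry; apply is_derive_unique, Da; auto).
      replace (Derive (fun x => b x) t) with (b1 t) by (symmetry; apply is_derive_unique, Db; auto).
      replace (Derive (fun x => s x) t) with (g t * c t) by (symmetry; apply is_derive_unique, Ds; auto).
      replace (Derive (fun x => c x) t) with (- g t * s t) by (symmetry; apply is_derive_unique, Dc; auto).
      replace (Derive (fun x => rho x) t) with ((a t * a1 t + b t * b1 t) / rho t)
        by (symmetry; apply is_derive_unique, Drho; auto).
      specialize (Hg t Hlt). rewrite <- R2 in Hg.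
      apply Rmult_eq_reg_r with (rho t * rho t * rho t);
        [|apply Rgt_not_eq; repeat apply Rmult_lt_0_compat; auto].
      transitivity ((a1 t * c t + b1 t * s t) * (rho t * rho t)
        + (g t * (rho t * rho t)) * (b t * c t - a t * s t)
        - (a t * c t + b t * s t) * (a t * a1 t + b t * b1 t)); [field; lra|].
      rewrite Hg, R2. ring. }
  assert (Dcos : forall x, l < x -> is_derive (fun x => cos (th x)) x (- g x * sin (th x))).
  { intros x Hx. replace (- g x * sin (th x)) with (g x * - sin (th x)) by ring.
    apply (is_derive_comp (V := R_NormedModule) cos th); [|auto].
    apply is_derive_Reals, derivable_pt_lim_cos. }
  assert (Dsin : forall x, l < x -> is_derive (fun x => sin (th x)) x (g x * cos (th x))).
  { intros x Hx. apply (is_derive_comp (V := R_NormedModule) sin th); [|auto].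
    apply is_derive_Reals, derivable_pt_lim_sin. }
  assert (Z1 := Zero _ _ Dsin Dcos).
  assert (Z2 := Zero (fun x => cos (th x)) (fun x => - sin (th x))).
  intros x Hx. split; [auto|].
  specialize (Z1 x Hx).
  assert (Z2' : (a x * - sin (th x) + b x * cos (th x)) / rho x =
     (a x1 * - sin (th x1) + b x1 * cos (th x1)) / rho x1).
  { apply Z2; auto.
    - intros t Ht. replace (g t * - sin (th t)) with (- g t * sin (th t)) by ring. auto.
    - intros t Ht. replace (- g t * cos (th t)) with (- (g t * cos (th t))) by ring.
      apply (is_derive_opp (V := R_NormedModule) (fun x => sin (th x))). auto. }
  clear Z2.
  destruct (Hrho x1 Hl) as [R1 R2]. destruct (Hrho x Hx) as [R3 R4].
  cbv beta in Z1, Z2'. rewrite Hth1 in Z1, Z2'.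
  fold (rho x1) in Ha1, Hb1. fold (rho x).
  assert (E1 : a x * cos (th x) + b x * sin (th x) = rho x).
  { apply Rmult_eq_reg_r with (/ rho x); [|apply Rinv_neq_0_compat; lra].
    unfold Rdiv in Z1. rewrite Z1, Rinv_r by lra. 
    apply Rmult_eq_reg_r with (rho x1); [|lra].
    rewrite Rmult_assoc, Rinv_l, Rmult_1_r, Rmult_1_l by lra.
    rewrite Ha1 at 1. rewrite Hb1 at 1. pose proof (sin2_cos2 th1). unfold Rsqr in H.
    transitivity (rho x1 * (sin th1 * sin th1 + cos th1 * cos th1)); [ring|].
    rewrite H. ring. }
  assert (E2 : a x * - sin (th x) + b x * cos (th x) = 0).
  { apply Rmult_eq_reg_r with (/ rho x); [|apply Rinv_neq_0_compat; lra].
    unfold Rdiv in Z2'. rewrite Z2', Rmult_0_l.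
    replace (a x1 * - sin th1 + b x1 * cos th1) with 0; [ring|].
    rewrite Ha1, Hb1. ring. }
  pose proof (sin2_cos2 (th x)) as SC. unfold Rsqr in SC.
  split; rewrite <- E1.
  - transitivity (a x * (sin (th x) * sin (th x) + cos (th x) * cos (th x))
      + sin (th x) * (a x * - sin (th x) + b x * cos (th x))); [|ring].
    rewrite SC, E2. ring.
  - transitivity (b x * (sin (th x) * sin (th x) + cos (th x) * cos (th x))
      - cos (th x) * (a x * - sin (th x) + b x * cos (th x))); [|ring].
    rewrite SC, E2. ring.
Qed.

Lemma atan_abs_le u : Rabs (atan u) <= Rabs u.
Proof.
  rewrite <- (Rminus_0_r (atan u)), <- atan_0.
  replace (Rabs u) with (1 * Rabs (u - 0)) by (rewrite Rminus_0_r; ring).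
  apply mean_value_bound with (df := fun t => / (1 + t ^ 2)).
  - intros t _. apply is_derive_Reals, derivable_pt_lim_atan.
  - intros t _. pose proof (one_sqr_pos t). rewrite Rabs_pos_eq by (left; apply Rinv_0_lt_compat; lra).
    rewrite <- Rinv_1. apply Rinv_le_contravar; nra.
Qed.

(** The bound [4] excludes every multiple of [2 PI] other than [0]. *)
Lemma vanish_angle (e q : R -> R) K M : 0 < K ->
  (forall x, M < x -> Rabs (e x) <= 4) ->
  (forall x, M < x -> 0 < q x) ->
  vanish (fun x => q x * cos (e x) - K) -> vanish (fun x => q x * sin (e x)) -> vanish e.
Proof.
  intros HK He Hq Hc Hs. 
  assert (HK2 : 0 < K / 2) by lra.
  destruct (proj1 (vanish_spec _) Hc (mkposreal _ HK2)) as [M1 B1]. simpl in B1.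
  set (M2 := Rmax M M1).
  assert (E : forall x, M2 < x -> e x = atan (q x * sin (e x) / (q x * cos (e x))) /\
     K / 2 <= q x * cos (e x)).
  { intros x Hx. assert (M < x) by (eapply Rle_lt_trans; [apply Rmax_l | exact Hx]).
    assert (M1 < x) by (eapply Rle_lt_trans; [apply Rmax_r | exact Hx]).
    specialize (B1 x H0). specialize (He x H). pose proof (Hq x H) as Q1.
    apply Rabs_def2 in B1.
    assert (Hcos : 0 < cos (e x)).
    { apply Rmult_lt_reg_l with (q x); auto. lra. }
    assert (Hpi : Rabs (e x) < PI / 2).
    { destruct (Rlt_le_dec (Rabs (e x)) (PI / 2)) as [|Hge]; auto. exfalso.
      assert (cos (Rabs (e x)) <= 0).
      { apply cos_le_0; auto. pose proof PI_bounds. lra. }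
      assert (cos (Rabs (e x)) = cos (e x)).
      { unfold Rabs. destruct (Rcase_abs (e x)); [apply cos_neg | reflexivity]. }
      lra. }
    apply Rabs_def2 in Hpi. split; [|lra].
    replace (q x * sin (e x) / (q x * cos (e x))) with (tan (e x))
      by (unfold tan; field; lra).
    symmetry. apply atan_tan. lra. }
  assert (V : vanish (fun x => q x * sin (e x) * / (q x * cos (e x)))).
  { apply vanish_bounded with (/ (K / 2)) M2; auto.
    intros x Hx. destruct (E x Hx) as [_ E2].
    rewrite Rabs_pos_eq by (left; apply Rinv_0_lt_compat; lra).
    apply Rinv_le_contravar; lra. }
  apply vanish_spec. intros eps. destruct (proj1 (vanish_spec _) V eps) as [M3 B3].
  exists (Rmax M2 M3). intros x Hx.
  assert (M2 < x) by (eapply Rle_lt_trans; [apply Rmax_l | exact Hx]).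
  assert (M3 < x) by (eapply Rle_lt_trans; [apply Rmax_r | exact Hx]).
  destruct (E x H) as [E1 _]. rewrite E1. eapply Rle_lt_trans; [apply atan_abs_le|].
  apply B3; auto.
Qed.

Section Comparison.

(** Two solutions [y1], [y2] of [y'' + (1 + delta) y = 0], the derivative taken with
    respect to the variable [t], that behave like [K cos t] and [K sin t]. *)
Variables (l K : R) (t dt delta y1 z1 y2 z2 phi rho : R -> R).
Hypothesis HK : 0 < K.
Hypothesis Dt : forall x, l < x -> is_derive t x (dt x).
Hypothesis Cdt : forall x, l < x -> continuous dt x.
Hypothesis Hdt : forall x, l < x -> 0 < dt x.
Hypothesis Cdelta : forall x, l < x -> continuous delta x.
Hypothesis Dy1 : forall x, l < x -> is_derive y1 x (dt x * z1 x).
Hypothesis Dy2 : forall x, l < x -> is_derive y2 x (dt x * z2 x).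
Hypothesis Dz1 : forall x, l < x -> is_derive z1 x (- dt x * (1 + delta x) * y1 x).
Hypothesis Dz2 : forall x, l < x -> is_derive z2 x (- dt x * (1 + delta x) * y2 x).
Hypothesis Hrho : forall x, l < x -> 0 < rho x.
Hypothesis Hy1 : forall x, l < x -> y1 x = rho x * cos (phi x).
Hypothesis Hy2 : forall x, l < x -> y2 x = rho x * sin (phi x).
Hypothesis Cphi : forall x, l < x -> continuous phi x.
Hypothesis HW : forall x, l < x -> 0 < y1 x * z2 x - y2 x * z1 x.
Hypothesis Vy1 : vanish (fun x => y1 x - K * cos (t x)).
Hypothesis Vz1 : vanish (fun x => z1 x + K * sin (t x)).
Hypothesis Vy2 : vanish (fun x => y2 x - K * sin (t x)).
Hypothesis Vz2 : vanish (fun x => z2 x - K * cos (t x)).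
Hypothesis Vphi : vanish (fun x => phi x - t x).

(** Pruefer's angle of the solution that vanishes at [x1]. It agrees with the phase
    there, it never differs from it by as much as [PI], so both are asymptotic to [t]
    without a multiple of [2 PI] in between; and its rate is explicit. *)
Lemma pruefer_angle x1 : l < x1 -> exists e y z : R -> R,
  e x1 = phi x1 - t x1 /\ vanish e /\
  (forall x, l < x -> 0 < y x ^ 2 + z x ^ 2 /\
     is_derive y x (dt x * z x) /\
     is_derive e x (dt x * delta x * (y x ^ 2 / (y x ^ 2 + z x ^ 2)))).
Proof.
  intros Hx1. set (tau := phi x1 - PI / 2).
  set (y := fun x => cos tau * y1 x + sin tau * y2 x).
  set (z := fun x => cos tau * z1 x + sin tau * z2 x).
  set (yp := fun x => - sin tau * y1 x + cos tau * y2 x).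
  set (zp := fun x => - sin tau * z1 x + cos tau * z2 x).
  assert (SC := sin2_cos2 tau). unfold Rsqr in SC.
  assert (Wyz : forall x, l < x -> 0 < y x * zp x - yp x * z x).
  { intros x Hx. replace (y x * zp x - yp x * z x) with
      ((sin tau * sin tau + cos tau * cos tau) * (y1 x * z2 x - y2 x * z1 x))
      by (unfold y, z, yp, zp; ring).
    rewrite SC, Rmult_1_l. auto. }
  assert (Ey : forall x, l < x -> y x = rho x * cos (phi x - tau)).
  { intros x Hx. unfold y. rewrite Hy1, Hy2, cos_minus by auto. ring. }
  assert (Eyp : forall x, l < x -> yp x = rho x * sin (phi x - tau)).
  { intros x Hx. unfold yp. rewrite Hy1, Hy2, sin_minus by auto. ring. }
  assert (Dy : forall x, l < x -> is_derive y x (dt x * z x)).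
  { intros x Hx. unfold y, z.
    replace (dt x * (cos tau * z1 x + sin tau * z2 x))
      with (cos tau * (dt x * z1 x) + sin tau * (dt x * z2 x)) by ring.
    apply (is_derive_plus (V := R_NormedModule) (fun x => cos tau * y1 x));
      apply is_derive_scal; auto. }
  assert (Dz : forall x, l < x -> is_derive z x (- dt x * (1 + delta x) * y x)).
  { intros x Hx. unfold y, z.
    replace (- dt x * (1 + delta x) * (cos tau * y1 x + sin tau * y2 x))
      with (cos tau * (- dt x * (1 + delta x) * y1 x) + sin tau * (- dt x * (1 + delta x) * y2 x))
      by ring.
    apply (is_derive_plus (V := R_NormedModule) (fun x => cos tau * z1 x));
      apply is_derive_scal; auto. }
  assert (Pos : forall x, l < x -> 0 < y x ^ 2 + z x ^ 2).
  { intros x Hx. specialize (Wyz x Hx).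
    destruct (Req_dec (y x) 0) as [E0 | E0]; [|pose proof (pow2_ge_0 (z x)); nra].
    rewrite E0 in *. assert (z x <> 0) by (intros E1; rewrite E1 in Wyz; lra). nra. }
  assert (y0 : y x1 = 0).
  { rewrite Ey by auto. unfold tau. replace (phi x1 - (phi x1 - PI / 2)) with (PI / 2) by ring.
    rewrite cos_PI2. ring. }
  assert (z0 : z x1 < 0).
  { specialize (Wyz x1 Hx1). rewrite y0, Eyp in Wyz by auto. unfold tau in Wyz.
    replace (phi x1 - (phi x1 - PI / 2)) with (PI / 2) in Wyz by ring.
    rewrite sin_PI2 in Wyz. specialize (Hrho x1 Hx1). fold tau in Wyz.
    destruct (Rlt_le_dec (z x1) 0) as [|Hz]; auto. exfalso.
    assert (0 <= rho x1 * z x1) by (apply Rmult_le_pos; lra). lra. }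
  set (g := fun x => dt x * (1 + delta x * (y x ^ 2 / (y x ^ 2 + z x ^ 2)))).
  assert (Cy : forall x, l < x -> continuous y x).
  { intros x Hx. apply (ex_derive_continuous (V := R_NormedModule)). eexists; apply Dy; auto. }
  assert (Cz : forall x, l < x -> continuous z x).
  { intros x Hx. apply (ex_derive_continuous (V := R_NormedModule)). eexists; apply Dz; auto. }
  destruct (polar_lift l y (fun x => - z x) (fun x => dt x * z x)
     (fun x => dt x * (1 + delta x) * y x) g x1 (PI / 2)) as [psi [P1 P2]]; auto.
  - intros x Hx. replace (dt x * (1 + delta x) * y x) with (- (- dt x * (1 + delta x) * y x)) by ring.
    apply (is_derive_opp (V := R_NormedModule) z). auto.
  - intros x Hx. specialize (Pos x Hx). unfold g.
    assert (Cy2 : continuous (fun x => y x ^ 2) x).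
    { apply (continuous_ext (fun x => y x * y x)); [intros; simpl; ring|].
      apply (continuous_mult (K := R_AbsRing)); auto. }
    assert (Cz2 : continuous (fun x => z x ^ 2) x).
    { apply (continuous_ext (fun x => z x * z x)); [intros; simpl; ring|].
      apply (continuous_mult (K := R_AbsRing)); auto. }
    apply (continuous_mult (K := R_AbsRing)); auto.
    apply (continuous_plus (V := R_NormedModule)); [apply continuous_const|].
    apply (continuous_mult (K := R_AbsRing)); auto.
    apply (continuous_mult (K := R_AbsRing)); auto.
    apply (continuous_comp (fun x => y x ^ 2 + z x ^ 2) Rinv).
    + apply (continuous_plus (V := R_NormedModule)); auto.
    + apply continuous_Rinv. lra.
  - intros x Hx. replace ((- z x) ^ 2) with (z x ^ 2) by ring. auto.
  - intros x Hx. specialize (Pos x Hx). unfold g. field.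
    replace (y x ^ 2 + z x ^ 2) with (y x ^ 2 + z x ^ 2) in Pos by ring. nra.
  - rewrite cos_PI2, y0. ring.
  - rewrite sin_PI2, y0, Rmult_1_r. replace (0 ^ 2 + (- z x1) ^ 2) with ((- z x1) ^ 2) by ring.
    symmetry. apply sqrt_pow2. lra.
  - exists (fun x => psi x - t x + tau), y, z.
    assert (Cpsi : forall x, l < x -> continuous psi x).
    { intros x Hx. apply (ex_derive_continuous (V := R_NormedModule)). eexists; apply P2; auto. }
    set (Rr := fun x => sqrt (y x ^ 2 + (- z x) ^ 2)).
    assert (HR : forall x, l < x -> 0 < Rr x).
    { intros x Hx. apply sqrt_lt_R0. replace ((- z x) ^ 2) with (z x ^ 2) by ring. auto. }
    assert (Hpol : forall x, l < x -> y x = Rr x * cos (psi x) /\ - z x = Rr x * sin (psi x))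
      by (intros x Hx; apply P2; auto).
    set (D := fun x => phi x - tau - psi x).
    assert (CD : forall x, l < x -> continuous D x).
    { intros x Hx. unfold D. apply (continuous_minus (V := R_NormedModule)); auto.
      apply (continuous_minus (V := R_NormedModule)); auto. apply continuous_const. }
    assert (D0 : D x1 = 0) by (unfold D; rewrite P1; unfold tau; ring).
    assert (NoPi : forall x s, l < x -> s = PI \/ s = - PI -> D x <> s).
    { intros x s Hx Hs E.
      assert (C1 : cos (D x) = -1 /\ sin (D x) = 0).
      { rewrite E. destruct Hs as [-> | ->].
        - rewrite cos_PI, sin_PI. auto.
        - rewrite cos_neg, sin_neg, cos_PI, sin_PI. split; ring. }
      destruct C1 as [C1 C2].
      assert (Eq : phi x - tau = psi x + D x) by (unfold D; ring).
      destruct (Hpol x Hx) as [Q1 Q2].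
      specialize (Wyz x Hx). pose proof (Ey x Hx) as A1. pose proof (Eyp x Hx) as A2.
      rewrite Eq, cos_plus, C1, C2 in A1. rewrite Eq, sin_plus, C1, C2 in A2.
      specialize (HR x Hx). specialize (Hrho x Hx).
      assert (A3 : (Rr x + rho x) * cos (psi x) = 0) by (rewrite Q1 in A1; lra).
      apply Rmult_integral in A3. destruct A3 as [A3 | A3]; [lra|].
      assert (y x = 0) by (rewrite Q1, A3; ring).
      assert (z x = - Rr x * sin (psi x)) by lra.
      rewrite H, A2, H0 in Wyz.
      assert (0 <= rho x * Rr x * (sin (psi x) * sin (psi x))).
      { apply Rmult_le_pos; [apply Rmult_le_pos; lra|]. pose proof (Rle_0_sqr (sin (psi x))).
        unfold Rsqr in *. auto. }
      lra. }
    assert (Dlt : forall x, x1 < x -> Rabs (D x) < PI).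
    { intros x Hx. pose proof PI_RGT_0. apply Rabs_def1.
      - destruct (Rlt_le_dec (D x) PI) as [|Hge]; auto. exfalso.
        destruct (ivt D x1 x PI) as [c [Hc1 Hc2]]; [lra | intros; apply CD; lra | lra |].
        apply (NoPi c PI); auto. lra.
      - destruct (Rlt_le_dec (- PI) (D x)) as [|Hge]; auto. exfalso.
        destruct (ivt (fun x => - D x) x1 x PI) as [c [Hc1 Hc2]]; [lra | | lra |].
        + intros w Hw. apply (continuous_opp (V := R_NormedModule) D). apply CD. lra.
        + apply (NoPi c (- PI)); auto; lra. }
    destruct (proj1 (vanish_spec _) Vphi (mkposreal (1 / 2) ltac:(lra))) as [M HM].
    simpl in HM.
    split; [|split].
    + rewrite P1. unfold tau. ring.
    + assert (Vy : vanish (fun x => y x - K * cos (t x - tau))).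
      { apply (vanish_ext (fun x => cos tau * (y1 x - K * cos (t x))
           + sin tau * (y2 x - K * sin (t x))) _ 0).
        - intros x _. unfold y. rewrite cos_minus. ring.
        - apply vanish_plus; apply vanish_scal; auto. }
      assert (Vz : vanish (fun x => z x + K * sin (t x - tau))).
      { apply (vanish_ext (fun x => cos tau * (z1 x + K * sin (t x))
           + sin tau * (z2 x - K * cos (t x))) _ 0).
        - intros x _. unfold z. rewrite sin_minus. ring.
        - apply vanish_plus; apply vanish_scal; auto. }
      apply (vanish_angle _ Rr K (Rmax x1 M)); auto.
      * intros x Hx.
        assert (x1 < x) by (eapply Rle_lt_trans; [apply Rmax_l | exact Hx]).
        assert (M < x) by (eapply Rle_lt_trans; [apply Rmax_r | exact Hx]).
        specialize (HM x H0). specialize (Dlt x H). unfold D in Dlt.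
        apply Rabs_def2 in HM. apply Rabs_def2 in Dlt. pose proof PI_bounds.
        apply Rabs_le. lra.
      * intros x Hx. apply HR.
        assert (x1 < x) by (eapply Rle_lt_trans; [apply Rmax_l | exact Hx]). lra.
      * apply (vanish_ext (fun x => (y x - K * cos (t x - tau)) * cos (t x - tau)
          + (z x + K * sin (t x - tau)) * - sin (t x - tau)) _ l).
        -- intros x Hx. destruct (Hpol x Hx) as [Q1 Q2].
           replace (psi x - t x + tau) with (psi x - (t x - tau)) by ring.
           assert (Q3 : z x = - (Rr x * sin (psi x))) by lra.
           rewrite (cos_minus (psi x)). pose proof (sin2_cos2 (t x - tau)) as S2. unfold Rsqr in S2.
           rewrite Q1, Q3.
           transitivity (Rr x * (cos (psi x) * cos (t x - tau) + sin (psi x) * sin (t x - tau))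
             - K * (sin (t x - tau) * sin (t x - tau) + cos (t x - tau) * cos (t x - tau)));
             [ring | rewrite S2; ring].
        -- apply vanish_plus; apply vanish_bounded with 1 0; auto; intros;
             rewrite ?Rabs_Ropp; auto using Rabs_cos_le, Rabs_sin_le.
      * apply (vanish_ext (fun x => (y x - K * cos (t x - tau)) * - sin (t x - tau)
          + (z x + K * sin (t x - tau)) * - cos (t x - tau)) _ l).
        -- intros x Hx. destruct (Hpol x Hx) as [Q1 Q2].
           replace (psi x - t x + tau) with (psi x - (t x - tau)) by ring.
           assert (Q3 : z x = - (Rr x * sin (psi x))) by lra.
           rewrite (sin_minus (psi x)), Q1, Q3. ring.
        -- apply vanish_plus; apply vanish_bounded with 1 0; auto; intros;
             rewrite ?Rabs_Ropp; auto using Rabs_cos_le, Rabs_sin_le.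
    + intros x Hx. split; [auto|]. split; [auto|].
      destruct (P2 x Hx) as [P3 _].
      replace (dt x * delta x * (y x ^ 2 / (y x ^ 2 + z x ^ 2))) with (g x - dt x + 0)
        by (unfold g; ring).
      apply (is_derive_plus (V := R_NormedModule) (fun x => psi x - t x) (fun _ => tau));
        [|exact (is_derive_const (V := R_NormedModule) tau x)].
      apply (is_derive_minus (V := R_NormedModule) psi t); auto.
Qed.

(** A nondecreasing function with limit [0] is nonpositive; [s] carries the sign. *)
Lemma monotone_vanish_sign (e de : R -> R) x1 s :
  (forall x, x1 <= x -> is_derive e x (de x)) -> (forall x, x1 <= x -> 0 <= s * de x) ->
  vanish e -> 0 <= s * e x1 -> forall x, x1 <= x -> s * e x = 0.
Proof.
  intros De Hde Ve H1.
  assert (Mon : forall a b, x1 <= a <= b -> s * e a <= s * e b).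
  { intros a b Hab. destruct (mean_value e de a b) as [c [Hc E]].
    - intros x Hx. rewrite Rmin_left in Hx by lra. apply De. lra.
    - rewrite Rmin_left in Hc by lra. specialize (Hde c ltac:(lra)).
      assert (0 <= s * de c * (b - a)) by (apply Rmult_le_pos; lra).
      replace (s * e b) with (s * e a + s * (e b - e a)) by ring. rewrite E. lra. }
  intros x Hx. pose proof (Mon x1 x ltac:(lra)).
  destruct (Rle_lt_or_eq_dec 0 (s * e x)) as [Hp | Hp]; [lra| |auto].
  exfalso. assert (V := vanish_scal s e Ve). rewrite vanish_spec in V.
  destruct (V (mkposreal _ Hp)) as [M HM]. simpl in HM.
  specialize (HM (Rmax x M + 1)). 
  pose proof (Rmax_l x M). pose proof (Rmax_r x M).
  specialize (Mon x (Rmax x M + 1) ltac:(lra)). specialize (HM ltac:(lra)).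
  pose proof (Rle_abs (s * e (Rmax x M + 1))). lra.
Qed.

(** If [delta] has a constant sign, [psi - t] is monotone and tends to [0]. *)
Lemma phase_comparison s : (forall x, l < x -> 0 < s * delta x) ->
  forall x, l < x -> s * (phi x - t x) < 0.
Proof.
  intros Hs x1 Hx1. destruct (pruefer_angle x1 Hx1) as [e [y [z [E0 [Ve P]]]]].
  rewrite <- E0. destruct (Rlt_le_dec (s * e x1) 0) as [|Hge]; auto. exfalso.
  assert (Hsn : s <> 0) by (intros E; specialize (Hs x1 Hx1); rewrite E in Hs; lra).
  set (de := fun x => dt x * delta x * (y x ^ 2 / (y x ^ 2 + z x ^ 2))).
  assert (Z : forall x, x1 <= x -> s * e x = 0).
  { apply (monotone_vanish_sign e de); auto.
    - intros x Hx. apply P. lra.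
    - intros x Hx. destruct (P x ltac:(lra)) as [P1 _]. unfold de.
      specialize (Hs x ltac:(lra)). specialize (Hdt x ltac:(lra)).
      replace (s * (dt x * delta x * (y x ^ 2 / (y x ^ 2 + z x ^ 2))))
        with (dt x * (s * delta x) * (y x ^ 2 * / (y x ^ 2 + z x ^ 2))) by (unfold Rdiv; ring).
      apply Rmult_le_pos; [left; apply Rmult_lt_0_compat; auto|].
      apply Rmult_le_pos; [apply pow2_ge_0 | left; apply Rinv_0_lt_compat; auto]. }
  assert (Y0 : forall x, x1 < x -> y x = 0).
  { intros x Hx. destruct (P x ltac:(lra)) as [P1 [_ P3]].
    assert (D0 : is_derive e x 0).
    { apply (is_derive_ext_loc (fun _ => 0)); [|exact (is_derive_const (V := R_NormedModule) 0 _)].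
      exists (mkposreal (x - x1) ltac:(lra)). intros w Hw.
      assert (Hw' : Rabs (w - x) < x - x1) by exact Hw. apply Rabs_def2 in Hw'.
      specialize (Z w ltac:(lra)). apply Rmult_integral in Z. destruct Z; [contradiction|auto]. }
    apply is_derive_unique in D0. apply is_derive_unique in P3. rewrite D0 in P3.
    specialize (Hs x ltac:(lra)). specialize (Hdt x ltac:(lra)).
    symmetry in P3. apply Rmult_integral in P3. destruct P3 as [P3 | P3].
    - apply Rmult_integral in P3. destruct P3 as [P3|P3]; [lra|]. rewrite P3 in Hs. lra.
    - apply Rmult_integral in P3. destruct P3 as [P3 | P3].
      + simpl in P3. rewrite Rmult_1_r in P3. apply Rmult_integral in P3. tauto.
      + exfalso. apply (Rinv_neq_0_compat (y x ^ 2 + z x ^ 2)); lra. }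
  destruct (P (x1 + 1) ltac:(lra)) as [P1 [P2 _]].
  assert (D0 : is_derive y (x1 + 1) 0).
  { apply (is_derive_ext_loc (fun _ => 0)); [|exact (is_derive_const (V := R_NormedModule) 0 _)].
    exists (mkposreal 1 Rlt_0_1). intros w Hw.
    assert (Hw' : Rabs (w - (x1 + 1)) < 1) by exact Hw. apply Rabs_def2 in Hw'.
    symmetry. apply Y0. lra. }
  apply is_derive_unique in D0. apply is_derive_unique in P2. rewrite D0 in P2.
  specialize (Hdt (x1 + 1) ltac:(lra)). symmetry in P2. apply Rmult_integral in P2.
  destruct P2 as [P2 | P2]; [lra|]. rewrite P2, (Y0 (x1 + 1)) in P1 by lra. lra.
Qed.

End Comparison.

(** * The comparison phases *)

(** [phi_lower], [phi_tilde] and [p_poly] are elementary functions of this root, which is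
    [x] times the derivative of [phi_lower]. *)
Definition root_r (nu x : R) : R := sqrt (x ^ 2 - nu ^ 2).

Lemma le_div a b c : 0 < c -> a * c <= b -> a <= b / c.
Proof.
  intros Hc H. apply Rmult_le_reg_r with c; auto.
  unfold Rdiv. rewrite Rmult_assoc, Rinv_l; lra.
Qed.

Lemma div_le a b c : 0 < c -> a <= b * c -> a / c <= b.
Proof.
  intros Hc H. apply Rmult_le_reg_r with c; auto.
  unfold Rdiv. rewrite Rmult_assoc, Rinv_l; lra.
Qed.

Lemma root_r_spec nu x : 0 <= nu < x ->
  0 < root_r nu x /\ root_r nu x ^ 2 = x ^ 2 - nu ^ 2.
Proof.
  intros H. assert (0 < x ^ 2 - nu ^ 2) by nra. unfold root_r.
  split; [apply sqrt_lt_R0; auto|]. apply pow2_sqrt. lra.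
Qed.

Lemma is_derive_root_r nu x : 0 <= nu < x -> is_derive (root_r nu) x (x / root_r nu x).
Proof.
  intros H. destruct (root_r_spec nu x H) as [H1 H2]. unfold root_r in *. auto_derive.
  - nra.
  - change (x ^ 2) with (x * (x * 1)) in *. change (nu ^ 2) with (nu * (nu * 1)) in *.
    unfold Rminus in *. field. lra.
Qed.

Lemma acos_ratio nu x : 0 <= nu < x ->
  cos (acos (nu / x)) = nu / x /\ sin (acos (nu / x)) = root_r nu x / x /\
  0 < acos (nu / x) <= PI / 2.
Proof.
  intros H. destruct (root_r_spec nu x H) as [H1 H2].
  assert (B : 0 <= nu / x < 1).
  { split; [apply Rmult_le_pos; [lra | left; apply Rinv_0_lt_compat; lra]|].
    apply Rmult_lt_reg_r with x; [lra|]. unfold Rdiv. rewrite Rmult_assoc, Rinv_l; lra. }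
  assert (C : cos (acos (nu / x)) = nu / x) by (apply cos_acos; lra).
  pose proof (acos_bound (nu / x)) as A. pose proof PI_RGT_0.
  assert (S : 0 <= sin (acos (nu / x))) by (apply sin_ge_0; lra).
  split; [auto|]. split.
  - assert (0 <= root_r nu x / x) by (apply Rmult_le_pos; [lra | left; apply Rinv_0_lt_compat; lra]).
    apply Rsqr_inj; auto. unfold Rsqr. pose proof (sin2_cos2 (acos (nu / x))) as P.
    rewrite C in P. unfold Rsqr in P.
    replace (root_r nu x / x * (root_r nu x / x)) with (root_r nu x ^ 2 / x ^ 2) by (field; lra).
    rewrite H2. replace ((x ^ 2 - nu ^ 2) / x ^ 2) with (1 - nu / x * (nu / x)) by (field; lra). lra.
  - split.
    + destruct (Rle_lt_or_eq_dec 0 (acos (nu / x))) as [L | L]; auto; [lra|].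
      exfalso. rewrite <- L, cos_0 in C. lra.
    + destruct (Rle_lt_dec (acos (nu / x)) (PI / 2)) as [L | L]; auto. exfalso.
      assert (cos (acos (nu / x)) < 0) by (apply cos_lt_0; lra). lra.
Qed.

Lemma is_derive_acos u : -1 < u < 1 -> is_derive acos u (-1 / sqrt (1 - u²)).
Proof.
  intros H. apply is_derive_Reals. exact (derive_pt_eq_1 _ _ _ _ (derive_pt_acos u H)).
Qed.

Lemma is_derive_phi_lower nu x : 0 <= nu < x ->
  is_derive (phi_lower nu) x (root_r nu x / x).
Proof.
  intros H. destruct (root_r_spec nu x H) as [H1 H2].
  assert (B : -1 < nu / x < 1).
  { split; [apply Rlt_le_trans with 0; [lra|]; apply Rmult_le_pos;
      [lra | left; apply Rinv_0_lt_compat; lra]|].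
    apply Rmult_lt_reg_r with x; [lra|]. unfold Rdiv. rewrite Rmult_assoc, Rinv_l; lra. }
  assert (DA : is_derive acos (nu / x) (- / sqrt (1 - (nu / x) ^ 2))).
  { assert (DA := is_derive_acos (nu / x) B).
    replace ((nu / x) ^ 2) with (Rsqr (nu / x)) by (unfold Rsqr; ring).
    replace (- / sqrt (1 - (nu / x)²)) with (-1 / sqrt (1 - (nu / x)²))
      by (unfold Rdiv; ring). exact DA. }
  assert (ES : sqrt (1 - (nu / x) ^ 2) = root_r nu x / x).
  { replace (1 - (nu / x) ^ 2) with ((root_r nu x / x) ^ 2).
    - apply sqrt_pow2. apply Rmult_le_pos; [lra | left; apply Rinv_0_lt_compat; lra].
    - replace ((root_r nu x / x) ^ 2) with (root_r nu x ^ 2 / x ^ 2) by (field; lra).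
      rewrite H2. field. lra. }
  rewrite ES in DA.
  assert (DN : is_derive (fun x => nu / x) x (- nu / x ^ 2)) by (auto_derive; [lra|]; field; lra).
  assert (DC := is_derive_comp (V := R_NormedModule) acos (fun x => nu / x) x _ _ DA DN).
  assert (DR := is_derive_root_r nu x H).
  apply (is_derive_ext (fun x => root_r nu x - nu * acos (nu / x) + PI / 4)); [reflexivity|].
  set (ac := fun x => acos (nu / x)). 
  assert (DC' : is_derive ac x (nu / (x * root_r nu x))).
  { replace (nu / (x * root_r nu x)) with (scal (- nu / x ^ 2) (- / (root_r nu x / x))); [exact DC|].
    unfold scal; simpl; unfold mult; simpl. field. lra. }
  apply (is_derive_ext (fun x => root_r nu x - nu * ac x + PI / 4)); [reflexivity|].
  assert (E1 : ex_derive (root_r nu) x) by (eexists; exact DR).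
  assert (E2 : ex_derive ac x) by (eexists; exact DC').
  auto_derive; [auto|].
  replace (Derive (fun x => root_r nu x) x) with (x / root_r nu x)
    by (symmetry; apply is_derive_unique, DR).
  replace (Derive (fun x => ac x) x) with (nu / (x * root_r nu x))
    by (symmetry; apply is_derive_unique, DC').
  apply Rmult_eq_reg_r with (x * root_r nu x); [|nra].
  transitivity (x ^ 2 - nu ^ 2); [field; lra|]. rewrite <- H2. field. lra.
Qed.

Lemma is_derive_pos_increasing (f df : R -> R) a b :
  a < b -> (forall x, a <= x <= b -> is_derive f x (df x)) ->
  (forall x, a < x < b -> 0 < df x) -> f a < f b.
Proof.
  intros Hab Hd Hp.
  destruct (MVT_cor2 f df a b Hab) as [c [Hc1 Hc2]].
  - intros c Hc. apply is_derive_Reals. auto.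
  - specialize (Hp c Hc2). assert (0 < df c * (b - a)) by (apply Rmult_lt_0_compat; lra). lra.
Qed.

Lemma phi_lower_increasing nu a b : 0 <= nu < a -> a < b -> phi_lower nu a < phi_lower nu b.
Proof.
  intros Ha Hab. apply (is_derive_pos_increasing _ (fun x => root_r nu x / x)); auto.
  - intros x Hx. apply is_derive_phi_lower. lra.
  - intros x Hx. destruct (root_r_spec nu x ltac:(lra)). apply Rdiv_lt_0_compat; lra.
Qed.

Lemma phi_lower_at nu : 0 <= nu -> phi_lower nu nu = PI / 4.
Proof.
  intros H. unfold phi_lower. replace (nu ^ 2 - nu ^ 2) with 0 by ring. rewrite sqrt_0.
  destruct (Req_dec nu 0) as [-> | Hn]; [ring|].
  replace (nu / nu) with 1 by (field; auto). rewrite acos_1. ring.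
Qed.

(** In the angle [t = acos (nu / x)] the difference is [x (sin t - t cos t)]. *)
Lemma phi_lower_gt nu x : 0 <= nu < x -> PI / 4 < phi_lower nu x.
Proof.
  intros H. destruct (acos_ratio nu x H) as [C [S B]]. set (t := acos (nu / x)) in *.
  assert (A : sin 0 - 0 * cos 0 < sin t - t * cos t).
  { apply (is_derive_pos_increasing (fun t => sin t - t * cos t) (fun t => t * sin t)); [lra| |].
    - intros u _. auto_derive; auto. ring.
    - intros u Hu. pose proof PI_RGT_0. apply Rmult_lt_0_compat; [lra|]. apply sin_gt_0; lra. }
  rewrite sin_0, C, S in A. unfold phi_lower. fold (root_r nu x). fold t.
  assert (0 < x * (root_r nu x / x - t * (nu / x))) by (apply Rmult_lt_0_compat; lra).
  replace (x * (root_r nu x / x - t * (nu / x))) with (root_r nu x - nu * t) in H0 by (field; lra).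
  lra.
Qed.

Lemma phi_lower_le nu x : 0 <= nu < x -> phi_lower nu x <= root_r nu x + PI / 4.
Proof.
  intros H. destruct (acos_ratio nu x H) as [_ [_ B]]. unfold phi_lower. fold (root_r nu x). nra.
Qed.

Lemma phi_lower_unbounded nu K : 0 <= nu -> exists x, nu < x /\ K < phi_lower nu x.
Proof.
  intros H. set (x := nu + Rabs K + nu * (PI / 2) + nu + 1).
  pose proof (Rabs_pos K). pose proof (Rle_abs K). pose proof PI_RGT_0.
  assert (0 <= nu * (PI / 2)) by nra. assert (Hx : nu < x) by (unfold x; lra).
  exists x. split; auto.
  destruct (acos_ratio nu x ltac:(lra)) as [_ [_ B]].
  destruct (root_r_spec nu x ltac:(lra)) as [R1 R2].
  assert (x - nu <= root_r nu x).
  { apply Rsqr_incr_0_var; [|lra]. unfold Rsqr.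
    replace (root_r nu x * root_r nu x) with (root_r nu x ^ 2) by ring. rewrite R2. nra. }
  unfold phi_lower. fold (root_r nu x).
  assert (nu * acos (nu / x) <= nu * (PI / 2)) by (apply Rmult_le_compat_l; lra).
  unfold x in *. lra.
Qed.

Lemma vanish_phi_lower nu : 0 <= nu ->
  vanish (fun x => phi_lower nu x - (x - nu * (PI / 2) + PI / 4)).
Proof.
  intros H. apply is_lim_0_bound with (nu ^ 2 + 2 * nu ^ 2) (2 * nu + 1). intros x Hx.
  destruct (root_r_spec nu x ltac:(lra)) as [R1 R2].
  unfold phi_lower. fold (root_r nu x).
  replace (root_r nu x - nu * acos (nu / x) + PI / 4 - (x - nu * (PI / 2) + PI / 4))
    with ((root_r nu x - x) - nu * (acos (nu / x) - acos 0)) by (rewrite acos_0; ring).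
  assert (B0 : 0 <= nu / x <= 1 / 2).
  { split; [apply Rmult_le_pos; [lra | left; apply Rinv_0_lt_compat; lra]|].
    apply Rmult_le_reg_r with x; [lra|]. unfold Rdiv. rewrite Rmult_assoc, Rinv_l; lra. }
  assert (A : Rabs (acos (nu / x) - acos 0) <= 2 * Rabs (nu / x - 0)).
  { apply mean_value_bound with (df := fun u => -1 / sqrt (1 - u²)).
    - intros u Hu. rewrite Rmin_left, Rmax_right in Hu by lra.
      apply is_derive_acos. lra.
    - intros u Hu. rewrite Rmin_left, Rmax_right in Hu by lra.
      assert (1 / 2 <= sqrt (1 - u²)).
      { rewrite <- (sqrt_pow2 (1 / 2)) by lra. apply sqrt_le_1; unfold Rsqr; nra. }
      unfold Rdiv. rewrite Rabs_mult, Rabs_inv, (Rabs_pos_eq (sqrt _)) by lra.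
      rewrite (Rabs_left (-1)) by lra.
      assert (/ sqrt (1 - u²) <= / (1 / 2)) by (apply Rinv_le_contravar; lra). lra. }
  rewrite Rminus_0_r, (Rabs_pos_eq (nu / x)) in A by lra.
  assert (C : Rabs (root_r nu x - x) <= nu ^ 2 / x).
  { assert (E : root_r nu x - x = - nu ^ 2 / (root_r nu x + x)).
    { apply Rmult_eq_reg_r with (root_r nu x + x); [|lra].
      replace (- nu ^ 2 / (root_r nu x + x) * (root_r nu x + x)) with (- nu ^ 2) by (field; lra).
      replace ((root_r nu x - x) * (root_r nu x + x)) with (root_r nu x ^ 2 - x ^ 2) by ring.
      rewrite R2. ring. }
    rewrite E. unfold Rdiv. rewrite Rabs_mult, Rabs_Ropp, Rabs_inv.
    rewrite (Rabs_pos_eq (nu ^ 2)), (Rabs_pos_eq (root_r nu x + x)) by (try apply pow2_ge_0; lra).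
    apply Rmult_le_compat_l; [apply pow2_ge_0|]. apply Rinv_le_contravar; lra. }
  unfold Rminus at 1. eapply Rle_trans; [apply Rabs_triang|].
  rewrite Rabs_Ropp, Rabs_mult, (Rabs_pos_eq nu) by lra.
  apply Rle_trans with (nu ^ 2 / x + nu * (2 * (nu / x))); [|right; field; lra].
  apply Rplus_le_compat; auto. apply Rmult_le_compat_l; auto.
Qed.

(** With [s = sqrt (x^2 - nu^2)]: [qf] is the potential of the equation satisfied by
    [x J' / (x^2 - nu^2)^(1/4)] in the variable [phi_lower], and [qf1], [qf2] are its
    derivatives with respect to that variable. *)
Definition qf (nu x : R) : R := let s := root_r nu x in
  (s ^ 2 + nu ^ 2) * (3 * s ^ 2 + 7 * nu ^ 2) / (4 * s ^ 6).
Definition qf1 (nu x : R) : R := let s := root_r nu x in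
  - ((s ^ 2 + nu ^ 2) * (3 * s ^ 4 + 20 * nu ^ 2 * s ^ 2 + 21 * nu ^ 4)) / (2 * s ^ 9).
Definition qf2 (nu x : R) : R := let s := root_r nu x in
  (s ^ 2 + nu ^ 2) * (9 * s ^ 6 + 115 * nu ^ 2 * s ^ 4 + 287 * nu ^ 4 * s ^ 2 + 189 * nu ^ 6)
    / (2 * s ^ 12).

Lemma is_derive_root_r_comp nu x (F : R -> R) dF : 0 <= nu < x ->
  is_derive F (root_r nu x) dF ->
  is_derive (fun x => F (root_r nu x)) x
    (root_r nu x / x * (dF * (root_r nu x ^ 2 + nu ^ 2) / root_r nu x ^ 2)).
Proof.
  intros H HF. destruct (root_r_spec nu x H) as [R1 R2].
  assert (DR := is_derive_root_r nu x H).
  assert (DC := is_derive_comp (V := R_NormedModule) F (root_r nu) x _ _ HF DR).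
  replace (root_r nu x / x * (dF * (root_r nu x ^ 2 + nu ^ 2) / root_r nu x ^ 2))
    with (scal (x / root_r nu x) dF); [exact DC|].
  unfold scal; simpl; unfold mult; simpl.
  replace (root_r nu x * (root_r nu x * 1)) with (root_r nu x ^ 2) by ring.
  apply Rmult_eq_reg_r with (x * root_r nu x); [|nra].
  replace (root_r nu x ^ 2 + nu * (nu * 1)) with (x ^ 2) by (rewrite R2; ring).
  field. lra.
Qed.

Lemma is_derive_qf nu x : 0 <= nu < x ->
  is_derive (qf nu) x (root_r nu x / x * qf1 nu x).
Proof.
  intros H. destruct (root_r_spec nu x H) as [R1 _].
  set (F := fun s => (s ^ 2 + nu ^ 2) * (3 * s ^ 2 + 7 * nu ^ 2) / (4 * s ^ 6)).
  assert (HF : is_derive F (root_r nu x) (qf1 nu x * root_r nu x ^ 2 / (root_r nu x ^ 2 + nu ^ 2))).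
  { unfold F, qf1. set (s := root_r nu x) in *.
    assert (0 < s ^ 6) by (apply pow_lt; auto). pose proof (pow2_ge_0 nu).
    auto_derive; [simpl in *; lra|]. field. split; nra. }
  assert (D := is_derive_root_r_comp nu x F _ H HF).
  replace (root_r nu x / x * qf1 nu x) with (root_r nu x / x *
    (qf1 nu x * root_r nu x ^ 2 / (root_r nu x ^ 2 + nu ^ 2) * (root_r nu x ^ 2 + nu ^ 2)
      / root_r nu x ^ 2)); [exact D|].
  pose proof (pow2_ge_0 nu). field. repeat split; nra.
Qed.

Lemma is_derive_qf1 nu x : 0 <= nu < x ->
  is_derive (qf1 nu) x (root_r nu x / x * qf2 nu x).
Proof.
  intros H. destruct (root_r_spec nu x H) as [R1 _].
  set (F := fun s => - ((s ^ 2 + nu ^ 2) * (3 * s ^ 4 + 20 * nu ^ 2 * s ^ 2 + 21 * nu ^ 4))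
     / (2 * s ^ 9)).
  assert (HF : is_derive F (root_r nu x) (qf2 nu x * root_r nu x ^ 2 / (root_r nu x ^ 2 + nu ^ 2))).
  { unfold F, qf2. set (s := root_r nu x) in *.
    assert (0 < s ^ 9) by (apply pow_lt; auto). pose proof (pow2_ge_0 nu).
    auto_derive; [simpl in *; lra|]. field. split; nra. }
  assert (D := is_derive_root_r_comp nu x F _ H HF).
  replace (root_r nu x / x * qf2 nu x) with (root_r nu x / x *
    (qf2 nu x * root_r nu x ^ 2 / (root_r nu x ^ 2 + nu ^ 2) * (root_r nu x ^ 2 + nu ^ 2)
      / root_r nu x ^ 2)); [exact D|].
  pose proof (pow2_ge_0 nu). field. repeat split; nra.
Qed.

Lemma qf_pos nu x : 0 <= nu < x -> 0 < qf nu x.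
Proof.
  intros H. destruct (root_r_spec nu x H) as [R1 _]. unfold qf. set (s := root_r nu x) in *.
  assert (0 < s ^ 6) by (apply pow_lt; auto). pose proof (pow2_ge_0 nu).
  apply Rdiv_lt_0_compat; [|lra]. apply Rmult_lt_0_compat; nra.
Qed.

(** After clearing denominators all coefficients are positive. *)
Lemma qf2_gt_sqr nu x : 0 <= nu < x -> qf nu x ^ 2 < qf2 nu x.
Proof.
  intros H. destruct (root_r_spec nu x H) as [R1 _]. unfold qf, qf2. set (s := root_r nu x) in *.
  assert (P12 : 0 < s ^ 12) by (apply pow_lt; auto).
  set (r := s ^ 2). assert (Hr : 0 < r) by (unfold r; nra).
  set (n := nu ^ 2). assert (Hn : 0 <= n) by apply pow2_ge_0.
  apply Rlt_0_minus.
  replace ((r + n) * (9 * s ^ 6 + 115 * n * s ^ 4 + 287 * nu ^ 4 * r + 189 * nu ^ 6) / (2 * s ^ 12)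
     - ((r + n) * (3 * r + 7 * n) / (4 * s ^ 6)) ^ 2)
  with ((r + n) * (63 * r ^ 3 + 869 * (n * r ^ 2) + 2205 * (n ^ 2 * r) + 1463 * n ^ 3)
     / (16 * s ^ 12)) by (unfold r, n; field; lra).
  apply Rdiv_lt_0_compat; [|lra]. apply Rmult_lt_0_compat; [lra|].
  assert (0 < r ^ 3) by (apply pow_lt; auto).
  assert (0 <= n * r ^ 2) by (apply Rmult_le_pos; [auto | apply pow2_ge_0]).
  assert (0 <= n ^ 2 * r) by (apply Rmult_le_pos; [apply pow2_ge_0 | lra]).
  assert (0 <= n ^ 3) by (apply pow_le; auto). lra.
Qed.

(** [x_star] is the point where [qf] falls to [2], that is where [phi_tilde] becomes
    increasing. *)
Lemma p_poly_qf nu x : 0 <= nu < x -> p_poly nu x = 8 * root_r nu x ^ 6 * (1 - qf nu x / 2).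
Proof.
  intros H. destruct (root_r_spec nu x H) as [R1 R2]. unfold qf, p_poly.
  set (s := root_r nu x) in *. replace (x ^ 6) with ((x ^ 2) ^ 3) by ring.
  replace (x ^ 4) with ((x ^ 2) ^ 2) by ring. replace (x ^ 2) with (s ^ 2 + nu ^ 2) by lra.
  field. lra.
Qed.

Lemma qf1_neg nu x : 0 <= nu < x -> qf1 nu x < 0.
Proof.
  intros H. destruct (root_r_spec nu x H) as [R1 _]. unfold qf1. set (s := root_r nu x) in *.
  assert (0 < s ^ 9) by (apply pow_lt; auto). pose proof (pow2_ge_0 nu).
  assert (0 < s ^ 4) by (apply pow_lt; auto). assert (0 < s ^ 2) by (apply pow_lt; auto).
  assert (0 <= nu ^ 4) by (apply pow_le; lra).
  assert (0 <= nu ^ 2 * s ^ 2) by (apply Rmult_le_pos; lra).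
  unfold Rdiv. rewrite Ropp_mult_distr_l_reverse. apply Ropp_lt_gt_0_contravar.
  apply Rdiv_lt_0_compat; [|lra]. apply Rmult_lt_0_compat; nra.
Qed.

Lemma qf_decreasing nu a b : 0 <= nu < a -> a < b -> qf nu b < qf nu a.
Proof.
  intros Ha Hab.
  apply Ropp_lt_cancel. apply (is_derive_pos_increasing (fun x => - qf nu x)
    (fun x => - (root_r nu x / x * qf1 nu x))); auto.
  - intros x Hx. apply (is_derive_opp (V := R_NormedModule) (qf nu)). apply is_derive_qf. lra.
  - intros x Hx. destruct (root_r_spec nu x ltac:(lra)) as [R1 _].
    pose proof (qf1_neg nu x ltac:(lra)).
    assert (0 < root_r nu x / x) by (apply Rdiv_lt_0_compat; lra). nra.
Qed.

Lemma the_real_spec (P : R -> Prop) : (exists x, P x) -> P (the_real P).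
Proof. apply epsilon_spec. Qed.

Lemma x_star_spec nu : 0 <= nu -> nu < x_star nu /\ qf nu (x_star nu) = 2.
Proof.
  intros Hnu.
  assert (Ex : exists x, nu < x /\ p_poly nu x = 0).
  { set (a := sqrt (nu ^ 2 + 1 / 8)). set (b := sqrt (nu ^ 2 + 2 * (1 + nu ^ 2))).
    pose proof (pow2_ge_0 nu).
    assert (Ha : a ^ 2 = nu ^ 2 + 1 / 8) by (apply pow2_sqrt; lra).
    assert (Hb : b ^ 2 = nu ^ 2 + 2 * (1 + nu ^ 2)) by (apply pow2_sqrt; lra).
    assert (Hna : nu < a).
    { unfold a. rewrite <- (sqrt_pow2 nu) at 1 by auto. apply sqrt_lt_1; lra. }
    assert (Hab : a <= b) by (apply sqrt_le_1; lra).
    assert (P : forall x, p_poly nu x = 8 * (x ^ 2 - nu ^ 2) ^ 3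
       - x ^ 2 * (3 * (x ^ 2 - nu ^ 2) + 7 * nu ^ 2)) by (intros; unfold p_poly; ring).
    destruct (ivt (p_poly nu) a b 0) as [c [Hc1 Hc2]]; auto.
    - intros x _. apply (ex_derive_continuous (V := R_NormedModule)). unfold p_poly. auto_derive; auto.
    - rewrite !P, Ha, Hb. replace (nu ^ 2 + 1 / 8 - nu ^ 2) with (1 / 8) by ring.
      replace (nu ^ 2 + 2 * (1 + nu ^ 2) - nu ^ 2) with (2 * (1 + nu ^ 2)) by ring.
      set (n := nu ^ 2) in *. split; nra.
    - exists c. split; [lra | auto]. }
  destruct (the_real_spec _ Ex) as [S1 S2]. fold (x_star nu) in S1, S2. split; auto.
  rewrite p_poly_qf in S2 by lra. destruct (root_r_spec nu (x_star nu) ltac:(lra)) as [R1 _].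
  assert (0 < root_r nu (x_star nu) ^ 6) by (apply pow_lt; auto).
  apply Rmult_integral in S2. lra.
Qed.

Lemma phi_tilde_root nu x : 0 <= nu < x ->
  phi_tilde nu x = phi_lower nu x + (9 * root_r nu x ^ 2 + 7 * nu ^ 2) / (24 * root_r nu x ^ 3).
Proof.
  intros H. destruct (root_r_spec nu x H) as [R1 R2]. unfold phi_tilde. f_equal.
  rewrite <- R2. replace (3 / 2) with (/ 2 * 3) by field.
  rewrite <- Rpower_mult, Rpower_sqrt by (apply pow_lt; auto).
  rewrite sqrt_pow2 by lra.
  replace (Rpower (root_r nu x) 3) with (root_r nu x ^ 3).
  - f_equal. lra.
  - rewrite <- Rpower_pow by auto. f_equal. simpl. ring.
Qed.

Lemma is_derive_phi_tilde nu x : 0 <= nu < x ->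
  is_derive (phi_tilde nu) x (root_r nu x / x * (1 - qf nu x / 2)).
Proof.
  intros H. destruct (root_r_spec nu x H) as [R1 R2].
  set (F := fun s => (9 * s ^ 2 + 7 * nu ^ 2) / (24 * s ^ 3)).
  assert (HF : is_derive F (root_r nu x)
     (- (qf nu x / 2) * root_r nu x ^ 2 / (root_r nu x ^ 2 + nu ^ 2))).
  { unfold F, qf. set (s := root_r nu x) in *.
    assert (0 < s ^ 3) by (apply pow_lt; auto). pose proof (pow2_ge_0 nu).
    auto_derive; [simpl in *; lra|]. field. split; nra. }
  assert (D := is_derive_root_r_comp nu x F _ H HF).
  apply (is_derive_ext_loc (fun x => phi_lower nu x + F (root_r nu x))).
  { exists (mkposreal (x - nu) ltac:(lra)). intros y Hy.
    assert (Hy' : Rabs (y - x) < x - nu) by exact Hy. apply Rabs_def2 in Hy'.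
    symmetry. apply phi_tilde_root. lra. }
  replace (root_r nu x / x * (1 - qf nu x / 2)) with (root_r nu x / x + root_r nu x / x *
    (- (qf nu x / 2) * root_r nu x ^ 2 / (root_r nu x ^ 2 + nu ^ 2) * (root_r nu x ^ 2 + nu ^ 2)
      / root_r nu x ^ 2)).
  - apply (is_derive_plus (V := R_NormedModule) (phi_lower nu)); [|exact D].
    apply is_derive_phi_lower; auto.
  - pose proof (pow2_ge_0 nu). field. repeat split; nra.
Qed.

Lemma phi_tilde_increasing nu a b : 0 <= nu -> x_star nu <= a -> a < b ->
  phi_tilde nu a < phi_tilde nu b.
Proof.
  intros Hnu Ha Hab. destruct (x_star_spec nu Hnu) as [X1 X2].
  apply (is_derive_pos_increasing _ (fun x => root_r nu x / x * (1 - qf nu x / 2))); auto.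
  - intros x Hx. apply is_derive_phi_tilde. lra.
  - intros x Hx. destruct (root_r_spec nu x ltac:(lra)) as [R1 _].
    assert (qf nu x < qf nu (x_star nu)) by (apply qf_decreasing; lra).
    apply Rmult_lt_0_compat; [apply Rdiv_lt_0_compat; lra | lra].
Qed.

Lemma z_star_le nu x : 0 <= nu < x -> z_star nu <= phi_tilde nu x.
Proof.
  intros H. destruct (x_star_spec nu ltac:(lra)) as [X1 X2]. unfold z_star.
  destruct (Rtotal_order x (x_star nu)) as [L | [-> | L]]; [|lra|].
  - left. apply Ropp_lt_cancel.
    apply (is_derive_pos_increasing (fun x => - phi_tilde nu x)
      (fun x => - (root_r nu x / x * (1 - qf nu x / 2)))); auto.
    + intros y Hy. apply (is_derive_opp (V := R_NormedModule) (phi_tilde nu)).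
      apply is_derive_phi_tilde. lra.
    + intros y Hy. destruct (root_r_spec nu y ltac:(lra)) as [R1 _].
      assert (qf nu (x_star nu) < qf nu y) by (apply qf_decreasing; lra).
      assert (0 < root_r nu y / y) by (apply Rdiv_lt_0_compat; lra). nra.
  - left. apply phi_tilde_increasing; lra.
Qed.

Lemma x_star_0 : x_star 0 = sqrt (3 / 8).
Proof.
  destruct (x_star_spec 0 (Rle_refl 0)) as [X1 X2].
  destruct (root_r_spec 0 (x_star 0) ltac:(lra)) as [R1 R2]. unfold qf in X2.
  set (s := root_r 0 (x_star 0)) in *. 
  replace ((s ^ 2 + 0 ^ 2) * (3 * s ^ 2 + 7 * 0 ^ 2) / (4 * s ^ 6)) with (3 / (4 * s ^ 2)) in X2
    by (field; lra).
  assert (E : s ^ 2 = 3 / 8).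
  { assert (0 < s ^ 2) by (apply pow_lt; auto).
    assert (3 = 2 * (4 * s ^ 2)) by (rewrite <- X2; field; lra). lra. }
  assert (E2 : x_star 0 ^ 2 = 3 / 8) by lra.
  rewrite <- E2, sqrt_pow2; lra.
Qed.

Lemma z_star_0 : z_star 0 = sqrt (3 / 2) + PI / 4.
Proof.
  unfold z_star. destruct (x_star_spec 0 (Rle_refl 0)) as [X1 _].
  rewrite phi_tilde_root by lra. unfold phi_lower, root_r. rewrite x_star_0.
  assert (P : 0 < sqrt (3 / 8)) by (apply sqrt_lt_R0; lra).
  assert (P2 : sqrt (3 / 8) ^ 2 = 3 / 8) by (apply pow2_sqrt; lra).
  replace (sqrt (3 / 8) ^ 2 - 0 ^ 2) with (sqrt (3 / 8) ^ 2) by ring.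
  rewrite sqrt_pow2 by lra.
  replace (sqrt (3 / 2)) with (2 * sqrt (3 / 8)).
  - clear X1. set (u := sqrt (3 / 8)) in *. clearbody u.
    rewrite P2. replace (u ^ 3) with (3 / 8 * u) by (rewrite <- P2; ring).
    replace ((9 * (3 / 8) + 7 * 0 ^ 2) / (24 * (3 / 8 * u))) with (u ^ 2 / u)
      by (rewrite P2; field; lra).
    field. lra.
  - replace 2 with (sqrt (2 ^ 2)) at 1 by (apply sqrt_pow2; lra).
    rewrite <- sqrt_mult by lra. f_equal. field.
Qed.

Lemma sqrt_3_2_bounds : 1.2247448 < sqrt (3 / 2) < 1.2247449.
Proof.
  pose proof (sqrt_pos (3 / 2)). assert (E : sqrt (3 / 2) * sqrt (3 / 2) = 3 / 2) by (apply sqrt_sqrt; lra).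
  split; nra.
Qed.

Lemma atan_lower t : 0 <= t -> t - t ^ 3 / 3 <= atan t.
Proof.
  intros Ht. destruct (mean_value (fun t => atan t - t + t ^ 3 / 3)
    (fun t => t ^ 4 / (1 + t ^ 2)) 0 t) as [c [_ E]].
  - intros u _. pose proof (one_sqr_pos u). auto_derive; auto. field. simpl in H. lra.
  - rewrite atan_0 in E. pose proof (one_sqr_pos c).
    assert (0 <= c ^ 4 / (1 + c ^ 2) * (t - 0)).
    { apply Rmult_le_pos; [|lra]. apply Rmult_le_pos; [|left; apply Rinv_0_lt_compat; auto].
      replace (c ^ 4) with ((c ^ 2) ^ 2) by ring. apply pow2_ge_0. }
    lra.
Qed.

(** [z_star nu] is a minimum of [phi_tilde nu], so one value of [phi_tilde nu] bounds it:
    at [x^2 - nu^2 = 3/8], the minimizer for [nu = 0], if [nu] is small, and at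
    [x^2 - nu^2 = nu^(4/3)], the scale of the transition region, otherwise. *)
Lemma z_star_le_0 nu : 0 <= nu -> z_star nu <= z_star 0.
Proof.
  intros Hnu. rewrite z_star_0. pose proof sqrt_3_2_bounds as SB. pose proof (pow2_ge_0 nu) as N2.
  destruct (Rle_lt_dec nu (1 / 2)) as [Hs | Hl].
  - set (u := sqrt (3 / 8)). assert (Hu : 0 < u) by (apply sqrt_lt_R0; lra).
    assert (Hu2 : u ^ 2 = 3 / 8) by (apply pow2_sqrt; lra).
    assert (Eu : sqrt (3 / 2) = 2 * u).
    { unfold u. replace 2 with (sqrt (2 ^ 2)) at 2 by (apply sqrt_pow2; lra).
      rewrite <- sqrt_mult by lra. f_equal. field. }
    clearbody u. set (x := sqrt (nu ^ 2 + 3 / 8)). assert (Hx2 : x ^ 2 = nu ^ 2 + 3 / 8) by (apply pow2_sqrt; lra).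
    assert (Hx0 : 0 < x) by (apply sqrt_lt_R0; lra).
    assert (Hx : nu < x) by nra.
    apply Rle_trans with (1 := z_star_le nu x ltac:(lra)).
    assert (Er : root_r nu x = u).
    { unfold root_r. rewrite Hx2. replace (nu ^ 2 + 3 / 8 - nu ^ 2) with (u ^ 2) by lra.
      apply sqrt_pow2. lra. }
    rewrite phi_tilde_root by lra. unfold phi_lower. fold (root_r nu x). rewrite Er.
    destruct (acos_ratio nu x ltac:(lra)) as [_ [S B]]. rewrite Er in S.
    set (t := acos (nu / x)) in *.
    assert (T : u / x <= t) by (rewrite <- S; left; apply sin_lt_x; lra).
    assert (Hxu : x <= 4 / 5) by (destruct (Rle_lt_dec x (4 / 5)); auto; exfalso; nra).
    assert (Hu1 : 61 / 100 <= u) by (destruct (Rle_lt_dec (61 / 100) u); auto; exfalso; nra).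
    assert (T2 : 7 / 10 <= t).
    { apply Rle_trans with (2 := T). apply le_div; lra. }
    replace (u ^ 3) with (u * (3 / 8)) by (rewrite <- Hu2; ring).
    rewrite Hu2, Eu.
    replace ((9 * (3 / 8) + 7 * nu ^ 2) / (24 * (u * (3 / 8))))
      with (u + (7 / 9) * nu ^ 2 / u).
    2:{ apply Rmult_eq_reg_r with u; [|lra].
        replace ((u + 7 / 9 * nu ^ 2 / u) * u) with (u ^ 2 + 7 / 9 * nu ^ 2) by (field; lra).
        rewrite Hu2. field. lra. }
    assert (K : 7 / 9 * nu ^ 2 / u <= nu * t).
    { apply div_le; auto. assert (42 / 100 <= t * u) by nra. nra. }
    lra.
  - set (a := Rpower nu (/ 3)). assert (Ha : 0 < a) by apply exp_pos.
    assert (Ha3 : a ^ 3 = nu).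
    { unfold a. rewrite <- Rpower_pow by apply exp_pos. rewrite Rpower_mult.
      replace (/ 3 * INR 3) with 1 by (simpl; field). apply Rpower_1. lra. }
    set (u := a ^ 2). assert (Hu : 0 < u) by (unfold u; nra).
    assert (Hu3 : u ^ 3 = nu ^ 2) by (unfold u; rewrite <- Ha3; ring).
    assert (Hub : 6254 / 10000 <= u).
    { destruct (Rle_lt_dec (6254 / 10000) u) as [|L]; auto. exfalso.
      assert (u ^ 3 < (6254 / 10000) ^ 3) by (simpl; nra). nra. }
    set (x := sqrt (nu ^ 2 + u ^ 2)). pose proof (pow2_ge_0 u).
    assert (Hx2 : x ^ 2 = nu ^ 2 + u ^ 2) by (apply pow2_sqrt; lra).
    assert (Hx0 : 0 < x) by (apply sqrt_lt_R0; nra).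
    assert (Hx : nu < x) by nra.
    apply Rle_trans with (1 := z_star_le nu x ltac:(lra)).
    assert (Er : root_r nu x = u).
    { unfold root_r. rewrite Hx2. replace (nu ^ 2 + u ^ 2 - nu ^ 2) with (u ^ 2) by ring.
      apply sqrt_pow2. lra. }
    rewrite phi_tilde_root by lra. unfold phi_lower. fold (root_r nu x). rewrite Er.
    destruct (acos_ratio nu x ltac:(lra)) as [C [S B]]. rewrite Er in S.
    set (t := acos (nu / x)) in *.
    assert (Ct : 0 < cos t) by (rewrite C; apply Rdiv_lt_0_compat; lra).
    assert (Et : t = atan (u / nu)).
    { assert (t < PI / 2).
      { destruct (Rle_lt_or_eq_dec _ _ (proj2 B)) as [|E]; auto. rewrite E, cos_PI2 in Ct. lra. }
      rewrite <- (atan_tan t) by lra. f_equal. unfold tan. rewrite S, C. field. lra. }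
    assert (Hun : 0 < u / nu) by (apply Rdiv_lt_0_compat; lra).
    pose proof (atan_lower (u / nu) ltac:(lra)) as L. rewrite <- Et in L.
    assert (K1 : u - nu * t <= 1 / 3).
    { assert (nu * (u / nu - (u / nu) ^ 3 / 3) <= nu * t) by (apply Rmult_le_compat_l; lra).
      replace (nu * (u / nu - (u / nu) ^ 3 / 3)) with (u - u ^ 3 / (3 * nu ^ 2)) in H0
        by (field; lra).
      rewrite Hu3 in H0. replace (nu ^ 2 / (3 * nu ^ 2)) with (1 / 3) in H0 by (field; lra). lra. }
    assert (K2 : (9 * u ^ 2 + 7 * nu ^ 2) / (24 * u ^ 3) = 3 / 8 / u + 7 / 24)
      by (rewrite <- Hu3; field; lra).
    assert (K3 : 3 / 8 / u <= 5997 / 10000).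
    { apply div_le; lra. }
    rewrite K2. lra.
Qed.

(** * Liouville's normal form of the equation for the derivative *)

(** [liouville_V] satisfies [v'' + (1 - qf) v = 0] with respect to the variable
    [phi_lower], and [liouville_Z] is its derivative with respect to that variable. *)
Definition liouville_V (nu : R) (f1 : R -> R) (x : R) : R := x * f1 x / sqrt (root_r nu x).
Definition liouville_Z (nu : R) (f f1 : R -> R) (x : R) : R :=
  - sqrt (root_r nu x) * f x - x ^ 3 * f1 x / (2 * sqrt (root_r nu x) ^ 7).

Lemma fourth_root_spec nu x : 0 <= nu < x ->
  0 < sqrt (root_r nu x) /\ sqrt (root_r nu x) ^ 2 = root_r nu x /\
  is_derive (fun x => sqrt (root_r nu x)) x (x / (2 * sqrt (root_r nu x) ^ 3)).
Proof.
  intros H. destruct (root_r_spec nu x H) as [R1 R2].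
  assert (C : 0 < sqrt (root_r nu x)) by (apply sqrt_lt_R0; auto).
  assert (C2 : sqrt (root_r nu x) ^ 2 = root_r nu x) by (apply pow2_sqrt; lra).
  split; [auto|]. split; [auto|].
  assert (D := is_derive_comp (V := R_NormedModule) sqrt (root_r nu) x _ _
    (is_derive_sqrt (fun t => t) (root_r nu x) 1 (is_derive_id _) R1) (is_derive_root_r nu x H)).
  replace (x / (2 * sqrt (root_r nu x) ^ 3)) with
    (scal (x / root_r nu x) (1 / (2 * sqrt (root_r nu x)))); [exact D|].
  unfold scal; simpl; unfold mult; simpl. rewrite <- C2 at 1. field. lra.
Qed.

Lemma liouville_system nu f f1 x : 0 <= nu < x -> bessel_sol nu f f1 ->
  is_derive (liouville_V nu f1) x (root_r nu x / x * liouville_Z nu f f1 x) /\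
  is_derive (liouville_Z nu f f1) x
    (- (root_r nu x / x) * (1 + - qf nu x) * liouville_V nu f1 x).
Proof.
  intros H S. destruct (root_r_spec nu x H) as [R1 R2].
  destruct (fourth_root_spec nu x H) as [C1 [C2 C3]].
  destruct (S x ltac:(lra)) as [F1 F2].
  set (cc := fun x => sqrt (root_r nu x)) in *. 
  assert (Ec : ex_derive cc x) by (eexists; exact C3).
  assert (Ef : ex_derive f x) by (eexists; exact F1).
  assert (Ef1 : ex_derive f1 x) by (eexists; exact F2).
  assert (N : nu ^ 2 = x ^ 2 - cc x ^ 4).
  { replace (cc x ^ 4) with ((cc x ^ 2) ^ 2) by ring. unfold cc. rewrite C2. lra. }
  assert (HC : 0 < cc x) by exact C1. assert (HC2 : root_r nu x = cc x ^ 2) by (symmetry; exact C2).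
  assert (P7 : 0 < cc x ^ 7) by (apply pow_lt; auto).
  split.
  - apply (is_derive_ext (fun x => x * f1 x / cc x)); [reflexivity|].
    auto_derive; [repeat split; auto; lra|].
    replace (Derive (fun x => f1 x) x) with (- (f1 x / x) - (1 - nu ^ 2 / x ^ 2) * f x)
      by (symmetry; apply is_derive_unique, F2).
    replace (Derive (fun x => cc x) x) with (x / (2 * cc x ^ 3))
      by (symmetry; apply is_derive_unique, C3).
    unfold liouville_Z. fold (cc x). rewrite N, HC2. field. lra.
  - apply (is_derive_ext (fun x => - cc x * f x - x ^ 3 * f1 x / (2 * cc x ^ 7))); [reflexivity|].
    auto_derive; [repeat split; auto; simpl in *; lra|].
    replace (Derive (fun x => f1 x) x) with (- (f1 x / x) - (1 - nu ^ 2 / x ^ 2) * f x)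
      by (symmetry; apply is_derive_unique, F2).
    replace (Derive (fun x => f x) x) with (f1 x) by (symmetry; apply is_derive_unique, F1).
    replace (Derive (fun x => cc x) x) with (x / (2 * cc x ^ 3))
      by (symmetry; apply is_derive_unique, C3).
    unfold liouville_V, qf. fold (cc x). rewrite N, HC2. field. lra.
Qed.

Lemma liouville_wronskian nu f f1 g g1 x : 0 <= nu < x ->
  liouville_V nu f1 x * liouville_Z nu g g1 x - liouville_V nu g1 x * liouville_Z nu f f1 x =
  x * (f x * g1 x - f1 x * g x).
Proof.
  intros H. destruct (fourth_root_spec nu x H) as [C1 _]. unfold liouville_V, liouville_Z.
  field. lra.
Qed.

Lemma Rabs_cos_diff a b : Rabs (cos a - cos b) <= Rabs (a - b).
Proof.
  rewrite <- (Rmult_1_l (Rabs (a - b))).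
  apply mean_value_bound with (df := fun t => - sin t).
  - intros t _. auto_derive; auto. ring.
  - intros t _. rewrite Rabs_Ropp. apply Rabs_sin_le.
Qed.

Lemma Rabs_sin_diff a b : Rabs (sin a - sin b) <= Rabs (a - b).
Proof.
  rewrite <- (Rmult_1_l (Rabs (a - b))).
  apply mean_value_bound with (df := fun t => cos t).
  - intros t _. auto_derive; auto. ring.
  - intros t _. apply Rabs_cos_le.
Qed.

Lemma vanish_le f g M : vanish f -> (forall x, M < x -> Rabs (g x) <= Rabs (f x)) -> vanish g.
Proof.
  intros Hf H. rewrite vanish_spec in *. intros eps. destruct (Hf eps) as [M' HM'].
  exists (Rmax M M'). intros x Hx.
  apply Rle_lt_trans with (Rabs (f x)).
  - apply H. eapply Rle_lt_trans; [apply Rmax_l | exact Hx].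
  - apply HM'. eapply Rle_lt_trans; [apply Rmax_r | exact Hx].
Qed.

Lemma quarter_ratio nu x : 0 <= nu -> 2 * nu + 1 <= x ->
  1 <= sqrt x / sqrt (root_r nu x) <= 2 /\
  sqrt x / sqrt (root_r nu x) - 1 <= 2 * nu ^ 2 / x.
Proof.
  intros Hnu Hx. destruct (root_r_spec nu x ltac:(lra)) as [R1 R2].
  destruct (fourth_root_spec nu x ltac:(lra)) as [C1 [C2 _]].
  assert (Sx : 0 < sqrt x) by (apply sqrt_lt_R0; lra).
  assert (Sx2 : sqrt x ^ 2 = x) by (apply pow2_sqrt; lra).
  set (g := sqrt x / sqrt (root_r nu x)).
  assert (Hg : 0 < g) by (apply Rdiv_lt_0_compat; auto).
  pose proof (pow2_ge_0 nu) as N0.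
  assert (Hr : x ^ 2 - nu ^ 2 >= x ^ 2 / 2) by nra.
  assert (G4 : g ^ 4 = 1 + nu ^ 2 / (x ^ 2 - nu ^ 2)).
  { unfold g. replace ((sqrt x / sqrt (root_r nu x)) ^ 4) with
      ((sqrt x ^ 2) ^ 2 / (sqrt (root_r nu x) ^ 2) ^ 2) by (field; lra).
    rewrite Sx2, C2, R2. field. nra. }
  assert (Hq0 : 0 <= nu ^ 2 / (x ^ 2 - nu ^ 2)).
  { apply Rmult_le_pos; auto. left. apply Rinv_0_lt_compat. nra. }
  assert (Hq : nu ^ 2 / (x ^ 2 - nu ^ 2) <= 2 * nu ^ 2 / x).
  { apply div_le; [nra|].
    replace (2 * nu ^ 2 / x * (x ^ 2 - nu ^ 2)) with (nu ^ 2 * (2 * (x ^ 2 - nu ^ 2) / x))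
      by (field; lra).
    rewrite <- (Rmult_1_r (nu ^ 2)) at 1. apply Rmult_le_compat_l; auto.
    apply le_div; nra. }
  assert (Hq1 : nu ^ 2 / (x ^ 2 - nu ^ 2) <= 1) by (apply div_le; nra).
  assert (G1 : 1 <= g).
  { destruct (Rle_lt_dec 1 g) as [|L]; auto. exfalso.
    assert (g ^ 2 < 1) by nra. assert (g ^ 4 < 1) by (replace (g ^ 4) with (g ^ 2 * g ^ 2) by ring; nra).
    lra. }
  assert (G2 : g <= g ^ 4).
  { assert (1 <= g ^ 3) by (apply pow_R1_Rle; auto).
    replace (g ^ 4) with (g * g ^ 3) by ring. nra. }
  split; [split|]; lra.
Qed.

Lemma liouville_asym nu f f1 A al : 0 <= nu -> bessel_asym f f1 A al ->
  vanish (fun x => liouville_V nu f1 x + A * sin (x - al)) /\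
  vanish (fun x => liouville_Z nu f f1 x + A * cos (x - al)).
Proof.
  intros Hnu As. destruct (asym_bounded _ _ _ _ As) as [M [_ B1]]. destruct As as [F0 F1].
  set (g := fun x => sqrt x / sqrt (root_r nu x)).
  set (X0 := 2 * nu + 1).
  assert (Hg : forall x, X0 < x -> 1 <= g x <= 2 /\ g x - 1 <= 2 * nu ^ 2 / x)
    by (intros x Hx; apply quarter_ratio; unfold X0 in Hx; lra).
  assert (Vg : vanish (fun x => g x - 1)).
  { apply (vanish_le (fun x => (2 * nu ^ 2) / x) _ X0); [apply vanish_inv|].
    intros x Hx. destruct (Hg x Hx) as [G1 G2]. pose proof (Rle_abs (2 * nu ^ 2 / x)).
    rewrite Rabs_pos_eq by lra. lra. }
  assert (Vig : vanish (fun x => / g x - 1)).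
  { apply (vanish_le (fun x => g x - 1) _ X0); auto.
    intros x Hx. destruct (Hg x Hx) as [G1 G2].
    rewrite (Rabs_pos_eq (g x - 1)) by lra. rewrite Rabs_minus_sym.
    assert (Hi : 0 < / g x <= 1).
    { split; [apply Rinv_0_lt_compat; lra|]. rewrite <- Rinv_1. apply Rinv_le_contravar; lra. }
    rewrite Rabs_pos_eq by lra.
    replace (1 - / g x) with ((g x - 1) * / g x) by (field; lra). nra. }
  assert (Base : forall x, X0 < x -> 0 < sqrt x /\ sqrt x ^ 2 = x /\
     0 < sqrt (root_r nu x)).
  { intros x Hx. unfold X0 in Hx. destruct (fourth_root_spec nu x ltac:(lra)) as [C1 _].
    split; [apply sqrt_lt_R0; lra|]. split; [apply pow2_sqrt; lra | auto]. }
  split.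
  - apply (vanish_ext (fun x => (sqrt x * f1 x + A * sin (x - al)) * g x
      + (g x - 1) * (- A * sin (x - al))) _ X0).
    + intros x Hx. destruct (Base x Hx) as [S1 [S2 C1]]. unfold g, liouville_V.
      replace (x * f1 x) with (sqrt x ^ 2 * f1 x) by (rewrite S2; ring). field. lra.
    + apply vanish_plus.
      * apply vanish_bounded with 2 X0; auto. intros x Hx. destruct (Hg x Hx).
        rewrite Rabs_pos_eq; lra.
      * apply vanish_bounded with (Rabs A) 0; auto. intros x _.
        rewrite Rabs_mult, Rabs_Ropp. pose proof (Rabs_sin_le (x - al)).
        pose proof (Rabs_pos A). nra.
  - apply (vanish_ext (fun x => ((sqrt x * f x - A * cos (x - al)) * - / g x
      + (/ g x - 1) * (- A * cos (x - al)))
      + (1 / x) * (- (g x ^ 7 / 2) * (sqrt x * f1 x))) _ X0).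
    + intros x Hx. destruct (Base x Hx) as [S1 [S2 C1]]. unfold g, liouville_Z.
      set (w := sqrt x) in *. replace (1 / x) with (1 / w ^ 2) by (rewrite S2; reflexivity).
      replace (x ^ 3) with (w ^ 6) by (rewrite <- S2; ring). field. lra.
    + apply vanish_plus; [apply vanish_plus|].
      * apply vanish_bounded with 1 X0; auto. intros x Hx. destruct (Hg x Hx) as [G1 _].
        rewrite Rabs_Ropp, Rabs_pos_eq by (left; apply Rinv_0_lt_compat; lra).
        rewrite <- Rinv_1. apply Rinv_le_contravar; lra.
      * apply vanish_bounded with (Rabs A) 0; auto. intros x _.
        rewrite Rabs_mult, Rabs_Ropp. pose proof (Rabs_cos_le (x - al)).
        pose proof (Rabs_pos A). nra.
      * apply vanish_bounded with (2 ^ 7 / 2 * (1 + Rabs A)) (Rmax X0 M); [apply vanish_inv|].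
        intros x Hx.
        assert (H1 : X0 < x) by (eapply Rle_lt_trans; [apply Rmax_l | exact Hx]).
        assert (H2 : M < x) by (eapply Rle_lt_trans; [apply Rmax_r | exact Hx]).
        destruct (Hg x H1) as [G1 _]. rewrite Rabs_mult, Rabs_Ropp.
        assert (0 <= g x ^ 7 <= 2 ^ 7) by (split; [apply pow_le; lra | apply pow_incr; lra]).
        rewrite (Rabs_pos_eq (g x ^ 7 / 2)) by lra.
        apply Rmult_le_compat; auto using Rabs_pos; lra.
Qed.

Lemma liouville_asym_JY nu : 0 <= nu ->
  vanish (fun x => liouville_V nu (bessel_J1 nu) x - bessel_amp * cos (phi_lower nu x)) /\
  vanish (fun x => liouville_Z nu (bessel_J nu) (bessel_J1 nu) x
     + bessel_amp * sin (phi_lower nu x)) /\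
  vanish (fun x => liouville_V nu (bessel_Y1 nu) x - bessel_amp * sin (phi_lower nu x)) /\
  vanish (fun x => liouville_Z nu (bessel_Y nu) (bessel_Y1 nu) x
     - bessel_amp * cos (phi_lower nu x)).
Proof.
  intros Hnu. destruct (liouville_asym nu _ _ _ _ Hnu (bessel_asym_J nu)) as [VJ ZJ].
  destruct (liouville_asym nu _ _ _ _ Hnu (bessel_asym_Y nu Hnu)) as [VY ZY].
  assert (P := vanish_phi_lower nu Hnu).
  set (ti := fun x => x - nu * (PI / 2) + PI / 4) in *.
  assert (Pc : vanish (fun x => bessel_amp * (cos (phi_lower nu x) - cos (ti x)))).
  { apply vanish_scal. apply (vanish_le _ _ 0 P). intros. apply Rabs_cos_diff. }
  assert (Ps : vanish (fun x => bessel_amp * (sin (phi_lower nu x) - sin (ti x)))).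
  { apply vanish_scal. apply (vanish_le _ _ 0 P). intros. apply Rabs_sin_diff. }
  assert (E1 : forall x, sin (x - (nu * (PI / 2) + PI / 4)) = - cos (ti x) /\
     cos (x - (nu * (PI / 2) + PI / 4)) = sin (ti x)).
  { intros x. replace (x - (nu * (PI / 2) + PI / 4)) with (ti x - PI / 2) by (unfold ti; field).
    rewrite sin_minus, cos_minus, sin_PI2, cos_PI2. split; ring. }
  assert (E2 : forall x, sin (x - (nu * (PI / 2) + PI / 4 + PI / 2)) = - sin (ti x) /\
     cos (x - (nu * (PI / 2) + PI / 4 + PI / 2)) = - cos (ti x)).
  { intros x. replace (x - (nu * (PI / 2) + PI / 4 + PI / 2)) with (ti x - PI) by (unfold ti; field).
    rewrite sin_minus, cos_minus, sin_PI, cos_PI. split; ring. }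
  repeat split.
  - refine (vanish_ext _ _ 0 _ (vanish_plus _ _ VJ (vanish_scal (-1) _ Pc))).
    intros x _. rewrite (proj1 (E1 x)). ring.
  - refine (vanish_ext _ _ 0 _ (vanish_plus _ _ ZJ Ps)).
    intros x _. rewrite (proj2 (E1 x)). ring.
  - refine (vanish_ext _ _ 0 _ (vanish_plus _ _ VY (vanish_scal (-1) _ Ps))).
    intros x _. rewrite (proj1 (E2 x)). ring.
  - refine (vanish_ext _ _ 0 _ (vanish_plus _ _ ZY (vanish_scal (-1) _ Pc))).
    intros x _. rewrite (proj2 (E2 x)). ring.
Qed.

(** * The phase near the origin *)

Lemma tends0_near f l : 0 < l -> tends0 f l ->
  exists d, 0 < d /\ forall x, 0 < x <= d -> l / 2 < f x < 2 * l.
Proof.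
  intros Hl H. assert (Hl2 : 0 < l / 2) by lra.
  destruct (proj1 (filterlim_locally f l) H (mkposreal _ Hl2)) as [d Hd].
  exists (d / 2). pose proof (cond_pos d). split; [lra|].
  intros x Hx. assert (B : Rabs (f x - l) < l / 2).
  { apply Hd; [|lra]. change (Rabs (x - 0) < d). rewrite Rminus_0_r, Rabs_pos_eq; lra. }
  apply Rabs_def2 in B. lra.
Qed.

Lemma J_0coef_pos nu : 0 <= nu -> 0 < J_0coef nu.
Proof.
  intros H. unfold J_0coef. rewrite inv_Gamma_pos_eq by lra.
  apply Rmult_lt_0_compat; [apply exp_pos|]. apply Rinv_0_lt_compat, Gam_pos. lra.
Qed.

Lemma Rpower_small x p : 0 < x <= 1 -> 0 <= p -> 0 < Rpower x p <= 1.
Proof.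
  intros Hx Hp. split; [apply exp_pos|]. unfold Rpower. rewrite <- exp_0. apply exp_le_exp.
  assert (ln x <= 0) by (rewrite <- ln_1; apply ln_le; lra). nra.
Qed.

Lemma bessel_J1_near_0 nu : 0 < nu -> exists d C, 0 < d <= 1 /\ 0 < C /\
  forall x, 0 < x <= d -> 0 < bessel_J nu x /\ 0 < x * bessel_J1 nu x <= C.
Proof.
  intros Hnu. pose proof (J_0coef_pos nu ltac:(lra)) as HJ.
  destruct (tends0_near _ _ HJ (tends0_J nu)) as [d1 [Hd1 B1]].
  assert (HJ1 : 0 < nu * J_0coef nu) by (apply Rmult_lt_0_compat; auto).
  destruct (tends0_near _ _ HJ1 (tends0_J1 nu)) as [d2 [Hd2 B2]].
  exists (Rmin 1 (Rmin d1 d2)), (2 * (nu * J_0coef nu)).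
  split; [split; [repeat apply Rmin_pos; lra | apply Rmin_l]|]. split; [lra|].
  intros x [Hx0 Hx].
  assert (x <= 1) by (eapply Rle_trans; [exact Hx | apply Rmin_l]).
  assert (x <= d1) by (eapply Rle_trans; [exact Hx | eapply Rle_trans; [apply Rmin_r | apply Rmin_l]]).
  assert (x <= d2) by (eapply Rle_trans; [exact Hx | eapply Rle_trans; [apply Rmin_r | apply Rmin_r]]).
  specialize (B1 x ltac:(lra)). specialize (B2 x ltac:(lra)).
  assert (P1 : 0 < Rpower x (- nu)) by apply exp_pos.
  destruct (Rpower_small x nu ltac:(lra) ltac:(lra)) as [P2 P3].
  split.
  - apply Rmult_lt_reg_l with (Rpower x (- nu)); auto. lra.
  - replace (x * bessel_J1 nu x) with (Rpower x nu * (Rpower x (1 - nu) * bessel_J1 nu x)).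
    + split; [apply Rmult_lt_0_compat; lra|]. nra.
    + rewrite <- Rmult_assoc, <- Rpower_plus by lra. replace (nu + (1 - nu)) with 1 by ring.
      rewrite Rpower_1; lra.
Qed.

(** [x J J'] increases on [(0, nu]], so that neither factor can vanish there. *)
Lemma bessel_J1_pos nu x : 0 < nu -> 0 < x <= nu -> 0 < bessel_J1 nu x.
Proof.
  intros Hnu Hx. destruct (bessel_J1_near_0 nu Hnu) as [d [C [Hd [_ B]]]].
  set (J := bessel_J nu) in *. set (J1 := bessel_J1 nu) in *.
  assert (SJ : bessel_sol nu J J1) by apply bessel_sol_J.
  assert (NZ : forall y, 0 < y <= nu -> J1 y <> 0).
  { intros y Hy E. destruct (Rle_lt_dec y d) as [L | L].
    - destruct (B y ltac:(lra)) as [_ B2]. rewrite E in B2. lra.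
    - destruct (mean_value (fun x => x * J x * J1 x)
        (fun x => x * J1 x ^ 2 + (nu ^ 2 - x ^ 2) / x * J x ^ 2) d y) as [c [Hc Ec]].
      + intros t Ht. rewrite Rmin_left in Ht by lra. destruct (SJ t ltac:(lra)) as [F1 F2].
        assert (E1 : ex_derive J t) by (eexists; exact F1).
        assert (E2 : ex_derive J1 t) by (eexists; exact F2).
        auto_derive; [auto|].
        replace (Derive (fun x => J x) t) with (J1 t) by (symmetry; apply is_derive_unique, F1).
        replace (Derive (fun x => J1 x) t) with (- (J1 t / t) - (1 - nu ^ 2 / t ^ 2) * J t)
          by (symmetry; apply is_derive_unique, F2).
        field. lra.
      + rewrite Rmin_left, Rmax_right in Hc by lra. destruct (B d ltac:(lra)) as [B1 [B2 _]].
        rewrite E, Rmult_0_r in Ec.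
        assert (0 <= (c * J1 c ^ 2 + (nu ^ 2 - c ^ 2) / c * J c ^ 2) * (y - d)).
        { apply Rmult_le_pos; [|lra]. apply Rplus_le_le_0_compat.
          - apply Rmult_le_pos; [lra | apply pow2_ge_0].
          - apply Rmult_le_pos; [|apply pow2_ge_0].
            apply Rmult_le_pos; [nra | left; apply Rinv_0_lt_compat; lra]. }
        assert (0 < d * J d * J1 d).
        { replace (d * J d * J1 d) with (J d * (d * J1 d)) by ring.
          apply Rmult_lt_0_compat; auto. }
        lra. }
  destruct (Rle_lt_dec x d) as [L | L].
  - destruct (B x ltac:(lra)) as [_ [B2 _]]. apply Rmult_lt_reg_l with x; lra.
  - destruct (B d ltac:(lra)) as [_ [B2 _]].
    assert (0 < J1 d) by (apply Rmult_lt_reg_l with d; lra).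
    destruct (Rlt_le_dec 0 (J1 x)) as [|Hn]; auto. exfalso.
    destruct (ivt (fun x => - J1 x) d x 0) as [c [Hc Ec]]; [lra| |lra|].
    + intros t Ht. apply (continuous_opp (V := R_NormedModule) J1).
      apply (ex_derive_continuous (V := R_NormedModule)). eexists. apply SJ. lra.
    + apply (NZ c); lra.
Qed.

Lemma bessel_J1_order_0 x : bessel_J1 0 x = - bessel_J (0 + 1) x.
Proof. unfold bessel_J1. unfold Rdiv. ring. Qed.

Lemma bessel_J1_near_0_order_0 : exists d C, 0 < d <= 1 /\ 0 < C /\
  forall x, 0 < x <= d -> bessel_J1 0 x < 0 /\ - C <= bessel_J1 0 x.
Proof.
  pose proof (J_0coef_pos (0 + 1) ltac:(lra)) as HJ.
  destruct (tends0_near _ _ HJ (tends0_J (0 + 1))) as [d1 [Hd1 B1]].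
  exists (Rmin 1 d1), (2 * J_0coef (0 + 1)).
  split; [split; [apply Rmin_pos; lra | apply Rmin_l]|]. split; [lra|].
  intros x [Hx0 Hx].
  assert (x <= 1) by (eapply Rle_trans; [exact Hx | apply Rmin_l]).
  assert (x <= d1) by (eapply Rle_trans; [exact Hx | apply Rmin_r]).
  specialize (B1 x ltac:(lra)). rewrite bessel_J1_order_0.
  assert (E : Rpower x (- (0 + 1)) = / x) by (rewrite Rplus_0_l, Rpower_Ropp, Rpower_1; auto).
  rewrite E in B1.
  assert (Hi : 0 < / x) by (apply Rinv_0_lt_compat; auto).
  set (b := bessel_J (0 + 1) x) in *.
  assert (Eb : b = x * (/ x * b)) by (field; lra).
  set (w := / x * b) in *. rewrite Eb. split; nra.
Qed.

Definition mod2 (nu x : R) : R := bessel_J1 nu x ^ 2 + bessel_Y1 nu x ^ 2.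

Lemma mod2_pos nu x : 0 <= nu -> 0 < x -> 0 < mod2 nu x.
Proof.
  intros Hnu Hx. pose proof (bessel_wronskian nu x Hnu Hx) as W. pose proof bessel_amp_pos.
  unfold mod2. destruct (Req_dec (bessel_J1 nu x) 0) as [E | E].
  - destruct (Req_dec (bessel_Y1 nu x) 0) as [E' | E'].
    + exfalso. rewrite E, E' in W. replace (x * (bessel_J nu x * 0 - 0 * bessel_Y nu x)) with 0 in W by ring.
      nra.
    + pose proof (pow2_ge_0 (bessel_J1 nu x)). assert (0 < bessel_Y1 nu x ^ 2) by nra. lra.
  - pose proof (pow2_ge_0 (bessel_Y1 nu x)). assert (0 < bessel_J1 nu x ^ 2) by nra. lra.
Qed.

Definition phase_rate (nu x : R) : R :=
  (1 - nu ^ 2 / x ^ 2) * (bessel_amp * bessel_amp) / (x * mod2 nu x).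

(** The angular momentum of [(J', Y')], by Bessel's equation and the Wronskian. *)
Lemma phase_rate_spec nu x : 0 <= nu -> 0 < x ->
  phase_rate nu x * mod2 nu x =
  bessel_J1 nu x * (- (bessel_Y1 nu x / x) - (1 - nu ^ 2 / x ^ 2) * bessel_Y nu x)
  - bessel_Y1 nu x * (- (bessel_J1 nu x / x) - (1 - nu ^ 2 / x ^ 2) * bessel_J nu x).
Proof.
  intros Hnu Hx. pose proof (mod2_pos nu x Hnu Hx). unfold phase_rate.
  rewrite <- (bessel_wronskian nu x Hnu Hx). field. lra.
Qed.

(** The tangent of the phase; near [0] its derivative is not integrable. *)
Lemma is_derive_ratio nu x : 0 <= nu -> 0 < x -> bessel_J1 nu x <> 0 ->
  is_derive (fun x => bessel_Y1 nu x / bessel_J1 nu x) x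
    ((x ^ 2 - nu ^ 2) * (bessel_amp * bessel_amp) / (x * (x * bessel_J1 nu x) ^ 2)).
Proof.
  intros Hnu Hx HJ. destruct (bessel_sol_J nu x Hx) as [_ F2].
  destruct (bessel_Y_sol nu Hnu x Hx) as [_ G2].
  set (J1 := bessel_J1 nu) in *. set (Y1 := bessel_Y1 nu) in *.
  assert (E1 : ex_derive J1 x) by (eexists; exact F2).
  assert (E2 : ex_derive Y1 x) by (eexists; exact G2).
  auto_derive; [auto|].
  replace (Derive (fun x => J1 x) x) with (- (J1 x / x) - (1 - nu ^ 2 / x ^ 2) * bessel_J nu x)
    by (symmetry; apply is_derive_unique, F2).
  replace (Derive (fun x => Y1 x) x) with (- (Y1 x / x) - (1 - nu ^ 2 / x ^ 2) * bessel_Y nu x)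
    by (symmetry; apply is_derive_unique, G2).
  rewrite <- (bessel_wronskian nu x Hnu Hx). fold J1 Y1. field. split; auto. lra.
Qed.

(** [T + k ln] is nonincreasing. *)
Lemma log_divergence (T dT : R -> R) d k : 0 < d -> 0 < k ->
  (forall x, 0 < x <= d -> is_derive T x (dT x)) ->
  (forall x, 0 < x <= d -> dT x <= - (k / x)) ->
  forall K, exists d', 0 < d' /\ forall x, 0 < x <= d' -> K < T x.
Proof.
  intros Hd Hk DT HT K.
  assert (A : forall x, 0 < x <= d -> T d + k * ln d <= T x + k * ln x).
  { intros x Hx. destruct (mean_value (fun x => T x + k * ln x) (fun x => dT x + k / x) x d)
      as [c [Hc E]].
    - intros t Ht. rewrite Rmin_left, Rmax_right in Ht by lra.
      apply (is_derive_plus (V := R_NormedModule) T); [apply DT; lra|].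
      auto_derive; [lra|]. field. lra.
    - rewrite Rmin_left, Rmax_right in Hc by lra. specialize (HT c ltac:(lra)).
      assert (0 <= - (dT c + k / c) * (d - x)) by (apply Rmult_le_pos; lra). lra. }
  set (L := (T d + k * ln d - K - 1) / k).
  exists (Rmin d (exp L)). split; [apply Rmin_pos; auto; apply exp_pos|].
  intros x [Hx0 Hx].
  assert (x <= d) by (eapply Rle_trans; [exact Hx | apply Rmin_l]).
  assert (Hxe : x <= exp L) by (eapply Rle_trans; [exact Hx | apply Rmin_r]).
  specialize (A x ltac:(lra)).
  assert (ln x <= L) by (rewrite <- (ln_exp L); apply ln_le; auto).
  assert (k * ln x <= k * L) by (apply Rmult_le_compat_l; lra).
  replace (k * L) with (T d + k * ln d - K - 1) in H1 by (unfold L; field; lra). lra.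
Qed.

Lemma tends0_atan_infty (T : R -> R) :
  (forall K, exists d, 0 < d /\ forall x, 0 < x <= d -> K < T x) ->
  tends0 (fun x => atan (T x)) (PI / 2).
Proof.
  intros H. apply filterlim_locally. intros eps. pose proof (cond_pos eps).
  assert (Hi : 0 < / eps) by (apply Rinv_0_lt_compat; auto).
  destruct (H (/ eps)) as [d [Hd B]]. exists (mkposreal d Hd). intros x Hx Hx0.
  assert (Hx' : Rabs (x - 0) < d) by exact Hx. rewrite Rminus_0_r, Rabs_pos_eq in Hx' by lra.
  specialize (B x ltac:(lra)). change (Rabs (atan (T x) - PI / 2) < eps).
  rewrite <- (Rinv_inv (T x)). rewrite atan_inv by (apply Rinv_0_lt_compat; lra).
  replace (PI / 2 - atan (/ T x) - PI / 2) with (- atan (/ T x)) by ring.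
  rewrite Rabs_Ropp. eapply Rle_lt_trans; [apply atan_abs_le|].
  rewrite Rabs_pos_eq by (left; apply Rinv_0_lt_compat; lra).
  rewrite <- (Rinv_inv eps). apply Rinv_lt_contravar; nra.
Qed.

(** Leaving the half-plane would make the cosine vanish on the way. *)
Lemma half_plane_angle (f : R -> R) b : 0 < b -> (forall x, 0 < x <= b -> continuous f x) ->
  (forall x, 0 < x <= b -> 0 < cos (f x)) -> Rabs (f b) < PI / 2 ->
  forall x, 0 < x <= b -> Rabs (f x) < PI / 2.
Proof.
  intros Hb Hc Hcos H0 x Hx. destruct (Rlt_le_dec (Rabs (f x)) (PI / 2)) as [|L]; auto. exfalso.
  destruct (ivt (fun y => - Rabs (f y)) x b (- (PI / 2))) as [c [Hc1 Hc2]]; [lra| |lra|].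
  - intros t Ht. apply (continuous_opp (V := R_NormedModule) (fun y => Rabs (f y))).
    apply (continuous_comp f Rabs); [apply Hc; lra | apply continuous_Rabs].
  - assert (Hc3 : Rabs (f c) = PI / 2) by lra.
    specialize (Hcos c ltac:(lra)).
    assert (cos (f c) = cos (Rabs (f c))).
    { unfold Rabs. destruct (Rcase_abs (f c)); [symmetry; apply cos_neg | reflexivity]. }
    rewrite H, Hc3, cos_PI2 in Hcos. lra.
Qed.

(** One choice of data for all orders: [s] is the sign of [J'] near the origin and [sh]
    the direction of the half-plane that contains [(J', Y')] there. *)
Lemma phase_origin_data nu : 0 <= nu -> exists b s sh,
  0 < b /\ (0 < nu -> b = nu /\ sh = 0) /\ (nu = 0 -> sh = PI) /\
  cos sh = s /\ sin sh = 0 /\ s * s = 1 /\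
  (forall x, 0 < x <= b -> 0 < s * bessel_J1 nu x) /\
  tends0 (fun x => sh + atan (bessel_Y1 nu x / bessel_J1 nu x)) (PI / 2).
Proof.
  intros Hnu. pose proof bessel_amp_pos as HA.
  destruct (Rle_lt_or_eq_dec 0 nu Hnu) as [Hp | <-].
  - exists nu, 1, 0. rewrite cos_0, sin_0. repeat split; auto; try lra.
    + intros x Hx. rewrite Rmult_1_l. apply bessel_J1_pos; auto.
    + apply (tends0_ext (fun x => atan (bessel_Y1 nu x / bessel_J1 nu x))); [intros; ring|].
      destruct (bessel_J1_near_0 nu Hp) as [d [C [Hd [HC B]]]].
      apply tends0_atan_infty.
      set (d0 := Rmin d (nu / 2)). assert (Hd0 : 0 < d0) by (apply Rmin_pos; lra).
      set (k := 3 / 4 * nu ^ 2 * (bessel_amp * bessel_amp) / C ^ 2).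
      assert (Hk : 0 < k).
      { unfold k. apply Rdiv_lt_0_compat; [|nra]. apply Rmult_lt_0_compat; nra. }
      apply (log_divergence _ (fun x => (x ^ 2 - nu ^ 2) * (bessel_amp * bessel_amp)
        / (x * (x * bessel_J1 nu x) ^ 2)) d0 k); auto.
      * intros x Hx. apply is_derive_ratio; auto; [lra|].
        assert (x <= d) by (eapply Rle_trans; [apply Hx | apply Rmin_l]).
        destruct (B x ltac:(lra)) as [_ [B2 _]]. intros E. rewrite E in B2. lra.
      * intros x Hx.
        assert (x <= d) by (eapply Rle_trans; [apply Hx | apply Rmin_l]).
        assert (Hx2 : x <= nu / 2) by (eapply Rle_trans; [apply Hx | apply Rmin_r]).
        destruct (B x ltac:(lra)) as [_ B2]. set (w := x * bessel_J1 nu x) in *.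
        assert (Hw : 0 < w ^ 2 <= C ^ 2) by (split; [nra | apply pow_incr; lra]).
        set (W := bessel_amp * bessel_amp) in *. assert (HW : 0 < W) by (unfold W; nra).
        replace ((x ^ 2 - nu ^ 2) * W / (x * w ^ 2)) with (- ((nu ^ 2 - x ^ 2) * W / w ^ 2 / x))
          by (field; split; [nra | lra]).
        apply Ropp_le_contravar. apply Rmult_le_compat_r; [left; apply Rinv_0_lt_compat; lra|].
        unfold k. apply Rmult_le_compat.
        -- apply Rmult_le_pos; nra.
        -- left; apply Rinv_0_lt_compat; nra.
        -- apply Rmult_le_compat_r; nra.
        -- apply Rinv_le_contravar; lra.
  - destruct bessel_J1_near_0_order_0 as [d [C [Hd [HC B]]]].
    exists d, (-1), PI. rewrite cos_PI, sin_PI. repeat split; auto; try lra.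
    + intros x Hx. destruct (B x Hx). lra.
    + apply (tends0_ext (fun x => PI + (-1) * atan (- (bessel_Y1 0 x / bessel_J1 0 x)))).
      { intros x _. rewrite atan_opp. ring. }
      replace (PI / 2) with (PI + (-1) * (PI / 2)) by field.
      apply tends0_plus; [apply tends0_const|]. apply tends0_mult; [apply tends0_const|].
      apply tends0_atan_infty.
      set (k := bessel_amp * bessel_amp / C ^ 2).
      assert (Hk : 0 < k) by (apply Rdiv_lt_0_compat; nra).
      apply (log_divergence _ (fun x => - ((x ^ 2 - 0 ^ 2) * (bessel_amp * bessel_amp)
        / (x * (x * bessel_J1 0 x) ^ 2))) d k); auto; try lra.
      * intros x Hx. apply (is_derive_opp (V := R_NormedModule)
          (fun x => bessel_Y1 0 x / bessel_J1 0 x)). apply is_derive_ratio; try lra.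
        destruct (B x Hx). lra.
      * intros x Hx. destruct (B x Hx) as [B1 B2]. set (j := bessel_J1 0 x) in *.
        set (W := bessel_amp * bessel_amp) in *. assert (HW : 0 < W) by (unfold W; nra).
        assert (Hj : 0 < j ^ 2 <= C ^ 2) by nra.
        replace ((x ^ 2 - 0 ^ 2) * W / (x * (x * j) ^ 2)) with (W / j ^ 2 / x)
          by (field; split; lra).
        apply Ropp_le_contravar. apply Rmult_le_compat_r; [left; apply Rinv_0_lt_compat; lra|].
        unfold k. apply Rmult_le_compat_l; [lra|]. apply Rinv_le_contravar; lra.
Qed.

Lemma phase_exists nu : 0 <= nu -> exists phi : R -> R,
  (forall x, 0 < x -> is_derive phi x (phase_rate nu x) /\
     bessel_J1 nu x = sqrt (mod2 nu x) * cos (phi x) /\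
     bessel_Y1 nu x = sqrt (mod2 nu x) * sin (phi x)) /\
  tends0 phi (PI / 2) /\ (0 < nu -> forall x, 0 < x <= nu -> Rabs (phi x) < PI / 2).
Proof.
  intros Hnu. destruct (phase_origin_data nu Hnu) as [b [s [sh [Hb [P1 [P2 [Cs [Ss [S2 [HJ T]]]]]]]]]].
  set (J1 := bessel_J1 nu) in *. set (Y1 := bessel_Y1 nu) in *.
  destruct (polar_lift 0 J1 Y1
    (fun x => - (J1 x / x) - (1 - nu ^ 2 / x ^ 2) * bessel_J nu x)
    (fun x => - (Y1 x / x) - (1 - nu ^ 2 / x ^ 2) * bessel_Y nu x)
    (phase_rate nu) b (sh + atan (Y1 b / J1 b))) as [phi [E0 P]]; auto.
  - intros x Hx. apply (bessel_sol_J nu x Hx).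
  - intros x Hx. apply (bessel_Y_sol nu Hnu x Hx).
  - intros x Hx. pose proof (mod2_pos nu x Hnu Hx) as M.
    apply (ex_derive_continuous (V := R_NormedModule)). unfold phase_rate, mod2 in *.
    assert (X1 : ex_derive (bessel_J1 nu) x) by exact (ex_intro _ _ (proj2 (bessel_sol_J nu x Hx))).
    assert (X2 : ex_derive (bessel_Y1 nu) x) by exact (ex_intro _ _ (proj2 (bessel_Y_sol nu Hnu x Hx))).
    auto_derive. split; [nra|]. split; [exact X1|]. split; [exact X2|]. split; [|exact I].
    apply Rmult_integral_contrapositive_currified; [lra|]. simpl in M. lra.
  - intros x Hx. apply (mod2_pos nu x Hnu Hx).
  - intros x Hx. apply (phase_rate_spec nu x Hnu Hx).
  - destruct (polar_angle_pos (s * J1 b) (s * Y1 b)) as [A1 A2]; [apply HJ; lra|].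
    replace ((s * J1 b) ^ 2 + (s * Y1 b) ^ 2) with ((s * s) * (J1 b ^ 2 + Y1 b ^ 2)) in A1, A2 by ring.
    rewrite S2, Rmult_1_l in A1, A2. rewrite cos_plus, Cs, Ss.
    assert (J1 b <> 0) by (intros E; specialize (HJ b ltac:(lra)); rewrite E in HJ; lra).
    replace (s * Y1 b / (s * J1 b)) with (Y1 b / J1 b) in A1, A2 by (field; split; auto; nra).
    transitivity (s * (s * J1 b)); [rewrite <- Rmult_assoc, S2; ring|]. rewrite A1. ring.
  - destruct (polar_angle_pos (s * J1 b) (s * Y1 b)) as [A1 A2]; [apply HJ; lra|].
    replace ((s * J1 b) ^ 2 + (s * Y1 b) ^ 2) with ((s * s) * (J1 b ^ 2 + Y1 b ^ 2)) in A1, A2 by ring.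
    rewrite S2, Rmult_1_l in A1, A2. rewrite sin_plus, Cs, Ss.
    assert (J1 b <> 0) by (intros E; specialize (HJ b ltac:(lra)); rewrite E in HJ; lra).
    replace (s * Y1 b / (s * J1 b)) with (Y1 b / J1 b) in A1, A2 by (field; split; auto; nra).
    transitivity (s * (s * Y1 b)); [rewrite <- Rmult_assoc, S2; ring|]. rewrite A2. ring.
  - exists phi. split; [exact P|].
    assert (SM : forall x, 0 < x -> 0 < sqrt (J1 x ^ 2 + Y1 x ^ 2))
      by (intros x Hx; apply sqrt_lt_R0, (mod2_pos nu x Hnu Hx)).
    assert (H : forall x, 0 < x <= b -> Rabs (phi x - sh) < PI / 2).
    { apply half_plane_angle; auto.
      - intros x Hx. apply (continuous_minus (V := R_NormedModule) phi);
          [|apply continuous_const].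
        apply (ex_derive_continuous (V := R_NormedModule)). eexists. apply P. lra.
      - intros x Hx. destruct (P x ltac:(lra)) as [_ [Q1 _]].
        rewrite cos_minus, Cs, Ss. specialize (HJ x Hx). specialize (SM x ltac:(lra)).
        apply Rmult_lt_reg_l with (1 := SM).
        replace (sqrt (J1 x ^ 2 + Y1 x ^ 2) * (cos (phi x) * s + sin (phi x) * 0))
          with (s * (sqrt (J1 x ^ 2 + Y1 x ^ 2) * cos (phi x))) by ring.
        rewrite <- Q1. lra.
      - rewrite E0. replace (sh + atan (Y1 b / J1 b) - sh) with (atan (Y1 b / J1 b)) by ring.
        pose proof (atan_bound (Y1 b / J1 b)). apply Rabs_def1; lra. }
    split.
    + apply (filterlim_ext_loc (fun x => sh + atan (Y1 x / J1 x))); [|exact T].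
      exists (mkposreal b Hb). intros x Hx Hx0.
      assert (Hx' : Rabs (x - 0) < b) by exact Hx. rewrite Rminus_0_r, Rabs_pos_eq in Hx' by lra.
      specialize (H x ltac:(lra)). apply Rabs_def2 in H.
      destruct (P x Hx0) as [_ [Q1 Q2]]. specialize (SM x Hx0). specialize (HJ x ltac:(lra)).
      assert (Hc : cos (phi x) <> 0).
      { intros E. rewrite E, Rmult_0_r in Q1. rewrite Q1 in HJ. lra. }
      assert (Et : Y1 x / J1 x = tan (phi x - sh)).
      { set (R0 := sqrt (J1 x ^ 2 + Y1 x ^ 2)) in *. clearbody R0. rewrite Q1, Q2. unfold tan. rewrite sin_minus, cos_minus, Cs, Ss. field.
        repeat split; auto; nra. }
      rewrite Et, atan_tan by lra. ring.
    + intros Hp x Hx. destruct (P1 Hp) as [-> ->]. specialize (H x Hx).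
      rewrite Rminus_0_r in H. exact H.
Qed.

Lemma dJ_eq nu x : 0 < x -> dJ nu x = bessel_J1 nu x.
Proof. intros Hx. apply is_derive_unique, (bessel_sol_J nu x Hx). Qed.

Lemma dY_eq nu x : 0 <= nu -> 0 < x -> dY nu x = bessel_Y1 nu x.
Proof. intros Hnu Hx. apply is_derive_unique, (bessel_Y_sol nu Hnu x Hx). Qed.

Lemma modulus_eq nu x : 0 <= nu -> 0 < x -> modulus nu x = sqrt (mod2 nu x).
Proof. intros Hnu Hx. unfold modulus, mod2. rewrite dJ_eq, dY_eq by auto. reflexivity. Qed.

(** Two branches differ by a continuous function with cosine [1] that vanishes at [0]. *)
Lemma is_phase_unique nu f g x : 0 <= nu -> is_phase nu f -> is_phase nu g -> 0 < x -> f x = g x.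
Proof.
  intros Hnu [Hf Lf] [Hg Lg] Hx. set (D := fun x => f x + (-1) * g x).
  assert (HD : forall y, 0 < y -> cos (D y) = 1).
  { intros y Hy. destruct (Hf y Hy) as [_ [F1 F2]]. destruct (Hg y Hy) as [_ [G1 G2]].
    assert (M : 0 < modulus nu y)
      by (rewrite modulus_eq by auto; apply sqrt_lt_R0, mod2_pos; auto).
    rewrite F1 in G1. rewrite F2 in G2.
    apply Rmult_eq_reg_l in G1; [|lra]. apply Rmult_eq_reg_l in G2; [|lra].
    unfold D. replace (f y + -1 * g y) with (f y - g y) by ring.
    rewrite cos_minus, G1, G2. pose proof (sin2_cos2 (g y)). unfold Rsqr in H. lra. }
  assert (HS : forall y, 0 < y -> sin (D y) = 0).
  { intros y Hy. pose proof (sin2_cos2 (D y)) as S. rewrite (HD y Hy) in S. unfold Rsqr in S. nra. }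
  assert (CD : forall y, 0 < y -> continuous D y).
  { intros y Hy. apply (continuous_plus (V := R_NormedModule) f); [apply Hf; auto|].
    apply (continuous_scal_r (V := R_NormedModule) (-1) g). apply Hg; auto. }
  assert (T : tends0 D 0).
  { replace 0 with (PI / 2 + (-1) * (PI / 2)) by ring.
    apply tends0_plus; [exact Lf|]. apply tends0_mult; [apply tends0_const | exact Lg]. }
  pose proof PI_bounds.
  destruct (proj1 (filterlim_locally D 0) T (mkposreal 1 Rlt_0_1)) as [d Hd].
  set (y := Rmin (d / 2) (x / 2)). pose proof (cond_pos d).
  assert (Hy : 0 < y) by (apply Rmin_pos; lra).
  assert (y <= d / 2) by apply Rmin_l. assert (y <= x / 2) by apply Rmin_r.
  assert (Dy : Rabs (D y) < 1).
  { rewrite <- (Rminus_0_r (D y)). apply (Hd y); auto.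
    change (Rabs (y - 0) < d). rewrite Rminus_0_r, Rabs_pos_eq; lra. }
  assert (Dx : Rabs (D x) < PI).
  { destruct (Rlt_le_dec (Rabs (D x)) PI) as [|L]; auto. exfalso.
    destruct (ivt (fun y => Rabs (D y)) y x PI) as [c [Hc1 Hc2]]; [lra| |lra|].
    - intros t Ht. apply (continuous_comp D Rabs); [apply CD; lra | apply continuous_Rabs].
    - specialize (HD c ltac:(lra)). unfold Rabs in Hc2. destruct (Rcase_abs (D c)).
      + rewrite <- (cos_neg (D c)), Hc2, cos_PI in HD. lra.
      + rewrite Hc2, cos_PI in HD. lra. }
  assert (D x = 0).
  { specialize (HS x Hx). apply Rabs_def2 in Dx.
    destruct (Rtotal_order (D x) 0) as [L | [L | L]]; auto; exfalso.
    - assert (0 < sin (- D x)) by (apply sin_gt_0; lra). rewrite sin_neg in H3. lra.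
    - assert (0 < sin (D x)) by (apply sin_gt_0; lra). lra. }
  unfold D in H3. lra.
Qed.

(** * Enclosure of the phase *)

Lemma cos_2PI_Z x k : cos (x + 2 * IZR k * PI) = cos x /\ sin (x + 2 * IZR k * PI) = sin x.
Proof.
  assert (N : forall y n, cos (y + 2 * INR n * PI) = cos y /\ sin (y + 2 * INR n * PI) = sin y)
    by (intros; split; [apply cos_period | apply sin_period]).
  destruct (Z_le_dec 0 k) as [H | H].
  - rewrite <- (Z2Nat.id k), <- INR_IZR_INZ by auto. apply N.
  - destruct (N (x + 2 * IZR k * PI) (Z.to_nat (- k))) as [N1 N2].
    rewrite INR_IZR_INZ, Z2Nat.id, opp_IZR in N1, N2 by lia.
    replace (x + 2 * IZR k * PI + 2 * - IZR k * PI) with x in N1, N2 by ring. auto.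
Qed.

(** The cosine of the difference tends to [1], and continuity keeps the difference near
    one multiple of [2 PI]. *)
Lemma phase_difference_limit l K (t y1 y2 phi rho : R -> R) : 0 < K ->
  (forall x, l < x -> continuous t x) -> (forall x, l < x -> continuous phi x) ->
  (forall x, l < x -> 0 < rho x) ->
  (forall x, l < x -> y1 x = rho x * cos (phi x)) ->
  (forall x, l < x -> y2 x = rho x * sin (phi x)) ->
  vanish (fun x => y1 x - K * cos (t x)) -> vanish (fun x => y2 x - K * sin (t x)) ->
  exists m : Z, vanish (fun x => phi x - 2 * IZR m * PI - t x).
Proof.
  intros HK Ct Cp Hr H1 H2 V1 V2. pose proof PI_bounds as HPI.
  set (D := fun x => phi x - t x).
  assert (VC : vanish (fun x => rho x * cos (D x) - K)).
  { apply (vanish_ext (fun x => (y1 x - K * cos (t x)) * cos (t x)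
      + (y2 x - K * sin (t x)) * sin (t x)) _ l).
    - intros x Hx. rewrite H1, H2 by auto. unfold D. rewrite cos_minus.
      pose proof (sin2_cos2 (t x)) as S. unfold Rsqr in S.
      transitivity (rho x * (cos (phi x) * cos (t x) + sin (phi x) * sin (t x))
        - K * (sin (t x) * sin (t x) + cos (t x) * cos (t x))); [ring | rewrite S; ring].
    - apply vanish_plus; apply vanish_bounded with 1 0; auto; intros;
        auto using Rabs_cos_le, Rabs_sin_le. }
  assert (VS : vanish (fun x => rho x * sin (D x))).
  { apply (vanish_ext (fun x => (y2 x - K * sin (t x)) * cos (t x)
      + (y1 x - K * cos (t x)) * - sin (t x)) _ l).
    - intros x Hx. rewrite H1, H2 by auto. unfold D. rewrite sin_minus. ring.
    - apply vanish_plus; apply vanish_bounded with 1 0; auto; intros;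
        rewrite ?Rabs_Ropp; auto using Rabs_cos_le, Rabs_sin_le. }
  destruct (proj1 (vanish_spec _) VC (mkposreal K HK)) as [M HM]. simpl in HM.
  set (x0 := Rmax l M + 1).
  assert (L0 : l < x0 /\ M < x0).
  { unfold x0. pose proof (Rmax_l l M). pose proof (Rmax_r l M). lra. }
  assert (Cpos : forall x, x0 <= x -> 0 < cos (D x)).
  { intros x Hx. specialize (HM x ltac:(lra)). specialize (Hr x ltac:(lra)).
    apply Rabs_def2 in HM. apply Rmult_lt_reg_l with (rho x); auto. lra. }
  set (m := up (D x0 / (2 * PI) - 1 / 2)).
  destruct (archimed (D x0 / (2 * PI) - 1 / 2)) as [A1 A2]. fold m in A1, A2.
  set (e := fun x => phi x - 2 * IZR m * PI - t x).
  assert (Ec : forall x, cos (e x) = cos (D x) /\ sin (e x) = sin (D x)).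
  { intros x. unfold e, D.
    replace (phi x - 2 * IZR m * PI - t x) with (phi x - t x + 2 * IZR (- m) * PI)
      by (rewrite opp_IZR; ring). apply cos_2PI_Z. }
  assert (E0 : Rabs (e x0) <= PI).
  { assert (D x0 = 2 * PI * (D x0 / (2 * PI))) by (field; lra).
    set (q := D x0 / (2 * PI)) in *.
    replace (e x0) with (2 * PI * (q - IZR m)) by (unfold e; unfold D in H; lra).
    apply Rabs_le. split; nra. }
  assert (Ce : forall x, x0 <= x -> continuous (fun x => Rabs (e x)) x).
  { intros x Hx. apply (continuous_comp e Rabs); [|apply continuous_Rabs].
    unfold e. apply (continuous_minus (V := R_NormedModule)); [|apply Ct; lra].
    apply (continuous_minus (V := R_NormedModule) phi); [apply Cp; lra | apply continuous_const]. }
  assert (NoHalf : forall x, x0 <= x -> Rabs (e x) <> PI / 2).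
  { intros x Hx E. specialize (Cpos x Hx). rewrite <- (proj1 (Ec x)) in Cpos.
    assert (cos (e x) = cos (Rabs (e x))).
    { unfold Rabs. destruct (Rcase_abs (e x)); [symmetry; apply cos_neg | reflexivity]. }
    rewrite H, E, cos_PI2 in Cpos. lra. }
  assert (E1 : Rabs (e x0) < PI / 2).
  { destruct (Rlt_le_dec (Rabs (e x0)) (PI / 2)) as [|L]; auto. exfalso.
    specialize (Cpos x0 (Rle_refl x0)). rewrite <- (proj1 (Ec x0)) in Cpos.
    assert (cos (e x0) = cos (Rabs (e x0))).
    { unfold Rabs. destruct (Rcase_abs (e x0)); [symmetry; apply cos_neg | reflexivity]. }
    assert (cos (Rabs (e x0)) <= 0) by (apply cos_le_0; lra). lra. }
  assert (E2 : forall x, x0 < x -> Rabs (e x) <= 4).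
  { intros x Hx. destruct (Rle_lt_dec (Rabs (e x)) 4) as [|L]; auto. exfalso.
    destruct (ivt (fun x => Rabs (e x)) x0 x (PI / 2)) as [c [Hc1 Hc2]]; [lra| |lra|].
    - intros y Hy. apply Ce. lra.
    - apply (NoHalf c); auto. lra. }
  exists m. apply (vanish_angle e rho K x0); auto.
  - intros x Hx. apply Hr. lra.
  - apply (vanish_ext (fun x => rho x * cos (D x) - K) _ 0); auto.
    intros x _. rewrite (proj1 (Ec x)). ring.
  - apply (vanish_ext (fun x => rho x * sin (D x)) _ 0); auto.
    intros x _. rewrite (proj2 (Ec x)). ring.
Qed.

Lemma continuous_of_derive (f : R -> R) x d : is_derive f x d -> continuous f x.
Proof. intros H. apply (ex_derive_continuous (V := R_NormedModule)). exists d. exact H. Qed.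

Section Enclosure.

Variables (nu : R) (phi : R -> R).
Hypothesis Hnu : 0 <= nu.
Hypothesis Dphi : forall x, nu < x -> continuous phi x.
Hypothesis PJ : forall x, nu < x -> bessel_J1 nu x = sqrt (mod2 nu x) * cos (phi x).
Hypothesis PY : forall x, nu < x -> bessel_Y1 nu x = sqrt (mod2 nu x) * sin (phi x).
Hypothesis Vphi : vanish (fun x => phi x - phi_lower nu x).

Let c4 (x : R) : R := sqrt (root_r nu x).
Let V1 := liouville_V nu (bessel_J1 nu).
Let V2 := liouville_V nu (bessel_Y1 nu).
Let Z1 := liouville_Z nu (bessel_J nu) (bessel_J1 nu).
Let Z2 := liouville_Z nu (bessel_Y nu) (bessel_Y1 nu).
Let om (x : R) : R := root_r nu x / x.
Let rho (x : R) : R := x * sqrt (mod2 nu x) / c4 x.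

Lemma om_pos x : nu < x -> 0 < om x.
Proof. intros Hx. destruct (root_r_spec nu x ltac:(lra)). apply Rdiv_lt_0_compat; lra. Qed.

Lemma continuous_om x : nu < x -> continuous om x.
Proof.
  intros Hx. destruct (root_r_spec nu x ltac:(lra)) as [R1 _].
  assert (E : ex_derive (root_r nu) x) by (eexists; apply is_derive_root_r; lra).
  apply (ex_derive_continuous (V := R_NormedModule)). unfold om. auto_derive. split; auto. lra.
Qed.

Lemma continuous_qf x : nu < x -> continuous (qf nu) x.
Proof. intros Hx. eapply continuous_of_derive. apply is_derive_qf. lra. Qed.

Lemma rho_pos x : nu < x -> 0 < rho x.
Proof.
  intros Hx. destruct (fourth_root_spec nu x ltac:(lra)) as [C1 _]. unfold rho, c4.
  apply Rdiv_lt_0_compat; auto. apply Rmult_lt_0_compat; [lra|].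
  apply sqrt_lt_R0, mod2_pos; lra.
Qed.

Lemma V1_polar x : nu < x -> V1 x = rho x * cos (phi x).
Proof. intros Hx. unfold V1, liouville_V, rho, c4. rewrite PJ by auto. unfold Rdiv. ring. Qed.

Lemma V2_polar x : nu < x -> V2 x = rho x * sin (phi x).
Proof. intros Hx. unfold V2, liouville_V, rho, c4. rewrite PY by auto. unfold Rdiv. ring. Qed.

Lemma VZ_wronskian x : nu < x -> V1 x * Z2 x - V2 x * Z1 x = bessel_amp * bessel_amp.
Proof.
  intros Hx. unfold V1, V2, Z1, Z2. rewrite liouville_wronskian by lra.
  apply bessel_wronskian; lra.
Qed.

(** The potential [1 - qf] lies below [1]: compare with [v'' + v = 0]. *)
Lemma phi_lower_lt_phase x : nu < x -> phi_lower nu x < phi x.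
Proof.
  intros Hx. pose proof bessel_amp_pos as HA.
  destruct (liouville_asym_JY nu Hnu) as [A1 [A2 [A3 A4]]].
  enough (-1 * (phi x - phi_lower nu x) < 0) by lra.
  apply (phase_comparison nu bessel_amp (phi_lower nu) om (fun x => - qf nu x)
    V1 Z1 V2 Z2 phi rho); auto.
  - intros y Hy. apply is_derive_phi_lower. lra.
  - apply continuous_om.
  - apply om_pos.
  - intros y Hy. apply (continuous_opp (V := R_NormedModule) (qf nu)). apply continuous_qf; auto.
  - intros y Hy. apply (liouville_system nu _ _ y); [lra | apply bessel_sol_J].
  - intros y Hy. apply (liouville_system nu _ _ y); [lra | apply bessel_Y_sol; auto].
  - intros y Hy. apply (liouville_system nu _ _ y); [lra | apply bessel_sol_J].
  - intros y Hy. apply (liouville_system nu _ _ y); [lra | apply bessel_Y_sol; auto].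
  - apply rho_pos.
  - apply V1_polar.
  - apply V2_polar.
  - intros y Hy. rewrite VZ_wronskian by auto. nra.
  - intros y Hy. pose proof (qf_pos nu y ltac:(lra)). lra.
Qed.

(** The functions [cos (phi_tilde) / sqrt eta] and [sin (phi_tilde) / sqrt eta] solve an
    equation of the same kind as [V1] and [V2]. Multiplying by [sqrt eta] and passing to the
    variable [phi_tilde] gives it the potential [1], and gives the equation of [V1] and [V2]
    the potential [1 + delta]. *)
Let eta (x : R) : R := 1 - qf nu x / 2.
Let sq (x : R) : R := sqrt (eta x).
Let yt (V : R -> R) (x : R) : R := sq x * V x.
Let zt (V Z : R -> R) (x : R) : R := Z x / sq x - qf1 nu x / (4 * sq x ^ 3) * V x.
Let delta (x : R) : R :=
  (qf2 nu x / (4 * eta x) + 3 * qf1 nu x ^ 2 / (16 * eta x ^ 2) - qf nu x ^ 2 / 4) / eta x ^ 2.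

Lemma eta_pos x : x_star nu < x -> 0 < eta x < 1.
Proof.
  intros Hx. destruct (x_star_spec nu Hnu) as [X1 X2].
  pose proof (qf_decreasing nu (x_star nu) x ltac:(lra) Hx).
  pose proof (qf_pos nu x ltac:(lra)). unfold eta. lra.
Qed.

Lemma sq_spec x : x_star nu < x -> 0 < sq x /\ sq x ^ 2 = eta x.
Proof.
  intros Hx. pose proof (eta_pos x Hx). split; [apply sqrt_lt_R0; lra | apply pow2_sqrt; lra].
Qed.

Lemma is_derive_sq x : x_star nu < x -> is_derive sq x (om x * (- qf1 nu x / (4 * sq x))).
Proof.
  intros Hx. destruct (x_star_spec nu Hnu) as [X1 _]. pose proof (eta_pos x Hx) as He.
  destruct (sq_spec x Hx) as [S1 S2].
  assert (De : is_derive eta x (- (om x * qf1 nu x) / 2)).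
  { unfold eta. replace (- (om x * qf1 nu x) / 2) with (0 - om x * qf1 nu x * / 2) by (field; lra).
    apply (is_derive_minus (V := R_NormedModule) (fun _ => 1) (fun x => qf nu x / 2)).
    - exact (is_derive_const (V := R_NormedModule) 1 x).
    - apply (is_derive_scal_l (V := R_NormedModule) (qf nu) x (om x * qf1 nu x) (/ 2)).
      apply is_derive_qf. lra. }
  assert (D := is_derive_sqrt eta x _ De (proj1 He)).
  replace (om x * (- qf1 nu x / (4 * sq x))) with (- (om x * qf1 nu x) / 2 / (2 * sqrt (eta x)));
    [exact D|].
  fold (sq x). field. lra.
Qed.

Lemma modified_system V Z f f1 x : x_star nu < x -> bessel_sol nu f f1 ->
  V = liouville_V nu f1 -> Z = liouville_Z nu f f1 ->
  is_derive (yt V) x (om x * eta x * zt V Z x) /\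
  is_derive (zt V Z) x (- (om x * eta x) * (1 + delta x) * yt V x).
Proof.
  intros Hx S EV EZ. destruct (x_star_spec nu Hnu) as [X1 _].
  destruct (liouville_system nu f f1 x ltac:(lra) S) as [DV DZ]. rewrite <- EV, <- EZ in DV, DZ.
  destruct (sq_spec x Hx) as [S1 S2]. pose proof (eta_pos x Hx) as He.
  assert (Ds := is_derive_sq x Hx). assert (Dq := is_derive_qf1 nu x ltac:(lra)).
  fold (om x) in DV, DZ, Dq.
  assert (EVx : ex_derive V x) by (eexists; exact DV).
  assert (EZx : ex_derive Z x) by (eexists; exact DZ).
  assert (Esx : ex_derive sq x) by (eexists; exact Ds).
  assert (Eqx : ex_derive (qf1 nu) x) by (eexists; exact Dq).
  assert (Eq : qf nu x = 2 - 2 * sq x ^ 2) by (rewrite S2; unfold eta; field).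
  split; unfold yt, zt.
  - auto_derive; [auto|].
    replace (Derive (fun x => sq x) x) with (om x * (- qf1 nu x / (4 * sq x)))
      by (symmetry; apply is_derive_unique, Ds).
    replace (Derive (fun x => V x) x) with (om x * Z x) by (symmetry; apply is_derive_unique, DV).
    rewrite <- S2. field. lra.
  - assert (0 < sq x ^ 3) by (apply pow_lt; auto).
    auto_derive; [repeat split; auto; simpl in *; lra|].
    replace (Derive (fun x => sq x) x) with (om x * (- qf1 nu x / (4 * sq x)))
      by (symmetry; apply is_derive_unique, Ds).
    replace (Derive (fun x => V x) x) with (om x * Z x) by (symmetry; apply is_derive_unique, DV).
    replace (Derive (fun x => Z x) x) with (- om x * (1 + - qf nu x) * V x)
      by (symmetry; apply is_derive_unique, DZ).
    replace (Derive (fun x => qf1 nu x) x) with (om x * qf2 nu x)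
      by (symmetry; apply is_derive_unique, Dq).
    unfold delta. rewrite <- S2, Eq. field. lra.
Qed.

Lemma delta_pos x : x_star nu < x -> 0 < delta x.
Proof.
  intros Hx. destruct (x_star_spec nu Hnu) as [X1 _]. pose proof (eta_pos x Hx) as He.
  pose proof (qf2_gt_sqr nu x ltac:(lra)) as Q. unfold delta.
  apply Rdiv_lt_0_compat; [|nra].
  assert (0 <= qf nu x ^ 2) by apply pow2_ge_0.
  assert (qf nu x ^ 2 / 4 < qf2 nu x / (4 * eta x)).
  { apply Rlt_le_trans with (qf2 nu x / 4); [lra|].
    apply Rmult_le_compat_l; [lra|]. apply Rinv_le_contravar; lra. }
  assert (0 <= 3 * qf1 nu x ^ 2 / (16 * eta x ^ 2)).
  { apply Rmult_le_pos; [pose proof (pow2_ge_0 (qf1 nu x)); lra|].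
    left. apply Rinv_0_lt_compat. nra. }
  lra.
Qed.

Lemma root_r_large x : 2 * nu + 1 <= x -> x / 2 <= root_r nu x.
Proof.
  intros Hx. destruct (root_r_spec nu x ltac:(lra)) as [R1 R2].
  destruct (Rle_lt_dec (x / 2) (root_r nu x)); auto. exfalso. nra.
Qed.

Lemma vanish_inv_root k : vanish (fun x => k / root_r nu x).
Proof.
  apply (vanish_le (fun x => (2 * k) / x) _ (2 * nu + 1)); [apply vanish_inv|].
  intros x Hx. pose proof (root_r_large x ltac:(lra)).
  unfold Rdiv. rewrite !Rabs_mult, !Rabs_inv, (Rabs_pos_eq 2) by lra.
  rewrite (Rabs_pos_eq x), (Rabs_pos_eq (root_r nu x)) by lra.
  replace (2 * Rabs k * / x) with (Rabs k * / (x / 2)) by (field; lra).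
  apply Rmult_le_compat_l; [apply Rabs_pos|]. apply Rinv_le_contravar; lra.
Qed.

Lemma small_at_infinity : vanish (qf nu) /\ vanish (qf1 nu) /\
  vanish (fun x => phi_lower nu x - phi_tilde nu x).
Proof.
  set (n := nu ^ 2). assert (Hn : 0 <= n) by apply pow2_ge_0.
  assert (B : forall x, 2 * nu + 2 < x -> 1 <= root_r nu x).
  { intros x Hx. pose proof (root_r_large x ltac:(lra)). lra. }
  assert (Hinv : forall x k, 2 * nu + 2 < x -> 0 < / root_r nu x ^ k <= 1).
  { intros x k Hx. specialize (B x Hx). split; [apply Rinv_0_lt_compat, pow_lt; lra|].
    rewrite <- Rinv_1. apply Rinv_le_contravar; [lra|]. apply pow_R1_Rle; auto. }
  assert (V := vanish_inv_root 1).
  split; [|split].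
  - apply (vanish_ext (fun x => 1 / root_r nu x * (3 / 4 * / root_r nu x ^ 1
      + 5 / 2 * n * / root_r nu x ^ 3 + 7 / 4 * n ^ 2 * / root_r nu x ^ 5)) _ (2 * nu + 2)).
    + intros x Hx. specialize (B x Hx). unfold qf, n. field. lra.
    + apply vanish_bounded with (3 / 4 + 5 / 2 * n + 7 / 4 * n ^ 2) (2 * nu + 2); auto.
      intros x Hx. pose proof (Hinv x 1%nat Hx). pose proof (Hinv x 3%nat Hx).
      pose proof (Hinv x 5%nat Hx). pose proof (pow2_ge_0 n).
      rewrite Rabs_pos_eq; nra.
  - apply (vanish_ext (fun x => 1 / root_r nu x * - (3 / 2 * / root_r nu x ^ 2
      + 23 / 2 * n * / root_r nu x ^ 4 + 41 / 2 * n ^ 2 * / root_r nu x ^ 6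
      + 21 / 2 * n ^ 3 * / root_r nu x ^ 8)) _ (2 * nu + 2)).
    + intros x Hx. specialize (B x Hx). unfold qf1, n. field. lra.
    + apply vanish_bounded with (3 / 2 + 23 / 2 * n + 41 / 2 * n ^ 2 + 21 / 2 * n ^ 3)
        (2 * nu + 2); auto.
      intros x Hx. pose proof (Hinv x 2%nat Hx). pose proof (Hinv x 4%nat Hx).
      pose proof (Hinv x 6%nat Hx). pose proof (Hinv x 8%nat Hx).
      pose proof (pow2_ge_0 n). assert (0 <= n ^ 3) by (apply pow_le; auto).
      rewrite Rabs_Ropp, Rabs_pos_eq; nra.
  - apply (vanish_ext (fun x => 1 / root_r nu x * - (9 / 24 + 7 / 24 * n * / root_r nu x ^ 2))
      _ (2 * nu + 2)).
    + intros x Hx. specialize (B x Hx). rewrite phi_tilde_root by lra. unfold n. field. lra.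
    + apply vanish_bounded with (9 / 24 + 7 / 24 * n) (2 * nu + 2); auto.
      intros x Hx. pose proof (Hinv x 2%nat Hx). rewrite Rabs_Ropp, Rabs_pos_eq; nra.
Qed.

Lemma vanish_sq_minus_1 : vanish (fun x => sq x - 1) /\ vanish (fun x => / sq x - 1).
Proof.
  destruct small_at_infinity as [Q _]. destruct (x_star_spec nu Hnu) as [X1 _].
  assert (Q2 : exists M, forall x, M < x -> x_star nu < x /\ qf nu x < 1).
  { destruct (proj1 (vanish_spec _) Q (mkposreal 1 Rlt_0_1)) as [M HM]. simpl in HM.
    exists (Rmax M (x_star nu)). intros x Hx.
    assert (x_star nu < x) by (eapply Rle_lt_trans; [apply Rmax_r | exact Hx]).
    split; auto. specialize (HM x (Rle_lt_trans _ _ _ (Rmax_l _ _) Hx)).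
    apply Rabs_def2 in HM. lra. }
  destruct Q2 as [M HM].
  assert (B : forall x, M < x -> 1 / 2 <= sq x <= 1 /\ 1 - sq x <= qf nu x / 2).
  { intros x Hx. destruct (HM x Hx) as [H1 H2]. destruct (sq_spec x H1) as [S1 S2].
    pose proof (eta_pos x H1). unfold eta in *.
    assert (sq x <= 1) by nra. assert (1 / 2 <= sq x) by nra. split; [lra|].
    assert (sq x ^ 2 <= sq x) by nra. lra. }
  split; apply (vanish_le (qf nu) _ M Q); intros x Hx; destruct (B x Hx) as [B1 B2];
    destruct (HM x Hx) as [H1 H2]; pose proof (qf_pos nu x ltac:(lra));
    rewrite (Rabs_pos_eq (qf nu x)) by lra.
  - rewrite Rabs_left1 by lra. lra.
  - assert (E : / sq x - 1 = (1 - sq x) * / sq x) by (field; lra). rewrite E.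
    assert (0 < / sq x <= 2).
    { split; [apply Rinv_0_lt_compat; lra|]. replace 2 with (/ (1 / 2)) by field.
      apply Rinv_le_contravar; lra. }
    rewrite Rabs_pos_eq by nra. nra.
Qed.

Lemma modified_asym V Z (cv cz : R -> R) :
  (forall x, Rabs (cv x) <= bessel_amp) -> (forall x, Rabs (cz x) <= bessel_amp) ->
  vanish (fun x => V x - cv x) -> vanish (fun x => Z x - cz x) ->
  vanish (fun x => yt V x - cv x) /\ vanish (fun x => zt V Z x - cz x).
Proof.
  intros Bv Bz HV HZ. destruct vanish_sq_minus_1 as [S1 S2].
  destruct small_at_infinity as [_ [Q1 _]].
  destruct (vanish_eventually_bounded _ S1) as [M1 B1].
  destruct (vanish_eventually_bounded _ S2) as [M2 B2].
  destruct (vanish_eventually_bounded _ HV) as [M3 B3].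
  assert (Bd : forall a, Rabs (a - 1) <= 1 -> Rabs a <= 2).
  { intros a Ha. apply Rabs_le_between in Ha. apply Rabs_le. lra. }
  split.
  - apply (vanish_ext (fun x => (V x - cv x) * sq x + (sq x - 1) * cv x) _ 0).
    + intros x _. unfold yt. ring.
    + apply vanish_plus.
      * apply vanish_bounded with 2 M1; auto.
      * apply vanish_bounded with bessel_amp 0; auto.
  - destruct (x_star_spec nu Hnu) as [X1 _].
    apply (vanish_ext (fun x => ((Z x - cz x) * / sq x + (/ sq x - 1) * cz x)
      + qf1 nu x * - (/ 4 * (/ sq x) ^ 3 * V x)) _ (x_star nu)).
    + intros x Hx. destruct (sq_spec x Hx). unfold zt. field. lra.
    + apply vanish_plus; [apply vanish_plus|].
      * apply vanish_bounded with 2 M2; auto.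
      * apply vanish_bounded with bessel_amp 0; auto.
      * apply vanish_bounded with (/ 4 * 2 ^ 3 * (1 + bessel_amp)) (Rmax M2 M3); auto.
        intros x Hx.
        assert (H2 : M2 < x) by (eapply Rle_lt_trans; [apply Rmax_l | exact Hx]).
        assert (H3 : M3 < x) by (eapply Rle_lt_trans; [apply Rmax_r | exact Hx]).
        specialize (B2 x H2). specialize (B3 x H3). apply Bd in B2.
        assert (B4 : Rabs (V x) <= 1 + bessel_amp).
        { replace (V x) with ((V x - cv x) + cv x) by ring.
          eapply Rle_trans; [apply Rabs_triang|]. apply Rplus_le_compat; auto. }
        rewrite Rabs_Ropp, !Rabs_mult, <- RPow_abs, (Rabs_pos_eq (/ 4)) by lra.
        pose proof (Rabs_pos (/ sq x)).
        apply Rmult_le_compat; auto using Rabs_pos.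
        -- apply Rmult_le_pos; [lra | apply pow_le; auto].
        -- apply Rmult_le_compat_l; [lra|]. apply pow_incr. lra.
Qed.

(** Here the comparison equation is the one solved by [cos (phi_tilde) / sqrt eta];
    its potential lies below because [qf'' > qf^2]. *)
Lemma phase_lt_phi_tilde x : x_star nu < x -> phi x < phi_tilde nu x.
Proof.
  intros Hx. pose proof bessel_amp_pos as HA. destruct (x_star_spec nu Hnu) as [X1 _].
  destruct (liouville_asym_JY nu Hnu) as [A1 [A2 [A3 A4]]].
  destruct small_at_infinity as [_ [_ Vt]].
  set (a := bessel_amp) in *. set (tl := phi_tilde nu).
  assert (Bc : forall t, Rabs (a * cos t) <= a).
  { intros t. rewrite Rabs_mult, (Rabs_pos_eq a) by lra. pose proof (Rabs_cos_le t). nra. }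
  assert (Bs : forall t, Rabs (a * sin t) <= a).
  { intros t. rewrite Rabs_mult, (Rabs_pos_eq a) by lra. pose proof (Rabs_sin_le t). nra. }
  assert (Vc : vanish (fun x => a * (cos (phi_lower nu x) - cos (tl x)))).
  { apply vanish_scal. apply (vanish_le _ _ 0 Vt). intros. apply Rabs_cos_diff. }
  assert (Vs : vanish (fun x => a * (sin (phi_lower nu x) - sin (tl x)))).
  { apply vanish_scal. apply (vanish_le _ _ 0 Vt). intros. apply Rabs_sin_diff. }
  destruct (modified_asym V1 Z1 (fun x => a * cos (tl x)) (fun x => - (a * sin (tl x))))
    as [W1 W2].
  { intros; apply Bc. } { intros; rewrite Rabs_Ropp; apply Bs. }
  { refine (vanish_ext _ _ 0 _ (vanish_plus _ _ A1 Vc)). intros; unfold V1; ring. }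
  { refine (vanish_ext _ _ 0 _ (vanish_plus _ _ A2 (vanish_scal (-1) _ Vs))).
    intros; unfold Z1; ring. }
  destruct (modified_asym V2 Z2 (fun x => a * sin (tl x)) (fun x => a * cos (tl x)))
    as [W3 W4].
  { intros; apply Bs. } { intros; apply Bc. }
  { refine (vanish_ext _ _ 0 _ (vanish_plus _ _ A3 Vs)). intros; unfold V2; ring. }
  { refine (vanish_ext _ _ 0 _ (vanish_plus _ _ A4 Vc)). intros; unfold Z2; ring. }
  enough (1 * (phi x - tl x) < 0) by lra.
  apply (phase_comparison (x_star nu) a tl (fun x => om x * eta x) delta
    (yt V1) (zt V1 Z1) (yt V2) (zt V2 Z2) phi (fun x => sq x * rho x)); auto.
  - intros y Hy. apply is_derive_phi_tilde. lra.
  - intros y Hy. apply (continuous_mult (K := R_AbsRing) om eta); [apply continuous_om; lra|].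
    unfold eta. apply (continuous_minus (V := R_NormedModule) (fun _ => 1)); [apply continuous_const|].
    apply (continuous_scal_l (V := R_NormedModule) (qf nu) (/ 2)). apply continuous_qf. lra.
  - intros y Hy. pose proof (om_pos y ltac:(lra)). pose proof (eta_pos y Hy).
    apply Rmult_lt_0_compat; lra.
  - intros y Hy. pose proof (eta_pos y Hy) as He.
    assert (Eq : ex_derive (qf nu) y) by (eexists; apply is_derive_qf; lra).
    assert (Eq1 : ex_derive (qf1 nu) y) by (eexists; apply is_derive_qf1; lra).
    assert (Eq2 : ex_derive (qf2 nu) y).
    { unfold qf2. destruct (root_r_spec nu y ltac:(lra)) as [R1 _].
      assert (Er : ex_derive (root_r nu) y) by (eexists; apply is_derive_root_r; lra).
      assert (0 < root_r nu y ^ 12) by (apply pow_lt; auto).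
      auto_derive. repeat split; auto. simpl in *. lra. }
    apply (ex_derive_continuous (V := R_NormedModule)). unfold delta, eta in *.
    auto_derive. repeat split; auto; nra.
  - intros y Hy. apply (modified_system V1 Z1 (bessel_J nu) (bessel_J1 nu)); auto. apply bessel_sol_J.
  - intros y Hy. apply (modified_system V2 Z2 (bessel_Y nu) (bessel_Y1 nu)); auto.
    apply bessel_Y_sol; auto.
  - intros y Hy. apply (modified_system V1 Z1 (bessel_J nu) (bessel_J1 nu)); auto. apply bessel_sol_J.
  - intros y Hy. apply (modified_system V2 Z2 (bessel_Y nu) (bessel_Y1 nu)); auto.
    apply bessel_Y_sol; auto.
  - intros y Hy. destruct (sq_spec y Hy). pose proof (rho_pos y ltac:(lra)).
    apply Rmult_lt_0_compat; auto.
  - intros y Hy. unfold yt. rewrite V1_polar by lra. ring.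
  - intros y Hy. unfold yt. rewrite V2_polar by lra. ring.
  - intros y Hy. apply Dphi. lra.
  - intros y Hy. destruct (sq_spec y Hy) as [S1 S2].
    replace (yt V1 y * zt V2 Z2 y - yt V2 y * zt V1 Z1 y) with (V1 y * Z2 y - V2 y * Z1 y)
      by (unfold yt, zt; field; lra).
    rewrite VZ_wronskian by lra. apply Rmult_lt_0_compat; exact bessel_amp_pos.
  - refine (vanish_ext _ _ 0 _ W2). intros; ring.
  - refine (vanish_ext _ _ 0 _ (vanish_plus _ _ Vphi Vt)). intros; unfold tl; ring.
  - intros y Hy. pose proof (delta_pos y Hy). lra.
Qed.

End Enclosure.

Lemma continuous_right_below (f : R -> R) a eps : continuous f a -> 0 < eps ->
  exists b, a < b /\ f b < f a + eps.
Proof.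
  intros H He. destruct (proj1 (filterlim_locally f (f a)) H (mkposreal _ He)) as [d Hd].
  pose proof (cond_pos d). exists (a + d / 2). split; [lra|].
  assert (B : Rabs (f (a + d / 2) - f a) < eps).
  { apply Hd. change (Rabs (a + d / 2 - a) < d). replace (a + d / 2 - a) with (d / 2) by ring.
    rewrite Rabs_pos_eq; lra. }
  apply Rabs_def2 in B. lra.
Qed.

Lemma derive_neg_right (f : R -> R) a d : is_derive f a d -> d < 0 -> exists b, a < b /\ f b < f a.
Proof.
  intros H Hd. apply is_derive_Reals in H. destruct (H (- d / 2)) as [del Hdel]; [lra|].
  pose proof (cond_pos del). exists (a + del / 2). split; [lra|].
  specialize (Hdel (del / 2) ltac:(lra) ltac:(rewrite Rabs_pos_eq; lra)).
  apply Rabs_def2 in Hdel. destruct Hdel as [Hdel _].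
  assert (Q : (f (a + del / 2) - f a) / (del / 2) < 0) by lra.
  apply (Rmult_lt_compat_r (del / 2)) in Q; [|lra].
  unfold Rdiv in Q at 1. rewrite Rmult_assoc, Rinv_l, Rmult_0_l in Q by lra. lra.
Qed.

Lemma tends0_below f l v : tends0 f l -> l < v -> exists x, 0 < x /\ f x < v.
Proof.
  intros H Hv. assert (He : 0 < v - l) by lra.
  destruct (proj1 (filterlim_locally f l) H (mkposreal _ He)) as [d Hd].
  pose proof (cond_pos d). exists (d / 2). split; [lra|].
  assert (B : Rabs (f (d / 2) - l) < v - l).
  { apply Hd; [|lra]. change (Rabs (d / 2 - 0) < d). rewrite Rminus_0_r, Rabs_pos_eq; lra. }
  apply Rabs_def2 in B. lra.
Qed.

Lemma tends0_increasing_lower f l x : tends0 f l ->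
  (forall a b, 0 < a -> a < b -> f a < f b) -> 0 < x -> l < f x.
Proof.
  intros H Hinc Hx. destruct (Rlt_le_dec l (f x)) as [|L]; auto. exfalso.
  assert (Hh := Hinc (x / 2) x ltac:(lra) ltac:(lra)).
  assert (He : 0 < l - f (x / 2)) by lra.
  destruct (proj1 (filterlim_locally f l) H (mkposreal _ He)) as [d Hd].
  pose proof (cond_pos d). set (y := Rmin (d / 2) (x / 4)).
  assert (Hy : 0 < y) by (apply Rmin_pos; lra).
  assert (y <= d / 2) by apply Rmin_l. assert (y <= x / 4) by apply Rmin_r.
  assert (B : Rabs (f y - l) < l - f (x / 2)).
  { apply Hd; auto. change (Rabs (y - 0) < d). rewrite Rminus_0_r, Rabs_pos_eq; lra. }
  apply Rabs_def2 in B. specialize (Hinc y (x / 2) Hy ltac:(lra)). lra.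
Qed.

Lemma phase_rate_sign nu x : 0 <= nu -> 0 < x ->
  (nu < x -> 0 < phase_rate nu x) /\ (x < nu -> phase_rate nu x < 0).
Proof.
  intros Hnu Hx. pose proof (mod2_pos nu x Hnu Hx) as M. pose proof bessel_amp_pos as A.
  assert (E : phase_rate nu x = (x ^ 2 - nu ^ 2) * (bessel_amp * bessel_amp / (x ^ 3 * mod2 nu x)))
    by (unfold phase_rate; field; lra).
  assert (P : 0 < bessel_amp * bessel_amp / (x ^ 3 * mod2 nu x)).
  { apply Rdiv_lt_0_compat; [nra|]. apply Rmult_lt_0_compat; auto. apply pow_lt; auto. }
  rewrite E. split; intros H.
  - apply Rmult_lt_0_compat; nra.
  - assert (x ^ 2 - nu ^ 2 < 0) by nra. nra.
Qed.

Lemma z_star_small nu : 0 <= nu -> z_star nu < 202 / 100.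
Proof.
  intros H. pose proof (z_star_le_0 nu H) as Z. rewrite z_star_0 in Z.
  pose proof sqrt_3_2_bounds. pose proof PI_bounds. lra.
Qed.

(** The multiple of [2 PI] between the phase and its comparison functions is [0]: near
    [nu] the phase is at most [PI / 2] while [phi_lower] is [PI / 4], and at [x_star] it is
    at least [- PI / 2] while [phi_tilde] is [z_star], which is less than [2.02]. *)
Lemma phase_enclosure nu : 0 <= nu -> exists phi, is_phase nu phi /\
  (forall x, nu < x -> phi_lower nu x < phi x) /\
  (forall x, x_star nu <= x -> phi x < phi_tilde nu x) /\
  (forall x y, 0 < x -> nu <= x -> x < y -> phi x < phi y) /\
  (forall x, 0 < x <= nu -> 0 < phi x < PI / 2) /\
  (nu = 0 -> forall x, 0 < x -> PI / 2 < phi x) /\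
  (forall x, 0 < x -> continuous phi x).
Proof.
  intros Hnu. destruct (phase_exists nu Hnu) as [phi [P [T Half]]].
  pose proof PI_bounds as HPI.
  assert (D : forall x, 0 < x -> is_derive phi x (phase_rate nu x)) by (intros; apply P; auto).
  assert (Cp : forall x, 0 < x -> continuous phi x)
    by (intros x Hx; eapply continuous_of_derive; apply D; auto).
  assert (Inc : forall x y, 0 < x -> nu <= x -> x < y -> phi x < phi y).
  { intros x y Hx Hn Hxy. apply (is_derive_pos_increasing phi (phase_rate nu)); auto.
    - intros t Ht. apply D. lra.
    - intros t Ht. apply phase_rate_sign; lra. }
  assert (Zero : nu = 0 -> forall x, 0 < x -> PI / 2 < phi x).
  { intros E x Hx. apply (tends0_increasing_lower phi); auto. intros a b Ha Hab. apply Inc; lra. }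
  assert (Near : exists x, nu < x /\ phi x < PI / 2 + 1).
  { destruct (Rle_lt_or_eq_dec 0 nu Hnu) as [Hp | E].
    - specialize (Half Hp nu ltac:(lra)). apply Rabs_def2 in Half.
      destruct (continuous_right_below phi nu 1 (Cp nu Hp) Rlt_0_1) as [b [B1 B2]].
      exists b. split; lra.
    - destruct (tends0_below phi (PI / 2) (PI / 2 + 1) T ltac:(lra)) as [x [X1 X2]].
      exists x. split; lra. }
  assert (Far : forall x, nu < x -> - (PI / 2) < phi x).
  { intros x Hx. destruct (Rle_lt_or_eq_dec 0 nu Hnu) as [Hp | E].
    - specialize (Half Hp nu ltac:(lra)). apply Rabs_def2 in Half.
      specialize (Inc nu x Hp ltac:(lra) Hx). lra.
    - specialize (Zero (eq_sym E) x ltac:(lra)). lra. }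
  destruct (liouville_asym_JY nu Hnu) as [A1 [_ [A3 _]]].
  destruct (phase_difference_limit nu bessel_amp (phi_lower nu)
    (liouville_V nu (bessel_J1 nu)) (liouville_V nu (bessel_Y1 nu)) phi
    (fun x => x * sqrt (mod2 nu x) / sqrt (root_r nu x)) bessel_amp_pos) with (6 := A1) (7 := A3)
    as [m Vm].
  { intros x Hx. eapply continuous_of_derive. apply is_derive_phi_lower. lra. }
  { intros x Hx. apply Cp. lra. }
  { intros x Hx. destruct (fourth_root_spec nu x ltac:(lra)) as [C1 _].
    apply Rdiv_lt_0_compat; auto. apply Rmult_lt_0_compat; [lra|]. apply sqrt_lt_R0, mod2_pos; lra. }
  { intros x Hx. unfold liouville_V. destruct (P x ltac:(lra)) as [_ [Q1 _]].
    rewrite Q1 at 1. unfold Rdiv. ring. }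
  { intros x Hx. unfold liouville_V. destruct (P x ltac:(lra)) as [_ [_ Q2]].
    rewrite Q2 at 1. unfold Rdiv. ring. }
  set (psi := fun x => phi x - 2 * IZR m * PI) in *.
  assert (Cpsi : forall x, nu < x -> continuous psi x).
  { intros x Hx. apply (continuous_minus (V := R_NormedModule) phi);
      [apply Cp; lra | apply continuous_const]. }
  assert (Epsi : forall x, cos (psi x) = cos (phi x) /\ sin (psi x) = sin (phi x)).
  { intros x. unfold psi. replace (phi x - 2 * IZR m * PI) with (phi x + 2 * IZR (- m) * PI)
      by (rewrite opp_IZR; ring). apply cos_2PI_Z. }
  assert (PJ : forall x, nu < x -> bessel_J1 nu x = sqrt (mod2 nu x) * cos (psi x)).
  { intros x Hx. rewrite (proj1 (Epsi x)). apply P. lra. }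
  assert (PY : forall x, nu < x -> bessel_Y1 nu x = sqrt (mod2 nu x) * sin (psi x)).
  { intros x Hx. rewrite (proj2 (Epsi x)). apply P. lra. }
  assert (Low := fun x => phi_lower_lt_phase nu psi Hnu Cpsi PJ PY Vm x).
  assert (Up := fun x => phase_lt_phi_tilde nu psi Hnu Cpsi PJ PY Vm x).
  destruct (x_star_spec nu Hnu) as [X1 X2].
  assert (Hm0 : m = 0%Z).
  { destruct Near as [x [N1 N2]]. pose proof (Low x N1) as L. pose proof (phi_lower_gt nu x ltac:(lra)).
    unfold psi in L. assert (M1 : IZR m < 1) by nra.
    assert (Ct : continuous (phi_tilde nu) (x_star nu))
      by (eapply continuous_of_derive; apply is_derive_phi_tilde; lra).
    destruct (continuous_right_below _ _ (1 / 10) Ct ltac:(lra)) as [b [B1 B2]].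
    pose proof (Up b B1) as U. pose proof (Far b ltac:(lra)). pose proof (z_star_small nu Hnu).
    fold (z_star nu) in B2. unfold psi in U. assert (M2 : -1 < IZR m) by nra.
    apply lt_IZR in M1. apply lt_IZR in M2. lia. }
  assert (Epp : forall x, psi x = phi x) by (intros x; unfold psi; rewrite Hm0; simpl; ring).
  assert (LowF : forall x, nu < x -> phi_lower nu x < phi x)
    by (intros x Hx; rewrite <- Epp; apply Low; auto).
  assert (UpF : forall x, x_star nu < x -> phi x < phi_tilde nu x)
    by (intros x Hx; rewrite <- Epp; apply Up; auto).
  exists phi. split; [|split; [|split; [|split; [|split; [|split]]]]]; auto.
  - split; [|exact T]. intros x Hx. rewrite modulus_eq, dJ_eq, dY_eq by auto.
    split; [auto|]. apply P; auto.
  - intros x Hx. destruct (Rle_lt_or_eq_dec _ _ Hx) as [L | <-]; auto.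
    (* at [x_star] itself [phi_tilde] is stationary and the phase is not *)
    destruct (Rlt_le_dec (phi (x_star nu)) (phi_tilde nu (x_star nu))) as [|Hge]; auto. exfalso.
    assert (DF := is_derive_minus (V := R_NormedModule) (phi_tilde nu) phi (x_star nu) _ _
      (is_derive_phi_tilde nu (x_star nu) ltac:(lra)) (D (x_star nu) ltac:(lra))).
    destruct (derive_neg_right _ _ _ DF) as [b [B1 B2]].
    + rewrite X2. pose proof (proj1 (phase_rate_sign nu (x_star nu) Hnu ltac:(lra)) X1).
      unfold minus, plus, opp; simpl. replace (1 - 2 / 2) with 0 by field. rewrite Rmult_0_r. lra.
    + unfold minus, plus, opp in B2; simpl in B2. specialize (UpF b B1). lra.
  - intros x Hx. assert (Hp : 0 < nu) by lra. assert (H := Half Hp x Hx).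
    apply Rabs_def2 in H. split; [|lra].
    assert (Hn : PI / 4 <= phi nu).
    { destruct (Rle_lt_dec (PI / 4) (phi nu)) as [|L]; auto. exfalso.
      destruct (continuous_right_below phi nu (PI / 4 - phi nu) (Cp nu Hp) ltac:(lra)) as [b [B1 B2]].
      pose proof (LowF b B1). pose proof (phi_lower_gt nu b ltac:(lra)). lra. }
    destruct (Rle_lt_or_eq_dec _ _ (proj2 Hx)) as [L | ->]; [|lra].
    assert (- phi x < - phi nu).
    { apply (is_derive_pos_increasing (fun x => - phi x) (fun x => - phase_rate nu x)); auto.
      - intros t Ht. apply (is_derive_opp (V := R_NormedModule) phi). apply D. lra.
      - intros t Ht. pose proof (proj2 (phase_rate_sign nu t Hnu ltac:(lra)) ltac:(lra)). lra. }
    lra.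
Qed.

(** * Zeros in increasing order *)

(** The list in [is_kth_positive_zero] has the same elements as an initial segment of the
    enumeration, which fixes its length. *)
Lemma kth_positive_zero_enum (f : R -> R) (z : nat -> R) :
  (forall k, (1 <= k)%nat -> 0 < z k) -> (forall k, (1 <= k)%nat -> z k < z (S k)) ->
  (forall x, 0 < x -> (f x = 0 <-> exists k, (1 <= k)%nat /\ x = z k)) ->
  forall k, (1 <= k)%nat -> kth_positive_zero f k = z k.
Proof.
  intros Hpos Hinc Hz k Hk.
  assert (Mon : forall a b, (1 <= a < b)%nat -> z a < z b).
  { intros a b [Ha Hab]. induction Hab as [|b Hab IH]; [apply Hinc; auto|].
    apply Rlt_trans with (1 := IH). apply Hinc. lia. }
  assert (Inj : forall a b, (1 <= a)%nat -> (1 <= b)%nat -> z a < z b -> (a < b)%nat).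
  { intros a b Ha Hb H. destruct (Nat.lt_trichotomy a b) as [L | [L | L]]; auto.
    - subst. lra.
    - pose proof (Mon b a ltac:(lia)). lra. }
  assert (Spec : forall j, (1 <= j)%nat -> NoDup (map z (seq 1 (j - 1))) /\
     S (length (map z (seq 1 (j - 1)))) = j /\
     forall x, In x (map z (seq 1 (j - 1))) <-> (0 < x < z j /\ f x = 0)).
  { intros j Hj. split; [|split].
    - apply NoDup_map_NoDup_ForallPairs; [|apply seq_NoDup].
      intros a b Ha Hb E. apply in_seq in Ha. apply in_seq in Hb.
      destruct (Nat.lt_trichotomy a b) as [L | [L | L]]; auto.
      + pose proof (Mon a b ltac:(lia)). lra.
      + pose proof (Mon b a ltac:(lia)). lra.
    - rewrite length_map, length_seq. lia.
    - intros x. rewrite in_map_iff. split.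
      + intros [a [<- Ha]]. apply in_seq in Ha. split; [split; [apply Hpos; lia | apply Mon; lia]|].
        apply Hz; [apply Hpos; lia | exists a; split; [lia | auto]].
      + intros [[H1 H2] H3]. apply Hz in H3; auto. destruct H3 as [a [Ha ->]].
        exists a. split; auto. apply in_seq. pose proof (Inj a j Ha Hj H2). lia. }
  assert (Ex : is_kth_positive_zero f k (z k)).
  { split; [apply Hpos; auto|]. split.
    - apply Hz; [apply Hpos; auto | exists k; auto].
    - exists (map z (seq 1 (k - 1))). apply Spec; auto. }
  destruct (the_real_spec (is_kth_positive_zero f k) (ex_intro _ _ Ex)) as [S1 [S2 [l [L1 [L2 L3]]]]].
  fold (kth_positive_zero f k) in *. set (x := kth_positive_zero f k) in *.
  apply Hz in S2; auto. destruct S2 as [j [Hj Ej]].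
  destruct (Spec j Hj) as [N1 [N2 N3]].
  assert (Len : length l = length (map z (seq 1 (j - 1)))).
  { apply Nat.le_antisymm; apply NoDup_incl_length; auto; intros w Hw.
    - apply N3. rewrite <- Ej. apply L3. auto.
    - apply L3. rewrite Ej. apply N3. auto. }
  rewrite Ej. f_equal. lia.
Qed.

Section Zeros.

Variables (nu : R) (phi : R -> R).
Hypothesis Hnu : 0 <= nu.
Hypothesis Hphase : is_phase nu phi.
Hypothesis Low : forall x, nu < x -> phi_lower nu x < phi x.
Hypothesis Up : forall x, x_star nu <= x -> phi x < phi_tilde nu x.
Hypothesis Inc : forall x y, 0 < x -> nu <= x -> x < y -> phi x < phi y.
Hypothesis Before : forall x, 0 < x <= nu -> 0 < phi x < PI / 2.
Hypothesis Zero : nu = 0 -> forall x, 0 < x -> PI / 2 < phi x.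
Hypothesis Cphi : forall x, 0 < x -> continuous phi x.

(** From [PI / 2] on every phase is attained to the right of [nu], except that for
    [nu = 0] the value [PI / 2] belongs to the origin. *)
Definition admissible (v : R) : Prop := PI / 2 <= v /\ (nu = 0 -> PI / 2 < v).

Lemma phase_surjective v : admissible v -> exists x, nu < x /\ phi x = v.
Proof.
  intros [Hv Hv0]. pose proof PI_bounds.
  assert (S : exists x0, 0 < x0 /\ nu <= x0 /\ phi x0 < v \/ 0 < x0 /\ nu = x0 /\ phi x0 < v).
  { destruct (Rle_lt_or_eq_dec 0 nu Hnu) as [Hp | E].
    - exists nu. right. pose proof (Before nu ltac:(lra)). lra.
    - destruct Hphase as [_ T]. specialize (Hv0 (eq_sym E)).
      destruct (tends0_below phi (PI / 2) v T Hv0) as [x [X1 X2]]. exists x. left. lra. }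
  assert (S' : exists x0, 0 < x0 /\ nu <= x0 /\ phi x0 < v)
    by (destruct S as [x0 [S | S]]; exists x0; lra).
  destruct S' as [x0 [S1 [S2 S3]]].
  destruct (phi_lower_unbounded nu v Hnu) as [x1 [U1 U2]]. pose proof (Low x1 U1).
  assert (x0 < x1).
  { destruct (Rtotal_order x0 x1) as [L | [L | L]]; auto.
    - subst. lra.
    - pose proof (Inc x1 x0 ltac:(lra) ltac:(lra) L). lra. }
  destruct (ivt phi x0 x1 v) as [c [C1 C2]]; [lra | intros; apply Cphi; lra | lra |].
  exists c. split; auto.
  destruct (Rle_lt_or_eq_dec nu c ltac:(lra)) as [L | L]; auto. exfalso.
  subst c. pose proof (Before nu ltac:(lra)). lra.
Qed.

Definition phase_point (v : R) : R := the_real (fun x => nu < x /\ phi x = v).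

Lemma phase_point_spec v : admissible v -> nu < phase_point v /\ phi (phase_point v) = v.
Proof. intros H. apply (the_real_spec (fun x => nu < x /\ phi x = v)), phase_surjective, H. Qed.

Lemma phase_injective x y : nu < x -> nu < y -> phi x = phi y -> x = y.
Proof.
  intros Hx Hy E. destruct (Rtotal_order x y) as [L | [L | L]]; auto.
  - pose proof (Inc x y ltac:(lra) ltac:(lra) L). lra.
  - pose proof (Inc y x ltac:(lra) ltac:(lra) L). lra.
Qed.

Lemma phi_lower_inv_spec v : PI / 4 < v ->
  nu <= phi_lower_inv nu v /\ phi_lower nu (phi_lower_inv nu v) = v.
Proof.
  intros Hv. apply (the_real_spec (fun x => nu <= x /\ phi_lower nu x = v)).
  set (s0 := (v - PI / 4) / 2). assert (Hs : 0 < s0) by (unfold s0; lra).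
  set (x0 := sqrt (nu ^ 2 + s0 ^ 2)). pose proof (pow2_ge_0 nu).
  assert (X2 : x0 ^ 2 = nu ^ 2 + s0 ^ 2) by (apply pow2_sqrt; nra).
  assert (X0 : 0 < x0) by (apply sqrt_lt_R0; nra).
  assert (X1 : nu < x0) by nra.
  assert (Er : root_r nu x0 = s0).
  { unfold root_r. rewrite X2. replace (nu ^ 2 + s0 ^ 2 - nu ^ 2) with (s0 ^ 2) by ring.
    apply sqrt_pow2. lra. }
  pose proof (phi_lower_le nu x0 ltac:(lra)) as B. rewrite Er in B.
  destruct (phi_lower_unbounded nu v Hnu) as [x1 [U1 U2]].
  assert (x0 < x1).
  { destruct (Rtotal_order x0 x1) as [L | [L | L]]; auto.
    - rewrite <- L in U2. unfold s0 in B. lra.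
    - pose proof (phi_lower_increasing nu x1 x0 ltac:(lra) L). unfold s0 in B. lra. }
  destruct (ivt (phi_lower nu) x0 x1 v) as [c [C1 C2]]; [lra| |unfold s0 in B; lra|].
  - intros y Hy. eapply continuous_of_derive. apply is_derive_phi_lower. lra.
  - exists c. split; [lra | auto].
Qed.

Lemma phi_tilde_inv_spec v : z_star nu <= v ->
  x_star nu <= phi_tilde_inv nu v /\ phi_tilde nu (phi_tilde_inv nu v) = v.
Proof.
  intros Hv. apply (the_real_spec (fun x => x_star nu <= x /\ phi_tilde nu x = v)).
  destruct (x_star_spec nu Hnu) as [X1 _].
  destruct (phi_lower_unbounded nu v Hnu) as [x1 [U1 U2]].
  assert (B : v < phi_tilde nu x1).
  { rewrite phi_tilde_root by lra. destruct (root_r_spec nu x1 ltac:(lra)) as [R1 _].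
    assert (0 < (9 * root_r nu x1 ^ 2 + 7 * nu ^ 2) / (24 * root_r nu x1 ^ 3)).
    { pose proof (pow2_ge_0 nu). assert (0 < root_r nu x1 ^ 3) by (apply pow_lt; auto).
      apply Rdiv_lt_0_compat; nra. }
    lra. }
  set (x2 := Rmax (x_star nu) x1).
  assert (v <= phi_tilde nu x2).
  { unfold x2, Rmax. destruct (Rle_dec (x_star nu) x1) as [L | L]; [lra|].
    pose proof (z_star_le nu x1 ltac:(lra)). unfold z_star in Hv.
    destruct (phi_lower_unbounded nu v Hnu) as [x3 [U3 U4]].
    pose proof (z_star_le nu (x_star nu) ltac:(lra)).
    pose proof (Up (x_star nu) ltac:(lra)). pose proof (Low (x_star nu) X1).
    pose proof (phi_lower_increasing nu x1 (x_star nu) ltac:(lra) ltac:(lra)). lra. }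
  destruct (ivt (phi_tilde nu) (x_star nu) x2 v) as [c [C1 C2]].
  - apply Rmax_l.
  - intros y Hy. eapply continuous_of_derive. apply is_derive_phi_tilde. lra.
  - split; [exact Hv | auto].
  - exists c. split; [lra | auto].
Qed.

Lemma point_lt_upper x v : nu < x -> phi x = v -> x < phi_lower_inv nu v.
Proof.
  intros Hx E. pose proof (Low x Hx). pose proof (phi_lower_gt nu x ltac:(lra)).
  destruct (phi_lower_inv_spec v ltac:(lra)) as [S1 S2]. set (u := phi_lower_inv nu v) in *.
  destruct (Rlt_le_dec x u) as [|L]; auto. exfalso.
  destruct (Rle_lt_or_eq_dec _ _ S1) as [S3 | S3].
  - destruct (Rle_lt_or_eq_dec _ _ L) as [L1 | L1]; [|rewrite L1 in S2; lra].
    pose proof (phi_lower_increasing nu u x ltac:(lra) L1). lra.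
  - rewrite <- S3, phi_lower_at in S2 by auto. lra.
Qed.

(** [phi_tilde_inv] takes values beyond [x_star], so one first needs [x_star < x]; this is
    where the strict inequality at [x_star] enters. *)
Lemma lower_lt_point x v : nu < x -> phi x = v -> z_star nu <= v -> phi_tilde_inv nu v < x.
Proof.
  intros Hx E Hz. destruct (phi_tilde_inv_spec v Hz) as [S1 S2]. set (u := phi_tilde_inv nu v) in *.
  destruct (x_star_spec nu Hnu) as [X1 _]. pose proof (Up (x_star nu) (Rle_refl _)) as U.
  fold (z_star nu) in U.
  assert (Hxs : x_star nu < x).
  { destruct (Rtotal_order (x_star nu) x) as [L | [L | L]]; auto.
    - rewrite L in U. lra.
    - pose proof (Inc x (x_star nu) ltac:(lra) ltac:(lra) L). lra. }
  pose proof (Up x ltac:(lra)).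
  destruct (Rlt_le_dec u x) as [|L]; auto. exfalso.
  destruct (Rle_lt_or_eq_dec _ _ L) as [L1 | L1].
  - pose proof (phi_tilde_increasing nu x u Hnu ltac:(lra) L1). lra.
  - rewrite <- L1 in S2. lra.
Qed.

Lemma modulus_pos x : 0 < x -> 0 < modulus nu x.
Proof. intros Hx. rewrite modulus_eq by auto. apply sqrt_lt_R0, mod2_pos; auto. Qed.

Lemma zeros_by_phase (f : R -> R) (v : nat -> R) :
  (forall k, (1 <= k)%nat -> admissible (v k)) -> (forall k, (1 <= k)%nat -> v k < v (S k)) ->
  (forall x, 0 < x -> (f x = 0 <-> exists k, (1 <= k)%nat /\ phi x = v k)) ->
  forall k, (1 <= k)%nat -> nu < kth_positive_zero f k /\ phi (kth_positive_zero f k) = v k.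
Proof.
  intros Ha Hv Hf k Hk.
  rewrite (kth_positive_zero_enum f (fun k => phase_point (v k))); auto.
  - apply phase_point_spec; auto.
  - intros j Hj. destruct (phase_point_spec (v j) (Ha j Hj)). lra.
  - intros j Hj. destruct (phase_point_spec (v j) (Ha j Hj)) as [A1 A2].
    destruct (phase_point_spec (v (S j)) (Ha (S j) ltac:(lia))) as [B1 B2].
    destruct (Rtotal_order (phase_point (v j)) (phase_point (v (S j)))) as [L | [L | L]]; auto.
    + specialize (Hv j Hj). rewrite L in A2. lra.
    + specialize (Hv j Hj). pose proof (Inc (phase_point (v (S j))) (phase_point (v j)) ltac:(lra) ltac:(lra) L). lra.
  - intros x Hx. rewrite (Hf x Hx). split; intros [j [Hj E]]; exists j; split; auto.
    + destruct (Ha j Hj) as [P1 P2]. destruct (phase_point_spec (v j) (Ha j Hj)) as [A1 A2].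
      apply phase_injective; auto; [|lra].
      destruct (Rle_lt_dec x nu) as [L|L]; auto. exfalso.
      pose proof (Before x ltac:(lra)). lra.
    + rewrite E. apply phase_point_spec; auto.
Qed.

Lemma phi_pos x : 0 < x -> 0 < phi x.
Proof.
  intros Hx. pose proof PI_bounds. destruct (Rle_lt_dec x nu) as [L | L].
  - apply Before. lra.
  - pose proof (Low x L). pose proof (phi_lower_gt nu x ltac:(lra)). lra.
Qed.

Lemma dJ_zero_iff x : 0 < x ->
  (dJ nu x = 0 <-> exists k, (1 <= k)%nat /\ phi x = PI * (INR k - 1 / 2)).
Proof.
  intros Hx. destruct Hphase as [HP _]. destruct (HP x Hx) as [_ [E _]].
  pose proof (modulus_pos x Hx) as M. pose proof (phi_pos x Hx) as Pp. pose proof PI_bounds as HPI.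
  rewrite E. split.
  - intros H. apply Rmult_integral in H. destruct H as [H | H]; [lra|].
    apply cos_eq_0_0 in H. destruct H as [m Hm].
    assert (Hm0 : (0 <= m)%Z).
    { assert (-1 < IZR m) by nra. apply lt_IZR in H. lia. }
    exists (S (Z.to_nat m)). split; [lia|].
    rewrite S_INR, INR_IZR_INZ, Z2Nat.id by auto. rewrite Hm. field.
  - intros [k [Hk Ek]]. rewrite Ek.
    replace (PI * (INR k - 1 / 2)) with (IZR (Z.of_nat k - 1) * PI + PI / 2).
    + rewrite cos_eq_0_1; [ring|]. exists (Z.of_nat k - 1)%Z. reflexivity.
    + rewrite minus_IZR, <- INR_IZR_INZ. field.
Qed.

Lemma dY_zero_iff x : 0 < x ->
  (dY nu x = 0 <-> exists k, (1 <= k)%nat /\ phi x = PI * INR k).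
Proof.
  intros Hx. destruct Hphase as [HP _]. destruct (HP x Hx) as [_ [_ E]].
  pose proof (modulus_pos x Hx) as M. pose proof (phi_pos x Hx) as Pp. pose proof PI_bounds as HPI.
  rewrite E. split.
  - intros H. apply Rmult_integral in H. destruct H as [H | H]; [lra|].
    apply sin_eq_0_0 in H. destruct H as [m Hm].
    assert (Hm0 : (1 <= m)%Z).
    { assert (0 < IZR m) by nra. apply lt_IZR in H. lia. }
    exists (Z.to_nat m). split; [lia|].
    rewrite INR_IZR_INZ, Z2Nat.id by lia. rewrite Hm. ring.
  - intros [k [Hk Ek]]. rewrite Ek.
    rewrite sin_eq_0_1; [ring|]. exists (Z.of_nat k). rewrite <- INR_IZR_INZ. ring.
Qed.

Lemma y'_phase k : (1 <= k)%nat -> nu < y' nu k /\ phi (y' nu k) = PI * INR k.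
Proof.
  pose proof PI_bounds as HPI.
  apply (zeros_by_phase (dY nu) (fun k => PI * INR k)).
  - intros j Hj. apply le_INR in Hj. simpl in Hj. split; [nra | intros; nra].
  - intros j Hj. rewrite S_INR. nra.
  - apply dY_zero_iff.
Qed.

Lemma j'_phase k : (1 <= k)%nat -> (nu = 0 -> (2 <= k)%nat) ->
  nu < j' nu k /\ phi (j' nu k) = PI * (INR k - 1 / 2).
Proof.
  intros Hk Hk0. pose proof PI_bounds as HPI. unfold j'. destruct (Req_EM_T nu 0) as [E | E].
  - specialize (Hk0 E). destruct (Nat.eqb_spec k 1) as [|_]; [lia|].
    replace (PI * (INR k - 1 / 2)) with (PI * (INR (k - 1) + 1 / 2))
      by (rewrite minus_INR by lia; simpl; field).
    apply (zeros_by_phase (dJ nu) (fun k => PI * (INR k + 1 / 2))); [| | |lia].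
    + intros j Hj. apply le_INR in Hj. simpl in Hj. split; [nra | intros; nra].
    + intros j Hj. rewrite S_INR. nra.
    + intros x Hx. rewrite (dJ_zero_iff x Hx). split; intros [j [Hj Ej]].
      * assert (1 < INR j) by (pose proof (Zero E x Hx); nra).
        assert (Hj2 : (1 < j)%nat) by (apply INR_lt; simpl; auto).
        exists (j - 1)%nat. split; [lia|]. rewrite Ej, minus_INR by lia. simpl. field.
      * exists (S j). split; [lia|]. rewrite Ej, S_INR. field.
  - apply (zeros_by_phase (dJ nu) (fun k => PI * (INR k - 1 / 2))); auto.
    + intros j Hj. apply le_INR in Hj. simpl in Hj. split; [nra | intros; contradiction].
    + intros j Hj. rewrite S_INR. nra.
    + apply dJ_zero_iff.
Qed.

Lemma j'_0_1 : nu = 0 -> j' nu 1 = 0.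
Proof. intros E. unfold j'. destruct (Req_EM_T nu 0); [reflexivity | contradiction]. Qed.

Lemma phase_eq x : 0 < x -> phase nu x = phi x.
Proof.
  intros Hx. unfold phase. destruct (Rle_dec x 0) as [|_]; [lra|].
  apply (is_phase_unique nu); auto.
  apply (epsilon_spec (inhabits (fun _ : R => 0)) (is_phase nu)). exists phi. exact Hphase.
Qed.

Lemma phase_inv_admissible v : admissible v ->
  nu < phase_inv nu v /\ phi (phase_inv nu v) = v.
Proof.
  intros Hv. pose proof PI_bounds as HPI.
  assert (J : nu = 0 /\ j' nu 1 = 0 \/ 0 < nu /\ nu < j' nu 1 /\ phi (j' nu 1) = PI / 2).
  { destruct (Rle_lt_or_eq_dec 0 nu Hnu) as [Hp | E].
    - right. destruct (j'_phase 1 ltac:(lia) ltac:(intros; lra)) as [J1 J2].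
      split; [auto|]. split; [auto|]. rewrite J2. simpl. field.
    - left. split; [auto | apply j'_0_1; auto]. }
  assert (Ex : exists x, j' nu 1 <= x /\ phase nu x = v).
  { destruct (phase_surjective v Hv) as [x [X1 X2]]. exists x.
    split; [|rewrite phase_eq; [auto | lra]].
    destruct J as [[J1 J2] | [J1 [J2 J3]]]; [lra|].
    destruct (Rle_lt_dec (j' nu 1) x) as [|L]; auto. exfalso.
    pose proof (Inc x (j' nu 1) ltac:(lra) ltac:(lra) L). destruct Hv. lra. }
  destruct (the_real_spec (fun x => j' nu 1 <= x /\ phase nu x = v) Ex) as [S1 S2].
  fold (inverse_on (fun x => j' nu 1 <= x) (phase nu) v) in S1, S2.
  fold (phase_inv nu v) in S1, S2. set (x := phase_inv nu v) in *.
  assert (Hx : nu < x).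
  { destruct J as [[J1 J2] | [J1 [J2 J3]]]; [|lra].
    destruct (Rle_lt_or_eq_dec (j' nu 1) x S1) as [L | L]; [lra|]. exfalso.
    unfold phase in S2. destruct (Rle_dec x 0) as [|N]; [|lra].
    destruct Hv as [_ Hv]. specialize (Hv J1). lra. }
  rewrite phase_eq in S2 by lra. auto.
Qed.

Lemma phase_inv_0 : nu = 0 -> phase_inv nu (PI / 2) = 0.
Proof.
  intros E.
  assert (Ex : exists x, j' nu 1 <= x /\ phase nu x = PI / 2).
  { exists 0. rewrite j'_0_1 by auto. split; [lra|]. unfold phase. destruct (Rle_dec 0 0); [auto|lra]. }
  destruct (the_real_spec (fun x => j' nu 1 <= x /\ phase nu x = PI / 2) Ex) as [S1 S2].
  fold (inverse_on (fun x => j' nu 1 <= x) (phase nu) (PI / 2)) in S1, S2.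
  fold (phase_inv nu (PI / 2)) in S1, S2. set (x := phase_inv nu (PI / 2)) in *.
  rewrite j'_0_1 in S1 by auto. destruct (Rle_lt_or_eq_dec _ _ S1) as [L | L]; auto.
  rewrite phase_eq in S2 by auto. pose proof (Zero E x L). lra.
Qed.

Lemma c'_phase tau k : 0 <= tau -> (1 <= k)%nat ->
  nu < c' nu tau k /\ phi (c' nu tau k) = PI * (tau + INR k - 1 / 2) \/
  nu = 0 /\ tau = 0 /\ k = 1%nat /\ c' nu tau k = 0.
Proof.
  intros Ht Hk. pose proof PI_bounds as HPI. unfold c'.
  assert (1 <= INR k) by (change 1 with (INR 1); apply le_INR; auto).
  destruct (Req_dec (tau + INR k - 1 / 2) (1 / 2)) as [E | E].
  - assert (Ek : INR k = 1) by lra. assert (tau = 0) by lra.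
    rewrite E. replace (PI * (1 / 2)) with (PI / 2) by field.
    destruct (Req_dec nu 0) as [N | N].
    + right. split; [auto|]. split; [auto|]. split; [apply INR_eq; simpl; auto|].
      apply phase_inv_0; auto.
    + left. apply phase_inv_admissible. split; [lra | intros; contradiction].
  - left. apply phase_inv_admissible. split; [nra | intros; nra].
Qed.

End Zeros.

Lemma threshold_closed_form : 1 / PI * z_star 0 - 1 / 2 = 1 / PI * sqrt (3 / 2) - 1 / 4.
Proof. pose proof PI_bounds. rewrite z_star_0. field. lra. Qed.

Lemma threshold_numeric :
  Rabs (1 / PI * sqrt (3 / 2) - 1 / 4 - 139848 / 1000000) < 5 / 10000000.
Proof.
  pose proof PI_bounds as P. pose proof sqrt_3_2_bounds as S. set (q := 1 / PI * sqrt (3 / 2)).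
  assert (E : q * PI = sqrt (3 / 2)) by (unfold q; field; lra).
  apply Rabs_def1.
  - destruct (Rlt_le_dec q (3898485 / 10000000)) as [|L]; [lra|]. exfalso. nra.
  - destruct (Rlt_le_dec (3898475 / 10000000) q) as [|L]; [lra|]. exfalso. nra.
Qed.

Theorem corollary1p12 :
  forall nu : R, 0 <= nu ->
  (* (i) *)
  ( (forall k : nat, (2 <= k)%nat ->
       phi_tilde_inv nu (PI * (INR k - 1 / 2)) < j' nu k
       < phi_lower_inv nu (PI * (INR k - 1 / 2))) /\
    j' nu 1 < phi_lower_inv nu (PI / 2) /\
    (z_star nu <= PI / 2 -> phi_tilde_inv nu (PI / 2) < j' nu 1) ) /\
  (* (ii) *)
  (forall k : nat, (1 <= k)%nat ->
     phi_tilde_inv nu (PI * INR k) < y' nu k < phi_lower_inv nu (PI * INR k)) /\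
  (* (iii) *)
  ( (forall (tau : R) (k : nat), 0 <= tau < 1 -> (2 <= k)%nat ->
       phi_tilde_inv nu (PI * (tau + INR k - 1 / 2)) < c' nu tau k
       < phi_lower_inv nu (PI * (tau + INR k - 1 / 2))) /\
    (forall tau : R, 0 <= tau < 1 ->
       c' nu tau 1 < phi_lower_inv nu (PI * (tau + 1 / 2))) /\
    (forall tau : R, 0 <= tau < 1 ->
       z_star nu <= PI * (tau + 1 / 2) ->
       phi_tilde_inv nu (PI * (tau + 1 / 2)) < c' nu tau 1) /\
    (forall tau : R, 0 <= tau < 1 ->
       1 / PI * z_star 0 - 1 / 2 <= tau ->
       phi_tilde_inv nu (PI * (tau + 1 / 2)) < c' nu tau 1) /\
    1 / PI * z_star 0 - 1 / 2 = 1 / PI * sqrt (3 / 2) - 1 / 4 /\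
    Rabs (1 / PI * sqrt (3 / 2) - 1 / 4 - 139848 / 1000000) < 5 / 10000000 ).
Proof.
  intros nu Hnu. pose proof PI_bounds as HPI.
  destruct (phase_enclosure nu Hnu) as [phi [HP [Low [Up [Inc [Bef [Zer Cp]]]]]]].
  assert (Upper := fun x v => point_lt_upper nu phi Hnu Low x v).
  assert (Lower := fun x v => lower_lt_point nu phi Hnu Low Up Inc x v).
  assert (J := fun k => j'_phase nu phi Hnu HP Low Inc Bef Zer Cp k).
  assert (Y := fun k => y'_phase nu phi Hnu HP Low Inc Bef Cp k).
  assert (C := fun tau k => c'_phase nu phi Hnu HP Low Inc Bef Zer Cp tau k).
  pose proof (z_star_small nu Hnu) as Zs.
  (* for [nu = 0] the value [PI / 2] of the phase is attained at the origin, which no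
     enclosure covers *)
  assert (Up0 : nu = 0 -> 0 < phi_lower_inv nu (PI / 2)).
  { intros E. destruct (phi_lower_inv_spec nu Hnu (PI / 2) ltac:(lra)) as [S1 S2].
    destruct (Rle_lt_or_eq_dec _ _ S1) as [L | L]; [lra|].
    rewrite <- L, phi_lower_at in S2 by auto. lra. }
  assert (Z0 : nu = 0 -> PI / 2 < z_star nu).
  { intros ->. rewrite z_star_0. pose proof sqrt_3_2_bounds. lra. }
  assert (C1 : forall tau, 0 <= tau < 1 -> z_star nu <= PI * (tau + 1 / 2) ->
     phi_tilde_inv nu (PI * (tau + 1 / 2)) < c' nu tau 1).
  { intros tau Ht Hz. destruct (C tau 1%nat) as [[X1 X2] | [X1 [X2 _]]]; [lra | lia | |].
    - simpl in X2. replace (tau + 1 - 1 / 2) with (tau + 1 / 2) in X2 by field. auto.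
    - specialize (Z0 X1). subst tau. nra. }
  split; [split; [|split]|split].
  - intros k Hk. destruct (J k) as [X1 X2]; [lia | auto |].
    apply le_INR in Hk. simpl in Hk.
    split; [apply Lower | apply Upper]; auto. nra.
  - destruct (Req_dec nu 0) as [E | E].
    + rewrite j'_0_1 by auto. auto.
    + destruct (J 1%nat) as [X1 X2]; [lia | intros; contradiction |].
      apply Upper; auto. rewrite X2. simpl. field.
  - intros Hz. destruct (Req_dec nu 0) as [E | E]; [specialize (Z0 E); lra|].
    destruct (J 1%nat) as [X1 X2]; [lia | intros; contradiction |].
    apply Lower; auto. rewrite X2. simpl. field.
  - intros k Hk. destruct (Y k Hk) as [X1 X2]. apply le_INR in Hk. simpl in Hk.
    split; [apply Lower | apply Upper]; auto. nra.
  - split; [|split; [|split; [|split; [|split]]]].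
    + intros tau k Ht Hk. destruct (C tau k) as [[X1 X2] | [_ [_ [X _]]]]; [lra | lia | | lia].
      apply le_INR in Hk. simpl in Hk.
      split; [apply Lower | apply Upper]; auto. nra.
    + intros tau Ht. destruct (C tau 1%nat) as [[X1 X2] | [X1 [X2 [_ X3]]]]; [lra | lia | |].
      * apply Upper; auto. rewrite X2. simpl. f_equal. field.
      * rewrite X3, X2. replace (PI * (0 + 1 / 2)) with (PI / 2) by field. auto.
    + exact C1.
    + intros tau Ht Hz. apply C1; auto. apply Rle_trans with (1 := z_star_le_0 nu Hnu).
      replace (z_star 0) with (PI * (1 / PI * z_star 0 - 1 / 2 + 1 / 2)) by (field; lra).
      apply Rmult_le_compat_l; lra.
    + apply threshold_closed_form.
    + apply threshold_numeric.
Qed.
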